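(* Let $\frac12<\gamma\le1$, let $\Omega\subset\mathbb{R}^m$ be open, and let $f\in C^{0,\gamma}_{\rm loc}(\Omega;\mathbb{R}^{2n+1})$. Then $f\in C^{0,\gamma}_{\rm loc}(\Omega;\mathbb{H}^n)$ if and only if $f^*\alpha=0$ in the distributional sense, i.e. $$\langle f^*\alpha,\phi\rangle=\int_\Omega f^*\alpha\wedge\phi=0\qquad\text{for all }\phi\in\Omega_c^{m-1}(\Omega).$$
   Context: Heisenberg group: $\mathbb{H}^n$ is $\mathbb{R}^{2n+1}$ with coordinates $(z,t)=(x_1,y_1,\dots,x_n,y_n,t)$, regarded as a metric space with the Korányi metric $$d_K\big((z,t),(z',t')\big)=\Big(|z-z'|^4+\Big|t-t'+2\sum_{j=1}^n(x_j'y_j-x_jy_j')\Big|^2\Big)^{1/4}.$$ The standard contact form is $\alpha=dt+2\sum_{j=1}^n(x_j\,dy_j-y_j\,dx_j)$. For a metric space $Y$, $C^{0,\gamma}_{\rm loc}(\Omega;Y)$ is the set of maps $f:\Omega\to Y$ that are $\gamma$-Hölder continuous on every compact subset of $\Omega$ ($\mathbb{R}^{2n+1}$ carries the Euclidean metric). $\Omega_c^{m-1}(\Omega)$ denotes the smooth compactly supported $(m-1)$-forms on $\Omega$. Distributional pullback: for $f\in C^{0,\gamma}_{\rm loc}(\Omega;\mathbb{R}^{2n+1})$ with $\gamma>\frac12$ and $\phi\in\Omega_c^{m-1}(\Omega)$, one defines $$\int_\Omega f^*\alpha\wedge\phi:=\lim_{\varepsilon\to0^+}\int_\Omega (f^\varepsilon)^*\alpha\wedge\phi,$$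 where $f^\varepsilon$ are smooth maps converging pointwise to $f$ with $\sup_\varepsilon\|f^\varepsilon\|_{C^{0,\gamma}(K)}<\infty$ for every compact $K\subset\Omega$ (for instance, $f^\varepsilon=f*\eta_\varepsilon$, a standard mollification, near the support of $\phi$). The limit exists and does not depend on the approximation. *)

(* Defs.v *)
From HB Require Import structures.
From mathcomp Require Import all_boot all_order all_algebra.
From mathcomp Require Import all_classical all_reals all_analysis.

Set Implicit Arguments.
Unset Strict Implicit.
Unset Printing Implicit Defensive.

Import Order.TTheory GRing.Theory Num.Theory.
Import numFieldNormedType.Exports.

Local Open Scope classical_set_scope.
Local Open Scope ring_scope.

(* Lebesgue measure on R^n.  The measurable sets of 'rV[R]_n are those of the
   sigma-algebra generated by the coordinates, i.e. the Borel sets. *)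

Fact rV_display : measure_display.
Proof. by []. Qed.

Definition rV_measurable (R : realType) (n : nat) : set (set 'rV[R]_n) :=
  g_sigma_preimage (fun (i : 'I_n) (v : 'rV[R]_n) => v ord0 i : measurableTypeR R).

HB.instance Definition _ (R : realType) (n : nat) :=
  @isMeasurable.Build rV_display 'rV[R]_n (@rV_measurable R n)
    (@sigma_algebra0 _ _ _) (@sigma_algebraC _ _)
    (@sigma_algebra_bigcup _ _ _).

Lemma measurable_coord (R : realType) (n : nat) (i : 'I_n) :
  measurable_fun [set: 'rV[R]_n] (fun v => v ord0 i : measurableTypeR R).
Proof.
move=> _ Y mY; rewrite setTI; apply: sub_sigma_algebra => /=.
rewrite -bigcup_seq/=; exists i => /=; first by rewrite mem_index_enum.
by exists Y => //; rewrite setTI.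
Qed.

Lemma measurable_fun_rV d (T : measurableType d) (R : realType) (n : nat)
    (f : T -> 'rV[R]_n) :
  (forall i, measurable_fun setT (fun x => f x ord0 i : measurableTypeR R)) ->
  measurable_fun setT f.
Proof.
move=> mf _ A mA; rewrite setTI.
pose G := [set B : set 'rV[R]_n | measurable (f @^-1` B)].
suff : (@rV_measurable R n) `<=` G by exact.
apply: smallest_sub.
  split.
  - by rewrite /G/= preimage_set0.
  - by move=> B GB; rewrite /G/= setTD preimage_setC; exact: measurableC.
  - by move=> F GF; rewrite /G/= preimage_bigcup; exact: bigcupT_measurable.
move=> B; rewrite -bigcup_seq => -[i _ [Y mY <-]].
by rewrite /G/= setTI -[X in measurable X]setTI; exact: mf.
Qed.

Definition consrV (R : realType) (n : nat) (p : measurableTypeR R * 'rV[R]_n) :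
    'rV[R]_n.+1 :=
  \row_i oapp (fun j => p.2 ord0 j) p.1 (unlift ord0 i).

Lemma consrV0 (R : realType) (n : nat) (p : measurableTypeR R * 'rV[R]_n) :
  consrV p ord0 ord0 = p.1.
Proof. by rewrite mxE unlift_none. Qed.

Lemma consrVS (R : realType) (n : nat) (p : measurableTypeR R * 'rV[R]_n) i :
  consrV p ord0 (lift ord0 i) = p.2 ord0 i.
Proof. by rewrite mxE liftK. Qed.

Lemma measurable_consrV (R : realType) (n : nat) :
  measurable_fun setT (@consrV R n).
Proof.
apply: measurable_fun_rV => i; case: (unliftP ord0 i) => [j|] ->.
  under eq_fun do rewrite consrVS.
  exact: (measurableT_comp (measurable_coord j) measurable_snd).
by under eq_fun do rewrite consrV0; exact: measurable_fst.
Qed.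

Definition lebesgue_cons (R : realType) (n : nat)
    (mu : {sigma_finite_measure set 'rV[R]_n -> \bar R}) :
    set 'rV[R]_n.+1 -> \bar R :=
  pushforward (lebesgue_measure \x mu)%E (@consrV R n).

HB.instance Definition _ (R : realType) (n : nat)
    (mu : {sigma_finite_measure set 'rV[R]_n -> \bar R}) :=
  Measure.copy (lebesgue_cons mu)
    (measure_function_pushforward__canonical__measure_function_Measure
      (lebesgue_measure \x mu)%E (@measurable_consrV R n)).

Lemma lebesgue_consX (R : realType) (n : nat)
    (mu : {sigma_finite_measure set 'rV[R]_n -> \bar R})
    (A : set (measurableTypeR R)) (B : set 'rV[R]_n) :
  measurable A -> measurable B ->
  lebesgue_cons mu [set v | A (v ord0 ord0) /\ B (\row_i v ord0 (lift ord0 i))] =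
  (lebesgue_measure A * mu B)%E.
Proof.
move=> mA mB; rewrite -product_measure1E//; congr (product_measure1 _ _ _).
apply/seteqP; split=> -[x v] /=; rewrite consrV0.
all: rewrite (_ : \row_i _ = v) //; apply/rowP => i.
all: by rewrite mxE consrVS.
Qed.

Lemma measurable_cons_rect (R : realType) (n : nat)
    (A : set (measurableTypeR R)) (B : set 'rV[R]_n) :
  measurable A -> measurable B ->
  measurable [set v : 'rV[R]_n.+1 |
    A (v ord0 ord0) /\ B (\row_i v ord0 (lift ord0 i))].
Proof.
move=> mA mB; apply: measurableI.
  by rewrite -[X in measurable X]setTI; exact: measurable_coord.
rewrite -[X in measurable X]setTI.
apply: (measurable_fun_rV (f := fun v : 'rV[R]_n.+1 => _)) => // i.
by under eq_fun do rewrite mxE; exact: measurable_coord.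
Qed.

Lemma lebesgue_cons_sigma_finite (R : realType) (n : nat)
    (mu : {sigma_finite_measure set 'rV[R]_n -> \bar R}) :
  sigma_finite setT (lebesgue_cons mu).
Proof.
have /sigma_finiteP[F [TF ndF Foo]] :=
  sigma_finiteT (@lebesgue_measure R).
have /sigma_finiteP[G [TG ndG Goo]] := sigma_finiteT mu.
exists (fun k => [set v : 'rV[R]_n.+1 | F k (v ord0 ord0) /\
                          G k (\row_i v ord0 (lift ord0 i))]).
  apply/esym/seteqP; split=> // v _.
  have [i _ Fi] : (\bigcup_i F i) (v ord0 ord0) by rewrite -TF.
  have [j _ Gj] : (\bigcup_i G i) (\row_i v ord0 (lift ord0 i)) by rewrite -TG.
  exists (maxn i j) => //; split.
    by move: Fi; exact/subsetPset/ndF/leq_maxl.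
  by move: Gj; exact/subsetPset/ndG/leq_maxr.
move=> k; have [mF ?] := Foo k; have [mG ?] := Goo k; split.
  exact: measurable_cons_rect.
by rewrite lebesgue_consX// lte_mul_pinfty// ge0_fin_numE.
Qed.

HB.instance Definition _ (R : realType) (n : nat)
    (mu : {sigma_finite_measure set 'rV[R]_n -> \bar R}) :=
  Measure_isSigmaFinite.Build _ _ _ (lebesgue_cons mu)
    (@lebesgue_cons_sigma_finite R n mu).

Fixpoint lebesgue_rV (R : realType) (n : nat) :
    {sigma_finite_measure set 'rV[R]_n -> \bar R} :=
  match n with
  | 0%N => dirac (0 : 'rV[R]_0)
  | n'.+1 => lebesgue_cons (lebesgue_rV R n')
  end.
Arguments lebesgue_rV {R n}.

Lemma lebesgue_rV_box (R : realType) (n : nat)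
    (A : 'I_n -> set (measurableTypeR R)) :
  (forall i, measurable (A i)) ->
  lebesgue_rV [set v : 'rV[R]_n | forall i, A i (v ord0 i)] =
  (\prod_(i < n) lebesgue_measure (A i))%E.
Proof.
elim: n => [|n ih] in A * => mA.
  rewrite big_ord0 /= diracE mem_set// => i; by case: i.
rewrite big_ord_recl -ih// -lebesgue_consX//=.
  congr (lebesgue_cons _ _); apply/seteqP; split=> v /=.
    by move=> Av; split=> // i; rewrite mxE.
  move=> [A0 AS] i; case: (unliftP ord0 i) => [j|] -> //.
  by have := AS j; rewrite mxE.
rewrite (_ : [set _ | _] =
    \bigcap_(i in setT) (fun v : 'rV[R]_n => v ord0 i) @^-1` A (lift ord0 i)).
  apply: fin_bigcap_measurable => // i _.
  by rewrite -[X in measurable X]setTI; exact: measurable_coord.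
by apply/seteqP; split=> [v Av i _|v Av i]; exact: Av.
Qed.

(* 'rV[R]_m comes with the sup norm, hence the explicit Euclidean norm. *)
Definition eucl_norm (R : realType) (m : nat) (v : 'rV[R]_m) : R :=
  Num.sqrt (\sum_(i < m) v ord0 i ^+ 2).

Definition eucl_dist (R : realType) (m : nat) (u v : 'rV[R]_m) : R :=
  eucl_norm (u - v).

(* A map on an open set Omega is a function on the whole space of which only
   the values on Omega matter.  The distance dY on the codomain is explicit
   because R^(2n+1) is considered with two different metrics. *)
Definition holder_on (R : realType) (m : nat) (Y : Type) (dY : Y -> Y -> R)
    (gamma : R) (K : set 'rV[R]_m) (f : 'rV[R]_m -> Y) : Prop :=
  exists C : R, forall x y, K x -> K y ->
    dY (f x) (f y) <= C * eucl_dist x y `^ gamma.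

Definition holder_loc (R : realType) (m : nat) (Y : Type) (dY : Y -> Y -> R)
    (gamma : R) (Omega : set 'rV[R]_m) (f : 'rV[R]_m -> Y) : Prop :=
  forall K, compact K -> K `<=` Omega -> holder_on dY gamma K f.

(* Coordinates on R^(2n+1) are ordered as x_1, y_1, ..., x_n, y_n, t. *)
Section Heisenberg.
Context (R : realType) (n : nat).
Implicit Types p q w : 'rV[R]_(2 * n).+1.

Definition heis_x p (j : 'I_n) : R := p ord0 (inord (2 * j)).
Definition heis_y p (j : 'I_n) : R := p ord0 (inord (2 * j).+1).
Definition heis_t p : R := p ord0 ord_max.

Definition heis_zdist p q : R :=
  Num.sqrt (\sum_(j < n) ((heis_x p j - heis_x q j) ^+ 2 +
                          (heis_y p j - heis_y q j) ^+ 2)).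

Definition koranyi_dist p q : R :=
  (heis_zdist p q ^+ 4 +
   `|heis_t p - heis_t q +
     2 * \sum_(j < n) (heis_x q j * heis_y p j - heis_x p j * heis_y q j)| ^+ 2)
  `^ 4^-1.

Definition contact_form p w : R :=
  heis_t w +
  2 * \sum_(j < n) (heis_x p j * heis_y w j - heis_y p j * heis_x w j).

End Heisenberg.

Definition iter_derive (R : realType) (m : nat) (W : normedModType R)
    (vs : seq 'rV[R]_m) (g : 'rV[R]_m -> W) : 'rV[R]_m -> W :=
  foldr (fun v h x => 'D_v h x) g vs.

Definition smooth_on (R : realType) (m : nat) (W : normedModType R)
    (Omega : set 'rV[R]_m) (g : 'rV[R]_m -> W) : Prop :=
  forall (vs : seq 'rV[R]_m) x, Omega x -> differentiable (iter_derive vs g) x.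

(* k-covectors on R^m are alternating k-linear functions of the k rows of a
   matrix; k-forms are functions from R^m to k-covectors. *)
Definition alternating_multilinear (R : realType) (k m : nat)
    (w : 'M[R]_(k, m) -> R) : Prop :=
  (forall (i : 'I_k) (a b : R) (A B C : 'M[R]_(k, m)),
      row i A = a *: row i B + b *: row i C ->
      row' i B = row' i A -> row' i C = row' i A ->
      w A = a * w B + b * w C) /\
  (forall (A : 'M[R]_(k, m)) (i j : 'I_k),
      i != j -> row i A = row j A -> w A = 0).

Definition wedge1 (R : realType) (k m : nat) (a : 'rV[R]_m -> R)
    (w : 'M[R]_(k, m) -> R) (A : 'M[R]_(k.+1, m)) : R :=
  \sum_(i < k.+1) (-1) ^+ i * a (row i A) * w (row' i A).

Definition compactly_supported_form (R : realType) (k m : nat)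
    (Omega : set 'rV[R]_m) (phi : 'rV[R]_m -> 'M[R]_(k, m) -> R) : Prop :=
  [/\ forall x, Omega x -> alternating_multilinear (phi x),
      forall A, smooth_on Omega (fun x => phi x A : R^o) &
      exists K, [/\ compact K, K `<=` Omega &
        forall x, Omega x -> ~ K x -> forall A, phi x A = 0]].

(* The density of a form of top degree is its value on the standard frame. *)
Definition integral_form (R : realType) (m : nat) (Omega : set 'rV[R]_m)
    (theta : 'rV[R]_m -> 'M[R]_m -> R) : R :=
  \int[lebesgue_rV]_(x in Omega) theta x 1%:M.

Definition pullback1 (R : realType) (m N : nat) (g : 'rV[R]_m -> 'rV[R]_N)
    (a : 'rV[R]_N -> 'rV[R]_N -> R) (x v : 'rV[R]_m) : R :=
  a (g x) ('d g x v).

Definition smooth_approximation (R : realType) (m N : nat) (gamma : R)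
    (Omega : set 'rV[R]_m) (f : 'rV[R]_m -> 'rV[R]_N)
    (F : R -> 'rV[R]_m -> 'rV[R]_N) : Prop :=
  [/\ forall eps, 0 < eps -> smooth_on Omega (F eps),
      forall x, Omega x -> F eps x @[eps --> 0^'+] --> f x &
      forall K, compact K -> K `<=` Omega ->
        exists C : R, forall eps, 0 < eps -> forall x y, K x -> K y ->
          eucl_norm (F eps x) <= C /\
          eucl_dist (F eps x) (F eps y) <= C * eucl_dist x y `^ gamma].

(* [distributional_pullback gamma Omega a f phi l] : the integral over Omega of
   f^*a /\ phi, defined as the common limit of the integrals of
   (F eps)^*a /\ phi for all the smooth approximations F of f, is l.  Existence
   of an approximation is required lest the value be undetermined. *)
Definition distributional_pullback (R : realType) (m N : nat) (gamma : R)
    (Omega : set 'rV[R]_m.+1) (a : 'rV[R]_N -> 'rV[R]_N -> R)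
    (f : 'rV[R]_m.+1 -> 'rV[R]_N)
    (phi : 'rV[R]_m.+1 -> 'M[R]_(m, m.+1) -> R) (l : R) : Prop :=
  (exists F, smooth_approximation gamma Omega f F) /\
  (forall F, smooth_approximation gamma Omega f F ->
    integral_form Omega
      (fun x => wedge1 (pullback1 (F eps) a x) (phi x)) @[eps --> 0^'+] --> l).

(* Main.v *)
(* For p, q in R^(2n+1) the number A(p, q) = contact_form p (q - p) is the
   t-component of the Heisenberg product p^-1 q, so that
   A(f x, f y) = O(|x - y|^(2 gamma)) is what the Koranyi Hoelder condition adds
   to the Euclidean one.  A is additive along p, q, s up to the symplectic area
   of (q - p, s - q), which for consecutive values of f at distance |c| is
   O(|c|^(2 gamma)), with 2 gamma > 1.

   Fix a direction v and a test function psi, and let I(s) be the integral of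
   psi(x) A(f x, f(x + s v)).  By almost additivity, and because a translation
   moves from A onto psi, I(s)/s changes by O(s^(2 gamma - 1)) when s is halved.
   For a smooth map I(s)/s tends to the integral of psi f^*alpha(v); summing the
   geometric series bounds the distance between the two by O(s^(2 gamma - 1)),
   with a constant depending only on the Hoelder data of f.  The bound therefore
   holds uniformly along a smooth approximation of f, and compares the
   distributional pullback with I(s)/s for f itself.

   If f is Hoelder for the Koranyi metric then I(s) = O(s^(2 gamma)) and the
   pullback vanishes.  Conversely, if the pullback vanishes, cut the segment
   [x, x + v] into 2^k pieces: the sum of A over the pieces differs from
   A(f x, f(x + v)) by O(|v|^(2 gamma)), while its integral against psi tends to
   0 as k grows; letting psi concentrate at x gives
   A(f x, f(x + v)) = O(|v|^(2 gamma)).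

   Smooth approximations of f, needed for the pullback to be meaningful, are
   finite sums of values of f on a mesh weighted by a smooth partition of unity;
   the values of f outside Omega do not matter. *)

Require Import Defs.
From HB Require Import structures.
From mathcomp Require Import all_boot all_order all_algebra.
From mathcomp Require Import all_classical all_reals all_analysis.
From mathcomp Require Import measurable_realfun.
From mathcomp Require Import ring lra.

Set Implicit Arguments.
Unset Strict Implicit.
Unset Printing Implicit Defensive.

Import Order.TTheory GRing.Theory Num.Theory.
Import numFieldNormedType.Exports.

Local Open Scope classical_set_scope.
Local Open Scope ring_scope.

(** * Lebesgue measure on R^n *)

Lemma ler_norm_coord (R : realType) (n : nat) (v : 'rV[R]_n) (i : 'I_n) :
  `|v ord0 i| <= `|v|.
Proof.
rewrite [leRHS]/Num.Def.normr /= mx_normrE; apply/bigmax_geP; right => /=.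
by exists (ord0, i).
Qed.

Lemma norm_rV_le (R : realType) (n : nat) (v : 'rV[R]_n) (r : R) :
  0 <= r -> (forall i, `|v ord0 i| <= r) -> `|v| <= r.
Proof.
move=> r0 vr; rewrite [leLHS]/Num.Def.normr /= mx_normrE; apply/bigmax_leP; split=> //.
by move=> [i j] _ /=; rewrite (ord1 i).
Qed.

Lemma norm_rV_lt (R : realType) (n : nat) (v : 'rV[R]_n) (r : R) :
  0 < r -> (forall i, `|v ord0 i| < r) -> `|v| < r.
Proof.
move=> r0 vr; rewrite [ltLHS]/Num.Def.normr /= mx_normrE; apply/bigmax_ltP; split=> //.
by move=> [i j] _ /=; rewrite (ord1 i).
Qed.

Lemma measurable_box (R : realType) (n : nat)
    (A : 'I_n -> set (measurableTypeR R)) :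
  (forall i, measurable (A i)) ->
  measurable [set v : 'rV[R]_n | forall i, A i (v ord0 i)].
Proof.
move=> mA.
rewrite (_ : [set _ | _] =
    \bigcap_(i in setT) (fun v : 'rV[R]_n => v ord0 i) @^-1` A i).
  apply: fin_bigcap_measurable => // i _.
  by rewrite -[X in measurable X]setTI; exact: measurable_coord.
by apply/seteqP; split=> [v Av i _|v Av i]; exact: Av.
Qed.

(** The sigma-algebra is generated by the coordinates, so openness has to be turned into a countable
    union: the boxes with rational centre and half-side [k.+1%:R^-1] that lie in [A] cover it. *)
Lemma open_measurable_rV (R : realType) (n : nat) (A : set 'rV[R]_n) :
  open A -> measurable A.
Proof.
move=> oA.
pose box (p : 'rV[rat]_n * nat) := [set v : 'rV[R]_n | forall i,
  `]ratr (p.1 ord0 i) - p.2.+1%:R^-1, ratr (p.1 ord0 i) + p.2.+1%:R^-1[%classic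
  (v ord0 i)].
have -> : A = \bigcup_p (if pselect (box p `<=` A) then box p else set0).
  apply/seteqP; split=> [v Av|v [p _]]; last by case: pselect => // pA /pA.
  move: oA; rewrite openE => /(_ _ Av)/nbhs_ballP[e /= e0 veA].
  (* Twice the half-side must stay below [e], because [v] may be off-centre in the box around the
     rational point [q]. *)
  pose k := Num.truncn (2 / e).
  have ke : 2 * k.+1%:R^-1 < e.
    by rewrite ltr_pdivrMr// mulrC -ltr_pdivrMr// truncnS_gt.
  have k0 : 0 < k.+1%:R^-1 :> R by rewrite invr_gt0.
  have boxk q : box (q, k) = [set w | forall i, `]ratr (q ord0 i) - k.+1%:R^-1,
    ratr (q ord0 i) + k.+1%:R^-1[%classic (w ord0 i)] by [].
  move: boxk k0 ke; set d := k.+1%:R^-1 => boxk k0 ke.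
  have /choice[q qv] : forall i, exists q : rat,
      `|v ord0 i - ratr q| < d.
    move=> i; have /rat_in_itvoo[q] : v ord0 i - d < v ord0 i + d.
      by lra.
    rewrite in_itv/= => /andP[? ?]; exists q; rewrite ltr_norml; apply/andP.
    by split; lra.
  exists (\row_i q i, k) => //; case: pselect => [boxA /=|].
    rewrite boxk => i /=; rewrite in_itv/= mxE; have := qv i.
    by rewrite ltr_norml => /andP[? ?]; apply/andP; split; lra.
  case; rewrite boxk => w /= wq; apply: veA; rewrite -ball_normE /ball_/=.
  apply: norm_rV_lt => // i; have := wq i; rewrite !mxE in_itv/= => /andP[? ?].
  by have := qv i; rewrite !ltr_norml => /andP[? ?]; apply/andP; split; lra.
apply: countable_bigcupT_measurable; first exact: countableP.
move=> p; case: pselect => [?|?] //=.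
exact: (@measurable_box R n (fun i => `]ratr (p.1 ord0 i) - p.2.+1%:R^-1,
  ratr (p.1 ord0 i) + p.2.+1%:R^-1[%classic)).
Qed.

Lemma continuous_measurable_rV (R : realType) (n : nat) (f : 'rV[R]_n -> R) :
  continuous f -> measurable_fun setT f.
Proof.
move=> cf; apply: (measurability _ (RGenOpens.measurableE R)).
move=> _ [_ [a [b ->] <-]]; rewrite setTI; apply: open_measurable_rV.
by apply: open_comp => //; exact: interval_open.
Qed.

Lemma lebesgue_measure_shift (R : realType) (c : R) (A : set (measurableTypeR R)) :
  measurable A ->
  lebesgue_measure ((fun x : measurableTypeR R => x + c : measurableTypeR R) @^-1` A) =
  lebesgue_measure A.
Proof.
move=> mA.
have mc : measurable_fun setT (fun x : measurableTypeR R => x + c : measurableTypeR R).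
  by apply: measurable_funD => //; exact: measurable_cst.
apply/esym.
apply: (@lebesgue_measure_unique R
  (measure_function_pushforward__canonical__measure_function_Measure
    lebesgue_measure mc)) => //.
move=> _ [[a b] _ <-] /=; rewrite /pushforward.
have -> : (fun x : R => x + c) @^-1` `]a, b] = `](a - c), (b - c)]%classic.
  by apply/seteqP; split => x /=; rewrite !in_itv/= lerBrDr ltrBlDr.
rewrite !lebesgue_measure_itv/= !lte_fin ltrD2r; case: ifP => // _.
by rewrite -!EFinB; congr EFin; ring.
Qed.

Lemma measurable_shift_rV (R : realType) (n : nat) (c : 'rV[R]_n) :
  measurable_fun [set: 'rV[R]_n] (fun x => x + c).
Proof.
apply: measurable_fun_rV => i; under eq_fun do rewrite mxE.
by apply: measurable_funD; [exact: measurable_coord|exact: measurable_cst].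
Qed.

(** Boxes form a pi-system generating the sigma-algebra, and the cubes [g k] exhaust the space with
    finite measure, so it suffices to compare the two measures on boxes. There both are products,
    and one-dimensional invariance applies factor by factor. *)
Lemma lebesgue_rV_shift (R : realType) (n : nat) (c : 'rV[R]_n) (A : set 'rV[R]_n) :
  measurable A -> lebesgue_rV ((fun x => x + c) @^-1` A) = lebesgue_rV A.
Proof.
pose box (B : 'I_n -> set (measurableTypeR R)) :=
  [set v : 'rV[R]_n | forall i, B i (v ord0 i)].
have boxE B : (forall i, measurable (B i)) ->
    lebesgue_rV (box B) = (\prod_(i < n) lebesgue_measure (B i))%E.
  exact: lebesgue_rV_box.
pose G : set (set 'rV[R]_n) := [set C | exists2 B, (forall i, measurable (B i)) & C = box B].
have GE : @measurable _ 'rV[R]_n = <<s G >>.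
  apply/seteqP; split; last first.
    by apply: smallest_sub; [exact: sigma_algebra_measurable|
      move=> _ [B mB ->]; exact: measurable_box].
  apply: smallest_sub; first exact: smallest_sigma_algebra.
  move=> B; rewrite -bigcup_seq => -[i _ [Y mY <-]].
  (* A generator is a box all of whose sides but the [i]-th are the whole line. *)
  apply: sub_sigma_algebra; exists (fun j => if j == i then Y else setT).
    by move=> j; case: ifP.
  apply/seteqP; split=> [v [_ Yv] j|v /(_ i)]; rewrite /box/=.
    by case: eqP => // ->.
  by rewrite eqxx.
pose J (k : nat) : set (measurableTypeR R) := `]- k%:R, k%:R[%classic.
pose g (k : nat) : set 'rV[R]_n := box (fun=> J k).
pose mu' := measure_function_pushforward__canonical__measure_function_Measure
  lebesgue_rV (measurable_shift_rV c).
move=> mA; rewrite -[LHS]/(mu' A).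
apply/esym; apply: (measure_unique G g) => //.
- move=> _ _ [B1 mB1 ->] [B2 mB2 ->]; exists (fun i => B1 i `&` B2 i).
    by move=> i; exact: measurableI.
  apply/seteqP; split=> [v [v1 v2] i|v vB].
    by split; [exact: v1|exact: v2].
  by split=> i; have [] := vB i.
- move=> k; exists (fun=> J k) => // i; exact: measurable_itv.
- apply/seteqP; split=> // v _; exists (Num.truncn `|v|).+1 => // i /=.
  rewrite /J/= in_itv/= -ltr_norml (le_lt_trans (ler_norm_coord _ _))//.
  exact: truncnS_gt.
- move=> _ [B mB ->]; rewrite /= /pushforward.
  rewrite (_ : _ @^-1` _ = box (fun i => (fun x => x + c ord0 i) @^-1` B i)).
    have mcB i : measurable ((fun x : R => x + c ord0 i) @^-1` B i).
      rewrite -[X in measurable X]setTI.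
      have mc : measurable_fun setT (fun x : measurableTypeR R => x + c ord0 i : measurableTypeR R).
        by apply: measurable_funD => //; exact: measurable_cst.
      exact: mc.
    apply: (etrans (boxE _ mB)); apply: etrans (esym (boxE _ mcB)).
    by apply: eq_bigr => i _; rewrite lebesgue_measure_shift.
  apply/seteqP; split=> v /= vB i; have := vB i; by rewrite mxE.
- move=> k; have gE : lebesgue_rV (g k) =
      (\prod_(i < n) lebesgue_measure (J k))%E.
    by apply: (boxE (fun=> J k)); move=> ?; exact: measurable_itv.
  suff : (lebesgue_rV (g k) < +oo)%E by [].
  rewrite gE ltey_eq; apply/orP; left.
  elim/big_ind: _ => //= [x y x0 y0|i _]; first exact: fin_numM.
  by rewrite /J lebesgue_measure_itv/=; case: ifP => _; rewrite // -EFinB.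
Qed.

Lemma lebesgue_rV_boxr (R : realType) (n : nat) (c : 'rV[R]_n) (r : R) : 0 < r ->
  lebesgue_rV [set v : 'rV[R]_n | forall i, `]c ord0 i - r, c ord0 i + r[%classic (v ord0 i)]
  = ((2 * r) ^+ n)%:E.
Proof.
move=> r0; pose J i : set (measurableTypeR R) :=
  `]c ord0 i - r, c ord0 i + r[%classic.
have mJ i : measurable (J i) by exact: measurable_itv.
apply: (etrans (lebesgue_rV_box mJ)); rewrite /J.
rewrite (eq_bigr (fun=> (2 * r)%:E)); last first.
  move=> i _; rewrite lebesgue_measure_itv/= lte_fin ifT; last by lra.
  by rewrite -EFinB; congr EFin; ring.
by rewrite prodEFin prodr_const card_ord.
Qed.

Lemma measurable_cball (R : realType) (n : nat) (r : R) :
  measurable [set v : 'rV[R]_n | `|v| <= r].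
Proof.
rewrite (_ : [set _ | _] = ~` [set v | r < `|v|]).
  apply: measurableC; apply: open_measurable_rV.
  have := @open_comp _ _ (fun v : 'rV[R]_n => `|v|) [set x | r < x].
  by apply=> [x _|]; [exact: norm_continuous|exact: open_gt].
by apply/seteqP; split=> v /=; rewrite leNgt => /negP.
Qed.

Lemma lebesgue_rV_cball_fin (R : realType) (n : nat) (r : R) :
  (lebesgue_rV [set v : 'rV[R]_n | `|v| <= r]%R < +oo)%E.
Proof.
have r0 : 0 < `|r| + 1 by rewrite ltr_wpDl.
apply: (@le_lt_trans _ _ ((2 * (`|r| + 1)) ^+ n)%:E); last by rewrite ltry.
rewrite -(lebesgue_rV_boxr (0 : 'rV[R]_n) r0); apply: le_measure.
- by rewrite inE; exact: measurable_cball.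
- by rewrite inE; apply: (@measurable_box R n (fun=> _)) => i; exact: measurable_itv.
- move=> v /= vr i; rewrite mxE sub0r add0r in_itv/= -ltr_norml.
  rewrite (le_lt_trans (ler_norm_coord _ _))// (le_lt_trans vr)//.
  by rewrite (le_lt_trans (ler_norm _))// ltrDl.
Qed.

Definition vol_cball (R : realType) (n : nat) (r : R) : R :=
  fine (lebesgue_rV [set v : 'rV[R]_n | `|v| <= r]%R).

Lemma vol_cball_ge0 (R : realType) (n : nat) (r : R) : 0 <= vol_cball n r.
Proof. by rewrite fine_ge0. Qed.

(** The class to which the integrands below are reduced: membership gives integrability, and the
    explicit radius turns a sup bound into a bound on the integral through [vol_cball]. *)
Definition cont_supp (R : realType) (n : nat) (r : R) (g : 'rV[R]_n -> R) :=
  continuous g /\ forall x, r < `|x| -> g x = 0.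

Lemma compact_cball (R : realType) (n : nat) (r : R) :
  compact [set v : 'rV[R]_n | `|v| <= r].
Proof.
apply: bounded_closed_compact.
  by exists r; split=> [|x rx v /= vr]; [exact: num_real|rewrite (le_trans vr)// ltW].
rewrite (_ : [set _ | _] = (fun v => `|v|) @^-1` [set x | x <= r]) //.
by apply: closed_comp; [move=> ? _; exact: norm_continuous|exact: closed_le].
Qed.

Lemma cont_supp_bounded (R : realType) (n : nat) (r : R) (g : 'rV[R]_n -> R) :
  cont_supp r g -> exists M, forall x, `|g x| <= M.
Proof.
move=> [cg g0].
have cB := @compact_cball R n r.
have /compact_bounded[M [_ MB]] : compact (g @` [set v : 'rV[R]_n | `|v| <= r]).
  by apply: continuous_compact => //; exact: continuous_subspaceT.
exists (`|M| + 1) => x; have [xr|xr] := leP `|x| r; last first.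
  by rewrite g0// normr0 addr_ge0.
apply: (MB (`|M| + 1)); last by exists x.
by rewrite (le_lt_trans (ler_norm _))// ltrDl.
Qed.

Lemma cont_supp_integrable (R : realType) (n : nat) (r : R) (g : 'rV[R]_n -> R) :
  cont_supp r g -> lebesgue_rV.-integrable setT (EFin \o g).
Proof.
move=> [cg g0].
have mB := @measurable_cball R n r.
have mg := continuous_measurable_rV cg.
rewrite (_ : EFin \o g = (EFin \o g) \_ [set v : 'rV[R]_n | `|v| <= r]%R); last first.
  apply/funext => x; rewrite patchE; case: ifPn => //; rewrite notin_setE/= => xr.
  by rewrite g0// ltNge; apply/negP.
have ib : lebesgue_rV.-integrable [set v : 'rV[R]_n | `|v| <= r]%R (EFin \o g).
  apply: measurable_bounded_integrable => //.
  - exact: lebesgue_rV_cball_fin.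
  - exact: measurable_funTS.
  - have [M Mg] := cont_supp_bounded (conj cg g0).
    exists M; split; first exact: num_real.
    by move=> x Mx y _; exact: le_trans (Mg y) (ltW Mx).
exact: (integrable_mkcond _ mB).1 ib.
Qed.

Lemma cont_supp_shift (R : realType) (n : nat) (r s : R) (g : 'rV[R]_n -> R) (c : 'rV[R]_n) :
  `|c| <= s -> cont_supp r g -> cont_supp (r + s) (fun x => g (x + c)).
Proof.
move=> cs [cg g0]; split=> [x|x xr].
  have cc : {for x, continuous (fun y : 'rV[R]_n => y + c)}.
    by apply: (continuousD (f := id)) => //; exact: cst_continuous.
  exact: continuous_comp cc (cg _).
rewrite g0//; have := ler_normB (x + c) c; rewrite addrK => xc; lra.
Qed.

Lemma Rintegral_shift (R : realType) (n : nat) (r : R) (g : 'rV[R]_n -> R) (c : 'rV[R]_n) :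
  cont_supp r g ->
  \int[lebesgue_rV]_x g (x + c) = \int[lebesgue_rV]_x g x.
Proof.
move=> sg; rewrite /Rintegral; congr fine.
have mg := continuous_measurable_rV sg.1.
pose mu' := measure_function_pushforward__canonical__measure_function_Measure
  lebesgue_rV (measurable_shift_rV c).
rewrite [RHS](eq_measure_integral mu'); last first.
  by move=> A mA _; exact: (esym (lebesgue_rV_shift c mA)).
apply: esym; apply: (integral_pushforward (measurable_shift_rV c)) => //.
  by apply/measurable_EFinP.
exact: (cont_supp_integrable (cont_supp_shift (lexx _) sg)).
Qed.

Lemma le_normr_Rintegral_supp (R : realType) (n : nat) (r M : R) (g : 'rV[R]_n -> R) :
  cont_supp r g -> (forall x, `|g x| <= M) ->
  `|\int[lebesgue_rV]_x g x| <= M * vol_cball n r.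
Proof.
move=> sg gM; have ig := cont_supp_integrable sg; have [cg g0] := sg.
have mB := @measurable_cball R n r.
rewrite (_ : g = g \_ [set v : 'rV[R]_n | `|v| <= r]); last first.
  apply/funext => x; rewrite patchE; case: ifPn => //; rewrite notin_setE/= => xr.
  by rewrite g0// ltNge; apply/negP.
rewrite -Rintegral_mkcond.
have iB : lebesgue_rV.-integrable [set v : 'rV[R]_n | `|v| <= r] (EFin \o g).
  exact: integrableS ig.
rewrite (le_trans (le_normr_Rintegral mB iB))//.
rewrite /vol_cball -(Rintegral_cst _ mB); apply: le_Rintegral => //.
  exact: integrable_norm.
apply: measurable_bounded_integrable => //; first exact: lebesgue_rV_cball_fin.
by exists `|M|; split => // x ? y _ /=; exact: ltW.
Qed.

(** Dominated convergence, with the constant [|M|] on the ball of radius [r] as majorant. *)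
Lemma Rintegral_cvg (R : realType) (n : nat) (r M : R)
    (g_ : nat -> 'rV[R]_n -> R) (g : 'rV[R]_n -> R) :
  (forall k, cont_supp r (g_ k)) -> cont_supp r g ->
  (forall k x, `|g_ k x| <= M) -> (forall x, g_ k x @[k --> \oo] --> g x) ->
  \int[lebesgue_rV]_x g_ k x @[k --> \oo] --> \int[lebesgue_rV]_x g x.
Proof.
move=> sg_ sg gM gcvg.
have mB := @measurable_cball R n r.
pose h : 'rV[R]_n -> R := cst `|M| \_ [set v : 'rV[R]_n | `|v| <= r].
have ih : lebesgue_rV.-integrable setT (EFin \o h).
  rewrite /h -restrict_EFin; apply/(integrable_mkcond _ mB).1.
  apply: measurable_bounded_integrable => //; first exact: lebesgue_rV_cball_fin.
  by exists `|M|; split => // x ? y _ /=; rewrite normr_id; exact: ltW.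
have mg_ k : measurable_fun setT (EFin \o g_ k).
  by apply/measurable_EFinP; exact: (continuous_measurable_rV (sg_ k).1).
have mg : measurable_fun setT (EFin \o g).
  by apply/measurable_EFinP; exact: (continuous_measurable_rV sg.1).
have [||_ _ c] := dominated_convergence (mu := lebesgue_rV) measurableT mg_ mg _ ih.
- by apply: aeW => x _; apply: cvg_EFin; [exact: nearW|exact: gcvg].
- apply: aeW => x k _; rewrite /= lee_fin /h patchE; case: ifPn => xB.
    by rewrite (le_trans (gM k x))// ler_norm.
  rewrite (sg_ k).2 ?normr0// ltNge; apply/negP.
  by move: xB; rewrite notin_setE.
apply: fine_cvg; rewrite fineK; first exact: c.
exact: (integrable_fin_num _ (cont_supp_integrable sg)).
Qed.

(** By continuity [g] is at least [g x / 2] on a cube around [x], whose volume is positive. *)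
Lemma Rintegral_gt0 (R : realType) (n : nat) (r : R) (g : 'rV[R]_n -> R) (x : 'rV[R]_n) :
  cont_supp r g -> (forall y, 0 <= g y) -> 0 < g x ->
  0 < \int[lebesgue_rV]_x g x.
Proof.
move=> sg g0 gx; have [cg _] := sg.
have gx2 : 0 < g x / 2 by lra.
have /nbhs_ballP[e /= e0 xe] : \forall y \near x, `|g x - g y| < g x / 2.
  by move/cvgrPdist_lt: (cg x); exact.
pose J i : set (measurableTypeR R) := `]x ord0 i - e, x ord0 i + e[%classic.
pose B := [set v : 'rV[R]_n | forall i, J i (v ord0 i)].
have mB : measurable B by apply: measurable_box => i; exact: measurable_itv.
have muB : lebesgue_rV B = ((2 * e) ^+ n)%:E by exact: lebesgue_rV_boxr.
have gB y : B y -> g x / 2 <= g y.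
  move=> By; have : `|g x - g y| < g x / 2.
    apply: xe; rewrite -ball_normE /ball_/=; apply: norm_rV_lt => // i.
    have := By i; rewrite /J/= in_itv/= !mxE => /andP[? ?].
    by rewrite ltr_norml; apply/andP; split; lra.
  by rewrite ltr_norml => /andP[? ?]; lra.
have ig := cont_supp_integrable sg.
apply: (@lt_le_trans _ _ (\int[lebesgue_rV]_(y in B) (g x / 2))).
  rewrite Rintegral_cst//.
  suff : 0 < g x / 2 * fine (lebesgue_rV B) by [].
  by rewrite muB/= mulr_gt0// exprn_gt0//; lra.
rewrite Rintegral_mkcond; apply: le_Rintegral => //.
  rewrite -restrict_EFin; apply/(integrable_mkcond _ mB).1.
  apply: measurable_bounded_integrable => //.
    by apply: (le_lt_trans (y := ((2 * e) ^+ n)%:E)); rewrite ?ltry// -muB.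
  by exists `|g x / 2|; split => // z ? y _ /=; exact: ltW.
move=> y _; rewrite patchE; case: ifPn => //; rewrite inE; exact: gB.
Qed.

(** * Derivatives along lines *)

Lemma is_derive_line (R : realType) (V : normedModType R) (g : V -> R) (x v : V) (t : R) :
  derivable g (x + t *: v) v ->
  is_derive t 1 (fun s : R => g (x + s *: v)) ('D_v g (x + t *: v)).
Proof.
move=> dg.
have E : (fun h : R => h^-1 *: ((fun s : R => g (x + s *: v)) (h *: 1 + t) -
      (fun s : R => g (x + s *: v)) t)) =
    (fun h : R => h^-1 *: (g (h *: v + (x + t *: v)) - g (x + t *: v))).
  apply/funext => h /=; congr (_ *: (g _ - _)).
  by rewrite [h *: 1]mulr1 scalerDl addrCA.
split; first by rewrite /derivable E.
by rewrite /derive E.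
Qed.

Lemma mvt_line (R : realType) (V : normedModType R) (g : V -> R) (x v : V) (s : R) :
  0 <= s ->
  (forall t : R, 0 <= t <= s -> derivable g (x + t *: v) v) ->
  exists2 c : R, 0 <= c <= s & g (x + s *: v) - g x = s * 'D_v g (x + c *: v).
Proof.
move=> s0 dg.
have dg' t : t \in `[0, s]%R -> is_derive t 1 (fun s : R => g (x + s *: v)) ('D_v g (x + t *: v)).
  by rewrite in_itv/= => ?; apply: is_derive_line; exact: dg.
pose G s := g (x + s *: v); pose dG s := 'D_v g (x + s *: v).
have cG : {within `[0, s], continuous G}.
  apply: derivable_within_continuous => t t01.
  by have [] := dg' t t01.
have dG' t : t \in `]0, s[%R -> is_derive t 1 G (dG t).
  by rewrite in_itv/= => /andP[? ?]; apply: dg'; rewrite in_itv/= !ltW.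
have [c] := MVT_segment s0 dG' cG.
rewrite in_itv/= => c01 E; exists c => //.
by move: E; rewrite /G /dG scale0r addr0 subr0 mulrC.
Qed.

Lemma dir_lipschitz (R : realType) (V : normedModType R) (L : R) (v : V) (g : V -> R) :
  (forall x, derivable g x v) -> (forall x, `|'D_v g x| <= L) ->
  forall x s, `|g (x + s *: v) - g x| <= L * `|s|.
Proof.
move=> dg gL.
have pos x s : 0 <= s -> `|g (x + s *: v) - g x| <= L * `|s|.
  move=> s0; have [c _ ->] := @mvt_line R _ g x v s s0 (fun t _ => dg _).
  by rewrite normrM mulrC ler_wpM2r.
move=> x s; have [s0|s0] := leP 0 s; first exact: pos.
(* For negative [s] the two endpoints exchange roles. *)
have := pos (x + s *: v) (- s); rewrite -addrA -scalerDl subrr scale0r addr0 normrN.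
by rewrite distrC; apply; rewrite oppr_ge0 ltW.
Qed.

Lemma smooth_derivable (R : realType) (m : nat) (W : normedModType R)
    (Omega : set 'rV[R]_m) (g : 'rV[R]_m -> W) (x v : 'rV[R]_m) :
  smooth_on Omega g -> Omega x -> derivable g x v.
Proof. by move=> sg Ox; apply: diff_derivable; exact: (sg [::] x Ox). Qed.

Lemma smooth_derive_continuous (R : realType) (m : nat) (W : normedModType R)
    (Omega : set 'rV[R]_m) (g : 'rV[R]_m -> W) (x v : 'rV[R]_m) :
  smooth_on Omega g -> Omega x -> {for x, continuous ('D_v g)}.
Proof. by move=> sg Ox; apply: differentiable_continuous; exact: (sg [:: v] x Ox). Qed.

Lemma smooth_continuous (R : realType) (m : nat) (W : normedModType R)
    (Omega : set 'rV[R]_m) (g : 'rV[R]_m -> W) (x : 'rV[R]_m) :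
  smooth_on Omega g -> Omega x -> {for x, continuous g}.
Proof. by move=> sg Ox; apply: differentiable_continuous; exact: (sg [::] x Ox). Qed.

Lemma compact_norm_le (R : realType) (n : nat) (K : set 'rV[R]_n) :
  compact K -> exists r, forall x, K x -> `|x| <= r.
Proof.
move=> /compact_bounded[M [_ MK]]; exists (`|M| + 1) => x Kx; apply: MK => //.
by rewrite (le_lt_trans (ler_norm _))// ltrDl.
Qed.

Lemma compact_closed_rV (R : realType) (n : nat) (K : set 'rV[R]_n) : compact K -> closed K.
Proof. by apply: compact_closed; exact: norm_hausdorff. Qed.

(** * Extension by zero of functions with compact support in an open set *)

Section ExtendByZero.
Context (R : realType) (m : nat) (Omega K : set 'rV[R]_m) (g : 'rV[R]_m -> R).
Hypotheses (oO : open Omega) (cK : compact K) (KO : K `<=` Omega).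
Hypothesis g0 : forall x, Omega x -> ~ K x -> g x = 0.

Lemma near_ext0_in x : Omega x -> \near x, g x = (g \_ Omega) x.
Proof.
move=> Ox; have : \forall y \near x, Omega y by exact: open_nbhs_nbhs.
by apply: filterS => y Oy; rewrite patchE mem_set.
Qed.

(** The complement of [K] is open and the extension vanishes on it, inside [Omega] by [g0] and
    outside by definition. Since [K] lies in [Omega], local properties of the extension then follow
    from those of [g] at points of [Omega] and of zero elsewhere. *)
Lemma near_ext0_out x : ~ K x -> \near x, 0 = (g \_ Omega) x.
Proof.
move=> Kx; have : \forall y \near x, ~ K y.
  apply: (@open_nbhs_nbhs _ _ (~` K)); split=> //.
  by apply: closed_openC; exact: compact_closed_rV.
by apply: filterS => y Ky; rewrite patchE; case: ifPn => //; rewrite inE => /g0 ->.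
Qed.

Lemma ext0_continuous :
  (forall x, Omega x -> {for x, continuous g}) -> continuous (g \_ Omega).
Proof.
move=> cg x; rewrite /continuous_at; have [Kx|Kx] := pselect (K x).
  have E := near_ext0_in (KO Kx); have /nbhs_singleton <- := E.
  suff h : (g \_ Omega) y @[y --> x] `=>` g y @[y --> x].
    exact: cvg_trans h (cg x (KO Kx)).
  exact: (near_eq_cvg E).
have E := near_ext0_out Kx; have /nbhs_singleton <- := E.
suff h : (g \_ Omega) y @[y --> x] `=>` (cst 0 : _ -> R) y @[y --> x].
  have c0 : (cst 0 : 'rV[R]_m -> R) y @[y --> x] --> (0 : R).
    by exact: (@cst_continuous 'rV[R]_m R (0 : R) x).
  exact: cvg_trans h c0.
exact: (near_eq_cvg E).
Qed.

Lemma ext0_supp r : (forall x, K x -> `|x| <= r) ->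
  forall x, r < `|x| -> (g \_ Omega) x = 0.
Proof.
move=> Kr x xr; apply/esym; apply: (nbhs_singleton (near_ext0_out _)) => /Kr.
by rewrite leNgt xr.
Qed.

Lemma ext0_derivable v :
  (forall x, Omega x -> derivable g x v) -> forall x, derivable (g \_ Omega) x v.
Proof.
move=> dg x; have [Kx|Kx] := pselect (K x).
  by apply: near_eq_derivable (dg x (KO Kx)); exact/near_ext0_in/KO.
apply: (@near_eq_derivable _ _ _ (cst 0)); first exact: near_ext0_out.
exact: derivable_cst.
Qed.

Lemma ext0_derive v : 'D_v (g \_ Omega) = ('D_v g) \_ Omega.
Proof.
apply/funext => x; rewrite patchE; case: ifPn; rewrite ?inE ?notin_setE => Ox.
  by apply/esym; apply: near_eq_derive; exact: near_ext0_in.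
rewrite -(near_eq_derive (f := cst 0)) ?derive_cst//.
by apply: near_ext0_out => /KO.
Qed.

Lemma derive_ext0 v x : Omega x -> ~ K x -> 'D_v g x = 0.
Proof.
move=> Ox Kx; have : ('D_v g \_ Omega) x = 'D_v g x by rewrite patchE mem_set.
rewrite -ext0_derive => <-.
by rewrite -(near_eq_derive (f := cst 0)) ?derive_cst//; exact: near_ext0_out.
Qed.

End ExtendByZero.

(** * Smooth bump functions *)

Section FlatExponential.
Context (R : realType).

(** The functions s^-k exp(-1/s), extended by 0 to s <= 0. Derivatives of members of this family are
    linear combinations of members, which lets the order of smoothness be handled by induction. *)
Definition flat_exp (k : nat) (s : R) : R :=
  if 0 < s then s^-1 ^+ k * expR (- s^-1) else 0.

Lemma flat_exp_ge0 k s : 0 <= flat_exp k s.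
Proof.
rewrite /flat_exp; case: ifP => // s0.
by rewrite mulr_ge0 ?expR_ge0// exprn_ge0// invr_ge0 ltW.
Qed.

Lemma flat_exp_gt0 k s : 0 < s -> 0 < flat_exp k s.
Proof.
by move=> s0; rewrite /flat_exp s0 mulr_gt0 ?expR_gt0// exprn_gt0// invr_gt0.
Qed.

Lemma flat_exp_eq0 k s : s <= 0 -> flat_exp k s = 0.
Proof. by rewrite /flat_exp leNgt => /negbTE ->. Qed.

(** The term of order [k.+2] of the exponential series at u = 1/s gives u^(k+2) <= (k+2)! exp(u).
    Quadratic decay at 0 is what makes the derivative there vanish. *)
Lemma flat_exp_le k s : `|flat_exp k s| <= k.+2`!%:R * s ^+ 2.
Proof.
rewrite ger0_norm ?flat_exp_ge0//.
have [s0|s0] := leP s 0.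
  by rewrite flat_exp_eq0// mulr_ge0// sqr_ge0.
have u0 : 0 < s^-1 by rewrite invr_gt0.
have := expR_ge1Dxn k.+1 (ltW u0).
have F0 : 0 < k.+2`!%:R :> R by rewrite ltr0n fact_gt0.
rewrite /flat_exp s0 expRN; set u := s^-1 in u0 *; move=> H.
have -> : s = u^-1 by rewrite invrK.
have H2 : u ^+ k.+2 <= k.+2`!%:R * expR u.
  rewrite mulrC -ler_pdivrMr//; apply: le_trans H; rewrite lerDr ler01//.
have un0 : u != 0 by rewrite gt_eqF.
have -> : u ^+ k = u ^+ k.+2 * u^-1 ^+ 2.
  by rewrite -addn2 exprD -mulrA -exprMn divff// expr1n mulr1.
rewrite ler_pdivrMr ?expR_gt0// [X in _ <= X]mulrAC.
by rewrite ler_wpM2r// sqr_ge0.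
Qed.

Lemma is_derive_flat_exp k (s : R) :
  is_derive s 1 (flat_exp k) (flat_exp k.+2 s - k%:R * flat_exp k.+1 s).
Proof.
have [s0|s0|->] := ltrgtP s 0.
- rewrite !flat_exp_eq0 ?ltW// mulr0 subr0.
  apply: (near_eq_is_derive _ (is_derive_cst (0 : R) s (1 : R))).
  have : \forall t \near s, t < 0 by apply: open_nbhs_nbhs; split; [exact: open_lt|].
  by apply: filterS => t t0; rewrite flat_exp_eq0 ?ltW.
- have sn0 : s != 0 by rewrite gt_eqF.
  have du : is_derive s 1 (fun t : R => t^-1) (- s^-1 ^+ 2).
    have d := @derivableV R R id s 1 sn0 (@derivable_id _ _ s 1).
    split => //; rewrite (@deriveV R R id s 1)// derive_id.
    by rewrite -exprVn; exact: mulr1.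
  have dN := is_deriveN du.
  have dE := @is_derive1_comp R expR (- (fun t : R => t^-1)) s _ _ (is_derive_expR _) dN.
  have dX := is_deriveX k du.
  have dM := is_deriveM dX dE.
  have E : {near s, ((fun t : R => t^-1) ^+ k) * (expR \o (- (fun t : R => t^-1))) =1 flat_exp k}.
    have : \forall t \near s, 0 < t by apply: open_nbhs_nbhs; split; [exact: open_gt|].
    by apply: filterS => t t0; rewrite exprfctE /flat_exp t0.
  apply: (is_derive_eq (near_eq_is_derive E dM)); rewrite /flat_exp s0.
  rewrite exprfctE /= /GRing.scale /=.
  case: k {dX dM E} => [|k]; rewrite ?expr0/= ?exprS; ring.
- rewrite !flat_exp_eq0// mulr0 subr0.
  (* At the junction the difference quotient is at most (k+2)! |h|, by the quadratic bound. *)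
  have c0 : (h^-1 *: (flat_exp k (h *: 1 + 0) - flat_exp k 0)) @[h --> 0^'] --> (0 : R).
    apply/cvgr0Pnorm_le => e e0.
    have F0 : 0 < k.+2`!%:R :> R by rewrite ltr0n fact_gt0.
    exists (e / k.+2`!%:R) => /=; first by rewrite divr_gt0.
    move=> h /=; rewrite sub0r normrN => he h0.
    rewrite (flat_exp_eq0 k (lexx 0)) subr0 addr0 [h *: 1]mulr1 normrZ normfV.
    rewrite mulrC ler_pdivrMr ?normr_gt0//.
    rewrite (le_trans (flat_exp_le _ _))// -[h ^+ 2]ger0_norm ?sqr_ge0// normrX expr2 mulrA.
    by rewrite ler_wpM2r// mulrC -ler_pdivlMr// ltW.
  split; first by rewrite /derivable; apply/cvg_ex; exists 0.
  by apply/cvg_lim.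
Qed.

End FlatExponential.

(** * Calculus of functions of class C^k *)

Section SmoothClass.
Context (R : realType) (m : nat).
Local Notation V := 'rV[R]_m.

(** Counting the order allows products and inverses to be treated by induction, the derivative of a
    product being a sum of products of lower order; [smooth_on], which speaks of lists of
    directions, is recovered in [Cinf_smooth_on]. *)
Fixpoint Ck (k : nat) (g : V -> R) : Prop :=
  (forall x, differentiable g x) /\
  if k is k'.+1 then forall v, Ck k' ('D_v g) else True.

Lemma Ck_diff k g : Ck k g -> forall x, differentiable g x.
Proof. by case: k => [|k] []. Qed.

Lemma Ck_derive k g v : Ck k.+1 g -> Ck k ('D_v g).
Proof. by move=> [_ ]; exact. Qed.

Lemma CkW k g : Ck k.+1 g -> Ck k g.
Proof.
elim: k g => [|k IH] g [dg Dg]; split=> // v.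
by apply: IH; exact: Dg.
Qed.

Lemma Ck_iter_derive k vs g : Ck (size vs + k) g -> Ck k (iter_derive vs (g : V -> R^o)).
Proof.
elim: vs k => [k|v vs IH k]; first by rewrite add0n.
by rewrite [size _]/= addSnnS => /IH; exact: Ck_derive.
Qed.

Definition Cinf g := forall k, Ck k g.

Lemma Cinf_smooth_on Omega g : Cinf g -> smooth_on Omega (g : V -> R^o).
Proof.
by move=> Cg vs x _; apply: (@Ck_diff 0%N); apply: Ck_iter_derive; exact: Cg.
Qed.

Lemma Ck_cst k (c : R) : Ck k (cst c).
Proof.
elim: k c => [|k IH] c; split=> // v.
rewrite (_ : 'D_v (cst c) = cst 0) //.
by apply/funext => x; rewrite derive_cst.
Qed.

Lemma CkD k f g : Ck k f -> Ck k g -> Ck k (fun x => f x + g x).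
Proof.
elim: k f g => [|k IH] f g Cf Cg; split=> //.
- by move=> x; apply: differentiableD; [exact: Ck_diff Cf x|exact: Ck_diff Cg x].
- by move=> x; apply: differentiableD; [exact: Ck_diff Cf x|exact: Ck_diff Cg x].
move=> v; rewrite (_ : 'D_v _ = fun x => 'D_v f x + 'D_v g x).
  by apply: IH; exact: Ck_derive.
apply/funext => x; rewrite -deriveD//; apply: diff_derivable.
  exact: Ck_diff Cf x.
exact: Ck_diff Cg x.
Qed.

Lemma CkM k f g : Ck k f -> Ck k g -> Ck k (fun x => f x * g x).
Proof.
elim: k f g => [|k IH] f g Cf Cg; split=> //.
- by move=> x; apply: differentiableM; [exact: Ck_diff Cf x|exact: Ck_diff Cg x].
- by move=> x; apply: differentiableM; [exact: Ck_diff Cf x|exact: Ck_diff Cg x].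
move=> v; rewrite (_ : 'D_v _ = fun x => f x * 'D_v g x + g x * 'D_v f x).
  by apply: CkD; apply: IH; [exact: CkW|exact: Ck_derive|exact: CkW|exact: Ck_derive].
apply/funext => x; rewrite -[RHS]deriveM//; apply: diff_derivable.
  exact: Ck_diff Cf x.
exact: Ck_diff Cg x.
Qed.

Lemma CkZ k c g : Ck k g -> Ck k (fun x => c * g x).
Proof. exact/CkM/Ck_cst. Qed.

Lemma CkB k f g : Ck k f -> Ck k g -> Ck k (fun x => f x - g x).
Proof.
move=> Cf /(CkZ (-1)) Cg; have := CkD Cf Cg.
by congr Ck; apply/funext => x; rewrite mulN1r.
Qed.

Lemma CkV k g : (forall x, g x != 0) -> Ck k g -> Ck k (fun x => (g x)^-1).
Proof.
move=> g0; elim: k => [|k IH] Cg; split=> //.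
- by move=> x; apply: differentiableV => //; exact: Ck_diff Cg x.
- by move=> x; apply: differentiableV => //; exact: Ck_diff Cg x.
move=> v; rewrite (_ : 'D_v _ = fun x => -1 * ((g x)^-1 * (g x)^-1) * 'D_v g x).
  have CV := IH (CkW Cg).
  by apply: CkM; [exact/CkZ/CkM|exact: Ck_derive].
apply/funext => x; rewrite deriveV//; last exact: (diff_derivable (Ck_diff Cg x)).
by rewrite /GRing.scale /= -exprVn expr2 mulN1r.
Qed.

Lemma Ck_prod k (I : Type) (s : seq I) (F : I -> V -> R) :
  (forall i, Ck k (F i)) -> Ck k (fun x => \prod_(i <- s) F i x).
Proof.
move=> CF; elim: s => [|i s IH].
  by under eq_fun do rewrite big_nil; exact: Ck_cst.
by under eq_fun do rewrite big_cons; exact: CkM.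
Qed.

Lemma derive_affine_coord (a c : R) (i : 'I_m) (x v : V) :
  differentiable (fun x : V => a * x ord0 i + c) x /\
  'D_v (fun x : V => a * x ord0 i + c) x = a * v ord0 i.
Proof.
have dc : differentiable (fun x : V => x ord0 i : R^o) x by exact: differentiable_coord.
have ddc : 'D_v (fun x : V => x ord0 i : R^o) x = v ord0 i.
  apply: cvg_lim => //.
  apply: (@cvg_trans _ ((fun=> v ord0 i) @ (0 : R)^')); last exact: cvg_cst.
  apply: near_eq_cvg; near=> h; rewrite /= !mxE addrK [_ *: _]mulKf//.
  near: h; exact: nbhs_dnbhs_neq.
have dZ := differentiableZ a dc.
split; first exact: (differentiableD dZ (differentiable_cst c x)).
rewrite [LHS](deriveD (diff_derivable (v := v) dZ) (derivable_cst c x v)).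
by rewrite (deriveZ _ (diff_derivable (v := v) dc)) ddc derive_cst addr0.
Unshelve. all: by end_near. Qed.

(** Differentiation changes the index of [flat_exp], so the induction on [k] runs over all [j] at
    once; the inner function is affine and contributes only the constant [a * v ord0 i]. *)
Lemma Ck_flat_exp k j (a c : R) (i : 'I_m) :
  Ck k (fun x => flat_exp j (a * x ord0 i + c)).
Proof.
pose l (x : V) := a * x ord0 i + c.
have dE n s : differentiable (flat_exp n : R -> R) s.
  by apply/derivable1_diffP; have [] := is_derive_flat_exp n s.
elim: k j => [|k IH] j; split=> //.
- move=> x; apply: (differentiable_comp (f := l)); last exact: dE.
  by have [] := derive_affine_coord a c i x 0.
- move=> x; apply: (differentiable_comp (f := l)); last exact: dE.
  by have [] := derive_affine_coord a c i x 0.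
move=> v; rewrite (_ : 'D_v _ = fun x =>
   (a * v ord0 i) * (flat_exp j.+2 (l x) - j%:R * flat_exp j.+1 (l x))).
  by apply: CkZ; apply: CkB; [exact: IH|apply: CkZ; exact: IH].
apply/funext => x; have [dl Dl] := derive_affine_coord a c i x v.
have dc : differentiable (flat_exp j \o l) x by exact: differentiable_comp.
rewrite -[LHS]/('D_v (flat_exp j \o l) x) (deriveE v dc) (diff_comp dl (dE j _)) /=.
rewrite -(deriveE v dl) Dl -[X in 'd _ _ X]mulr1 [LHS]linearZ /=; congr (_ * _).
rewrite -deriveE//; by have [_ ->] := is_derive_flat_exp j (l x).
Qed.

End SmoothClass.

Section SmoothStep.
Context (R : realType).
Implicit Types s : R.

(** The usual smooth transition from 0 to 1; s and 1 - s are never both nonpositive, so the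
    denominator is positive. *)
Definition smooth_step s : R :=
  flat_exp 0 s / (flat_exp 0 s + flat_exp 0 (1 - s)).

Lemma smooth_step_den_gt0 s : 0 < flat_exp 0 s + flat_exp 0 (1 - s).
Proof.
have [s0|s0] := ltP 0 s; first by rewrite ltr_pwDl ?flat_exp_gt0 ?flat_exp_ge0.
by rewrite ltr_wpDl ?flat_exp_ge0// flat_exp_gt0//; lra.
Qed.

Lemma smooth_step_ge0 s : 0 <= smooth_step s.
Proof. by rewrite divr_ge0 ?flat_exp_ge0// ltW// smooth_step_den_gt0. Qed.

Lemma smooth_step_le1 s : smooth_step s <= 1.
Proof. by rewrite ler_pdivrMr ?smooth_step_den_gt0// mul1r lerDl flat_exp_ge0. Qed.

Lemma smooth_step0 s : s <= 0 -> smooth_step s = 0.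
Proof. by move=> s0; rewrite /smooth_step flat_exp_eq0// mul0r. Qed.

Lemma smooth_step1 s : 1 <= s -> smooth_step s = 1.
Proof.
move=> s1; rewrite /smooth_step [X in _ + X]flat_exp_eq0; last by lra.
by rewrite addr0 divff// gt_eqF// flat_exp_gt0//; lra.
Qed.

(** A difference of two transitions one unit apart, so that sums over integer translates telescope:
    a partition of unity without normalisation. *)
Definition bump1 s : R := smooth_step (s + 1) - smooth_step s.

Lemma bump1_ge0 s : 0 <= bump1 s.
Proof.
rewrite /bump1; have [s0|s0] := leP s 0.
  by rewrite (smooth_step0 s0) subr0 smooth_step_ge0.
by rewrite smooth_step1 ?subr_ge0 ?smooth_step_le1//; lra.
Qed.

Lemma bump1_le1 s : bump1 s <= 1.
Proof.
by have := smooth_step_ge0 s; have := smooth_step_le1 (s + 1); rewrite /bump1; lra.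
Qed.

Lemma bump1_supp s : 1 <= `|s| -> bump1 s = 0.
Proof.
rewrite /bump1; have [s0|s0] := leP 0 s.
  by rewrite ger0_norm// => s1; rewrite !smooth_step1 ?subrr//; lra.
by rewrite ltr0_norm// => s1; rewrite !smooth_step0 ?subrr//; lra.
Qed.

Lemma bump1_0 : bump1 0 = 1.
Proof. by rewrite /bump1 smooth_step1 ?smooth_step0 ?subr0// add0r. Qed.

Lemma sum_bump1 (n : nat) s :
  \sum_(k < n) bump1 (s - k%:R) = smooth_step (s + 1) - smooth_step (s + 1 - n%:R).
Proof.
elim: n => [|n IH]; first by rewrite big_ord0 subr0 subrr.
rewrite big_ord_recr /= IH /bump1.
have -> : s + 1 - n.+1%:R = s - n%:R by rewrite -natr1; ring.
have -> : s - n%:R + 1 = s + 1 - n%:R by ring.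
by ring.
Qed.

End SmoothStep.

(** * Smooth partition of unity over the integer lattice *)

Section Bump.
Context (R : realType) (m : nat).
Local Notation V := 'rV[R]_m.
Implicit Types x y : V.

Definition bump x : R := \prod_(i < m) bump1 (x ord0 i).

Lemma Cinf_bump (a : R) (c : V) : Cinf (fun x => bump (a *: x + c)).
Proof.
move=> k; rewrite /bump; apply: Ck_prod => i.
under eq_fun do rewrite !mxE.
have Cs (b : R) : Ck k (fun x : V => smooth_step (a * x ord0 i + b)).
  have E0 := Ck_flat_exp k 0 a b i.
  have E1 := Ck_flat_exp k 0 (- a) (1 - b) i.
  rewrite (_ : (fun x => smooth_step _) = fun x : V =>
     flat_exp 0 (a * x ord0 i + b) *
     (flat_exp 0 (a * x ord0 i + b) + flat_exp 0 (- a * x ord0 i + (1 - b)))^-1).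
    apply: CkM => //; apply: CkV; last exact: CkD.
    move=> x; have := smooth_step_den_gt0 (a * x ord0 i + b).
    rewrite (_ : 1 - _ = - a * x ord0 i + (1 - b)); first by move/gt_eqF ->.
    by ring.
  apply/funext => x; rewrite /smooth_step.
  by rewrite (_ : 1 - _ = - a * x ord0 i + (1 - b))//; ring.
apply: CkB; last exact: Cs.
by under eq_fun do rewrite -addrA; exact: Cs.
Qed.

Lemma bump_ge0 x : 0 <= bump x.
Proof. by apply: prodr_ge0 => i _; exact: bump1_ge0. Qed.

Lemma bump_supp x : 1 <= `|x| -> bump x = 0.
Proof.
move=> x1; have [/existsP[i xi]|/existsPn xi] := boolP [exists i, 1 <= `|x ord0 i|].
  by rewrite /bump (bigD1 i)//= bump1_supp// mul0r.
have : `|x| < 1 by apply: norm_rV_lt => // i; rewrite ltNge xi.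
by rewrite ltNge x1.
Qed.

Lemma bump_0 : bump 0 = 1.
Proof. by rewrite /bump big1// => i _; rewrite mxE bump1_0. Qed.

Definition node (n : nat) (k : {ffun 'I_m -> 'I_n}) : V := \row_i (k i)%:R.

Lemma sum_bump (n : nat) x : \sum_(k : {ffun 'I_m -> 'I_n}) bump (x - node k) =
  \prod_(i < m) (smooth_step (x ord0 i + 1) - smooth_step (x ord0 i + 1 - n%:R)).
Proof.
under [RHS]eq_bigr do rewrite -sum_bump1.
rewrite bigA_distr_bigA /=; apply: eq_bigr => k _.
by apply: eq_bigr => i _; rewrite !mxE.
Qed.

Lemma sum_bump_le1 (n : nat) x :
  \sum_(k : {ffun 'I_m -> 'I_n}) bump (x - node k) <= 1.
Proof.
rewrite sum_bump; apply: prodr_ile1 => i _; rewrite -sum_bump1; apply/andP; split.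
  by apply: sumr_ge0 => k _; exact: bump1_ge0.
rewrite sum_bump1; have := smooth_step_le1 (x ord0 i + 1).
by have := smooth_step_ge0 (x ord0 i + 1 - n%:R); lra.
Qed.

Lemma sum_bump_eq1 (n : nat) x : (forall i, 0 <= x ord0 i <= n%:R - 1) ->
  \sum_(k : {ffun 'I_m -> 'I_n}) bump (x - node k) = 1.
Proof.
move=> xn; rewrite sum_bump big1// => i _; have /andP[? ?] := xn i.
by rewrite smooth_step1 ?smooth_step0 ?subr0//; lra.
Qed.

Lemma derive_sum_coord (g : V -> R) x v : differentiable g x ->
  'D_v g x = \sum_(i < m) v ord0 i * 'D_(delta_mx (0 : 'I_1) i) g x.
Proof.
move=> dg; rewrite deriveE// {1}(row_sum_delta v) linear_sum.
by apply: eq_bigr => i _; rewrite linearZ /= deriveE.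
Qed.

(** The partial derivatives are continuous with bounded support, hence bounded, and the derivative
    along x - y is a combination of them. *)
Lemma bump_lipschitz : exists2 L, 0 <= L & forall x y, `|bump x - bump y| <= L * `|x - y|.
Proof.
have C1 : Ck 1 bump.
  have := Cinf_bump 1 0 1.
  by congr Ck; apply/funext => x; rewrite scale1r addr0.
have db x : differentiable bump x by exact: Ck_diff C1 x.
have sD i : cont_supp 1 ('D_(delta_mx (0 : 'I_1) i) bump).
  split=> [x|x x1].
    by apply: differentiable_continuous; apply: (Ck_diff (Ck_derive _ C1)).
  rewrite -(near_eq_derive (f := cst 0)) ?derive_cst//.
  have : \forall y \near x, 1 < `|y|.
    apply: (@open_nbhs_nbhs _ x [set y | 1 < `|y|]); split => //.
    have := @open_comp _ _ (fun v : V => `|v|) [set x | 1 < x].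
    by apply=> [z _|]; [exact: norm_continuous|exact: open_gt].
  by apply: filterS => y y1; rewrite bump_supp// ltW.
have /choice[M MD] i := cont_supp_bounded (sD i).
have M0 i : 0 <= M i by exact: le_trans (MD i 0).
exists (\sum_i M i) => [|x y]; first by rewrite sumr_ge0.
have DL z : `|'D_(x - y) bump z| <= (\sum_i M i) * `|x - y|.
  rewrite derive_sum_coord// mulr_suml (le_trans (ler_norm_sum _ _ _))//.
  apply: ler_sum => i _; rewrite normrM mulrC ler_pM//; exact: ler_norm_coord.
have := dir_lipschitz (fun z => diff_derivable (v := x - y) (db z)) DL y 1.
by rewrite scale1r normr1 mulr1 (addrC y) subrK.
Qed.

(** The constant must not depend on the number of nodes: a pair of nearby points meets the supports
    of boundedly many translates. *)
Lemma sum_bump_lipschitz : exists2 L, 0 <= L & forall n x y, `|x - y| <= 1 ->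
  \sum_(k : {ffun 'I_m -> 'I_n}) `|bump (x - node k) - bump (y - node k)| <= L * `|x - y|.
Proof.
have [L L0 BL] := bump_lipschitz.
exists (L * #|{ffun 'I_m -> 'I_7}|%:R) => [|n x y xy]; first by rewrite mulr_ge0.
(* A coordinate of [x - node k] in [-2, 2], moved by 3, falls into [0, 6], where the sum over [j]
   with 7 nodes per axis is 1. That sum thus dominates the indicator of the relevant [k]; after
   exchanging sums, [sum_bump_le1] bounds the sum over [k] for each [j]. *)
pose t : V := const_mx 3.
have H (k : {ffun 'I_m -> 'I_n}) : `|bump (x - node k) - bump (y - node k)| <=
    L * `|x - y| * \sum_(j : {ffun 'I_m -> 'I_7}) bump (x + t - node j - node k).
  have S0 : 0 <= \sum_(j : {ffun 'I_m -> 'I_7}) bump (x + t - node j - node k).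
    by apply: sumr_ge0 => j _; exact: bump_ge0.
  have [k2|k2] := ltP `|x - node k| 2; last first.
    have T : `|x - node k| <= `|x - y| + `|y - node k|.
      rewrite (_ : x - node k = (x - y) + (y - node k)) ?ler_normD//.
      by rewrite addrA subrK.
    rewrite (bump_supp (x := x - _)); last by lra.
    rewrite (bump_supp (x := y - _)); last by lra.
    by rewrite subrr normr0 !mulr_ge0.
  under eq_bigr do rewrite addrAC.
  rewrite sum_bump_eq1 ?mulr1; last first.
    move=> i; have := ler_norm_coord (x - node k) i; rewrite !mxE.
    set u := x ord0 i; set w := (k i)%:R; rewrite ler_norml => /andP[? ?].
    by apply/andP; split; lra.
  by have := BL (x - node k) (y - node k); rewrite opprB addrA subrK.
apply: le_trans (ler_sum _ (fun k _ => H k)) _.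
rewrite -mulr_sumr exchange_big /= [leRHS]mulrAC ler_wpM2l ?mulr_ge0//.
rewrite -sumr_const; apply: ler_sum => j _; exact: sum_bump_le1.
Qed.

End Bump.

(** * Smooth approximation of Hoelder maps *)

Section EuclideanNorm.
Context (R : realType) (m : nat).
Implicit Types v : 'rV[R]_m.

Lemma ler_norm_eucl v : `|v| <= eucl_norm v.
Proof.
apply: norm_rV_le => [|i]; first exact: sqrtr_ge0.
rewrite /eucl_norm -sqrtr_sqr ler_wsqrtr// (bigD1 i)//= lerDl.
by apply: sumr_ge0 => j _; exact: sqr_ge0.
Qed.

Lemma eucl_le_norm v : eucl_norm v <= m.+1%:R * `|v|.
Proof.
rewrite /eucl_norm -[leRHS]ger0_norm ?mulr_ge0// -sqrtr_sqr ler_wsqrtr// exprMn.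
apply: (@le_trans _ _ (\sum_(i < m) `|v| ^+ 2)).
  apply: ler_sum => i _; rewrite -(real_normK (num_real (v ord0 i))).
  by rewrite lerXn2r ?nnegrE// ler_norm_coord.
rewrite sumr_const card_ord -[leLHS]mulr_natl ler_wpM2r ?sqr_ge0//.
by rewrite -natrX ler_nat -mulnn mulSn (leq_trans (leqnSn m))// leq_addr.
Qed.

End EuclideanNorm.

(** The Hoelder condition in the native sup norms; it differs from the Euclidean one by factors
    depending on the dimensions and [gamma]. *)
Definition holder_sup (R : realType) (m N : nat) (gamma C : R) (K : set 'rV[R]_m)
    (f : 'rV[R]_m -> 'rV[R]_N) : Prop :=
  forall x y, K x -> K y -> `|f x - f y| <= C * `|x - y| `^ gamma.

Lemma holder_eucl_sup (R : realType) (m N : nat) (gamma C : R) (K : set 'rV[R]_m)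
    (f : 'rV[R]_m -> 'rV[R]_N) : 0 <= gamma ->
  (forall x y, K x -> K y -> eucl_dist (f x) (f y) <= C * eucl_dist x y `^ gamma) ->
  holder_sup gamma (`|C| * m.+1%:R `^ gamma) K f.
Proof.
move=> g0 fC x y Kx Ky; rewrite (le_trans (ler_norm_eucl _))//.
rewrite (le_trans (fC x y Kx Ky))// -mulrA -powRM//.
rewrite (@le_trans _ _ (`|C| * eucl_dist x y `^ gamma))//.
  by rewrite ler_wpM2r ?powR_ge0// ler_norm.
rewrite ler_wpM2l// ge0_ler_powR ?nnegrE ?mulr_ge0//; first exact: sqrtr_ge0.
exact: eucl_le_norm.
Qed.

Lemma holder_sup_eucl (R : realType) (m N : nat) (gamma C : R) (K : set 'rV[R]_m)
    (f : 'rV[R]_m -> 'rV[R]_N) : 0 <= gamma -> 0 <= C ->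
  holder_sup gamma C K f ->
  forall x y, K x -> K y -> eucl_dist (f x) (f y) <= N.+1%:R * C * eucl_dist x y `^ gamma.
Proof.
move=> g0 C0 fC x y Kx Ky; rewrite (le_trans (eucl_le_norm _))// -mulrA ler_wpM2l//.
rewrite (le_trans (fC x y Kx Ky))// ler_wpM2l// ge0_ler_powR ?nnegrE//.
  exact: sqrtr_ge0.
exact: ler_norm_eucl.
Qed.

Section CompactNeighborhood.
Context (R : realType) (n : nat).
Local Notation V := 'rV[R]_n.

(** Compactness gives a margin [r] uniform over [K]; [K'] is the sum of [K] and the closed ball of
    radius [r], a continuous image of a compact product. *)
Lemma compact_nbhs (Omega K : set V) : open Omega -> compact K -> K `<=` Omega ->
  exists r K', [/\ 0 < r, compact K', K' `<=` Omega &
    forall x y, K x -> `|y - x| <= r -> K' y].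
Proof.
move=> oO cK KO.
have [r r0 rO] : exists2 r, 0 < r & forall x y, K x -> `|y - x| <= r -> Omega y.
  pose P (r : R) (x : V) := forall y, `|y - x| <= r -> Omega y.
  have H : forall x, K x -> \forall x' \near x & r \near (0 : R)^'+, P r x'.
    move=> x /KO Ox; move: oO; rewrite openE => /(_ _ Ox)/nbhs_ballP[e /= e0 eO].
    have e2 : 0 < e / 2 by lra.
    near=> x' r => y /= yx'; apply: eO; rewrite -ball_normE /ball_/=.
    have xx' : `|x - x'| < e / 2.
      by near: x'; apply/nbhs_ballP; exists (e / 2) => //= z; rewrite -ball_normE.
    have re : r < e / 2 by near: r; exact: nbhs_right_lt.
    rewrite (_ : x - y = (x - x') - (y - x')); last by rewrite opprB addrA subrK.
    by rewrite (le_lt_trans (ler_normB _ _))//; lra.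
  have /compact_near_coveringP /(_ R (0 : R)^'+ P _ H) := cK.
  move=> near0; near (0 : R)^'+ => r; exists r; first by near: r; exact: nbhs_right_gt.
  by move=> x y Kx; have := near near0 r; apply => //; near: r.
pose K' : set V := (fun p : V * V => p.1 + p.2) @` (K `*` [set v | `|v| <= r]).
exists r, K'; split => //.
- have cX := compact_setX cK (@compact_cball R n r).
  apply: (continuous_compact _ cX).
  by apply: continuous_subspaceT => p; exact: (@add_continuous V).
- by move=> _ [[x v] [/= Kx vr] <-]; apply: (rO x) => //; rewrite addrC addKr.
- by move=> x y Kx yx; exists (x, y - x) => //=; rewrite addrC subrK.
Unshelve. all: by end_near. Qed.

End CompactNeighborhood.

Section SmoothCombination.
Context (R : realType) (m N : nat) (I : Type) (c : I -> 'rV[R]_N).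
Local Notation V := 'rV[R]_m.

Lemma differentiable_comb (g : I -> V -> R) (s : seq I) x v :
  (forall i, differentiable (g i) x) ->
  differentiable (fun x => \sum_(i <- s) g i x *: c i) x /\
  'D_v (fun x => \sum_(i <- s) g i x *: c i) x = \sum_(i <- s) 'D_v (g i) x *: c i.
Proof.
move=> dg; elim: s => [|i s [ds Ds]].
  under eq_fun do rewrite big_nil.
  by rewrite big_nil; split; [exact: differentiable_cst|exact: derive_cst].
under eq_fun do rewrite big_cons.
have di : differentiable (fun x => g i x *: c i) x by exact: differentiableZl.
split; first exact: differentiableD.
rewrite big_cons -Ds [LHS](deriveD (diff_derivable (v := v) di) (diff_derivable (v := v) ds)).
by congr (_ + _); rewrite !deriveE// diffZl.
Qed.

Lemma smooth_on_comb (g : I -> V -> R) (s : seq I) Omega : (forall i, Cinf (g i)) ->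
  smooth_on Omega (fun x => \sum_(i <- s) g i x *: c i).
Proof.
move=> Cg vs.
have dg i x : differentiable (iter_derive vs (g i : V -> R^o)) x.
  exact: (Cinf_smooth_on (Omega := setT) (Cg i)).
suff -> : iter_derive vs (fun x => \sum_(i <- s) g i x *: c i) =
    fun x => \sum_(i <- s) iter_derive vs (g i : V -> R^o) x *: c i.
  by move=> x _; exact: (differentiable_comb s 0 (fun i => dg i x)).1.
elim: vs {dg} => [//|v vs IH]; rewrite [LHS]/= -/(iter_derive vs _) IH.
apply/funext => x; apply: (differentiable_comb s v _).2 => i.
exact: (Cinf_smooth_on (Omega := setT) (Cg i)).
Qed.

End SmoothCombination.

(** * Quasi-interpolation of a map from its values on a mesh *)

Section QuasiInterpolant.
Context (R : realType) (m N : nat) (f : 'rV[R]_m -> 'rV[R]_N).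
Local Notation V := 'rV[R]_m.

(* The mesh is [j.+1^-1] and the nodes fill the cube of half-side [j.+1]. *)
Definition mesh_node (j : nat) (k : {ffun 'I_m -> 'I_(j.+1 ^ 2).*2.+1}) : V :=
  j.+1%:R^-1 *: (node R k - const_mx (j.+1 ^ 2)%:R).

Definition quasi_interp (j : nat) (x : V) : 'rV[R]_N :=
  \sum_(k : {ffun 'I_m -> 'I_(j.+1 ^ 2).*2.+1})
    bump (j.+1%:R *: (x - mesh_node k)) *: f (mesh_node k).

Lemma mesh_nodeE j (k : {ffun 'I_m -> 'I_(j.+1 ^ 2).*2.+1}) x :
  j.+1%:R *: (x - mesh_node k) = j.+1%:R *: x + const_mx (j.+1 ^ 2)%:R - node R k.
Proof.
rewrite /mesh_node scalerBr scalerA divff ?pnatr_eq0// scale1r.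
by rewrite opprB addrA.
Qed.

Lemma quasi_interp_smooth j Omega : smooth_on Omega (quasi_interp j).
Proof.
apply: (@smooth_on_comb R m N _ (fun k => f (mesh_node k))
  (fun k x => bump (j.+1%:R *: (x - mesh_node k)))) => k.
have := Cinf_bump j.+1%:R (- (j.+1%:R *: mesh_node k)).
by congr Cinf; apply/funext => x; rewrite scalerBr.
Qed.

Lemma sum_mesh_bump j x : `|x| <= j.+1%:R ->
  \sum_(k : {ffun 'I_m -> 'I_(j.+1 ^ 2).*2.+1}) bump (j.+1%:R *: (x - mesh_node k)) = 1.
Proof.
move=> xj; under eq_bigr do rewrite mesh_nodeE.
apply: sum_bump_eq1 => i; rewrite !mxE.
have := le_trans (ler_norm_coord x i) xj; rewrite ler_norml => /andP[x1 x2].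
have j0 : 0 <= j.+1%:R :> R by [].
have -> : (j.+1 ^ 2).*2.+1%:R - 1 = 2 * (j.+1 ^ 2)%:R :> R.
  by rewrite -natr1 addrK -mul2n natrM.
rewrite natrX; move: x1 x2 j0; set a := j.+1%:R; set u := x ord0 i => x1 x2 j0.
apply/andP; split; nra.
Qed.

Section Bounds.
Context (L : R).
Hypothesis L0 : 0 <= L.
Hypothesis HL : forall n x y, `|x - y| <= 1 ->
  \sum_(k : {ffun 'I_m -> 'I_n}) `|bump (x - node R k) - bump (y - node R k)| <= L * `|x - y|.
Context (gamma C r : R) (K K' : set V) (j : nat).
Hypotheses (g0 : 0 <= gamma) (g1 : gamma <= 1) (C0 : 0 <= C).
Hypothesis KK' : forall x y, K x -> `|y - x| <= r -> K' y.
Hypothesis fC : holder_sup gamma C K' f.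
Hypothesis Kj : forall x, K x -> `|x| <= j.+1%:R.
Hypothesis rj : 2 * j.+1%:R^-1 <= r.

Let a : R := j.+1%:R.
Let a0 : 0 < a. Proof. by rewrite ltr0n. Qed.
Let p := @mesh_node j.
Let w k x := bump (a *: (x - p k)).

(** Nodes within two mesh widths of a point of [K] lie in [K'] by [rj], so only values of [f] where
    it is Hoelder enter the estimates. *)
Let near_node (s : R) x k : K x -> s <= 2 -> `|a *: (x - p k)| <= s ->
  `|f (p k) - f x| <= C * (s / a) `^ gamma.
Proof.
move=> Kx s2; rewrite normrZ gtr0_norm// mulrC -ler_pdivlMr// => xp.
have r0 : 0 <= r by apply: le_trans rj; rewrite mulr_ge0// invr_ge0.
have Kp : K' (p k).
  apply: (KK' Kx); rewrite distrC (le_trans xp)// (le_trans _ rj)//.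
  by rewrite ler_wpM2r// invr_ge0 ltW.
have K'x : K' x by apply: (KK' Kx); rewrite subrr normr0.
rewrite (le_trans (fC Kp K'x))// ler_wpM2l// ge0_ler_powR ?nnegrE//.
  exact: le_trans xp.
by rewrite distrC.
Qed.

(** The weights sum to 1 on [K], so the error is an average of f(p k) - f(x) over nodes less than
    one mesh width away. *)
Lemma quasi_interp_close x : K x -> `|quasi_interp j x - f x| <= C * a^-1 `^ gamma.
Proof.
move=> Kx; have S1 := sum_mesh_bump (Kj Kx).
have -> : quasi_interp j x - f x = \sum_k w k x *: (f (p k) - f x).
  under [RHS]eq_bigr do rewrite scalerBr.
  by rewrite sumrB -scaler_suml S1 scale1r.
rewrite (le_trans (ler_norm_sum _ _ _))//.
apply: (@le_trans _ _ (\sum_k w k x * (C * a^-1 `^ gamma))); last first.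
  by rewrite -mulr_suml S1 mul1r.
apply: ler_sum => k _; rewrite /w normrZ ger0_norm ?bump_ge0//.
have [k1|k1] := leP 1 `|a *: (x - p k)|; first by rewrite bump_supp// !mul0r.
rewrite ler_wpM2l ?bump_ge0//.
have := near_node Kx (_ : 1 <= 2) (ltW k1); rewrite mul1r; apply.
by rewrite ler1n.
Qed.

(** Above the mesh width the interpolant is compared with [f] at both points, the errors being
    absorbed by d^gamma. Below it the weights are Lipschitz at scale 1 / a, and the constant [f x]
    may be subtracted because the weights sum to 1. *)
Lemma quasi_interp_holder : holder_sup gamma ((3 + 2 * L) * C) K (quasi_interp j).
Proof.
move=> x y Kx Ky; set d := `|x - y|.
have d0 : 0 <= d by exact: normr_ge0.
have r0 : 0 <= r by apply: le_trans rj; rewrite mulr_ge0// invr_ge0.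
have a1 : 0 < a^-1 by rewrite invr_gt0.
have K'x z : K z -> K' z by move=> Kz; apply: (KK' Kz); rewrite subrr normr0.
have [da|da] := leP 1 (a * d).
  have ad : a^-1 `^ gamma <= d `^ gamma.
    have ad : a^-1 <= d by rewrite -[a^-1]mul1r ler_pdivrMr// mulrC.
    by apply: ge0_ler_powR; rewrite ?nnegrE// ltW.
  have H1 := quasi_interp_close Kx; have H2 := quasi_interp_close Ky.
  have H3 := fC (K'x _ Kx) (K'x _ Ky).
  have -> : quasi_interp j x - quasi_interp j y =
     (quasi_interp j x - f x) + (f x - f y) - (quasi_interp j y - f y).
    by rewrite addrA subrK opprB addrA subrK.
  rewrite (le_trans (ler_normB _ _))// (@le_trans _ _
    (C * a^-1 `^ gamma + C * d `^ gamma + C * a^-1 `^ gamma))//.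
    by rewrite lerD// (le_trans (ler_normD _ _))// lerD.
  have H4 : C * a^-1 `^ gamma <= C * d `^ gamma by rewrite ler_wpM2l.
  have H5 : 0 <= L * (C * d `^ gamma) by rewrite !mulr_ge0 ?powR_ge0.
  by nra.
have E z : K z -> quasi_interp j z - f x = \sum_k w k z *: (f (p k) - f x).
  move=> Kz; under [RHS]eq_bigr do rewrite scalerBr.
  by rewrite sumrB -scaler_suml (sum_mesh_bump (Kj Kz)) scale1r.
have -> : quasi_interp j x - quasi_interp j y =
    \sum_k (w k x - w k y) *: (f (p k) - f x).
  transitivity ((quasi_interp j x - f x) - (quasi_interp j y - f x)).
    by rewrite opprB addrA subrK.
  rewrite (E x Kx) (E y Ky) -sumrB; apply: eq_bigr => k _.
  by rewrite scalerBl.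
have fk k : `|(w k x - w k y) *: (f (p k) - f x)| <=
    `|w k x - w k y| * (C * (2 / a) `^ gamma).
  rewrite normrZ; have [k2|k2] := leP `|a *: (x - p k)| 2.
    by rewrite ler_wpM2l//; exact: near_node.
  (* Here [x] is more than two mesh widths from the node and [y] less than one from [x], so both
     weights vanish. *)
  have T : `|a *: (x - p k)| <= a * d + `|a *: (y - p k)|.
    have -> : a *: (x - p k) = a *: (x - y) + a *: (y - p k).
      by rewrite -scalerDr addrA subrK.
    by rewrite (le_trans (ler_normD _ _))// normrZ gtr0_norm.
  rewrite /w (bump_supp (x := a *: (x - _))); last by rewrite ltW// (lt_trans _ k2)// ltr1n.
  rewrite (bump_supp (x := a *: (y - _))); last by lra.
  by rewrite subrr normr0 !mul0r.
rewrite (le_trans (ler_norm_sum _ _ _))// (le_trans (ler_sum _ (fun k _ => fk k)))//.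
rewrite -mulr_suml.
have S : \sum_k `|w k x - w k y| <= L * (a * d).
  have -> : a * d = `|(a *: x + const_mx (j.+1 ^ 2)%:R) - (a *: y + const_mx (j.+1 ^ 2)%:R)|.
    by rewrite opprD addrACA subrr addr0 -scalerBr normrZ gtr0_norm.
  under eq_bigr do rewrite /w /p !mesh_nodeE.
  apply: HL; rewrite opprD addrACA subrr addr0 -scalerBr normrZ gtr0_norm//.
  exact: ltW.
have P1 : 0 <= C * (2 / a) `^ gamma by rewrite mulr_ge0 ?powR_ge0.
rewrite (le_trans (ler_wpM2r P1 S))//.
(* From a d <= 1 and gamma <= 1 one gets a d <= (a d)^gamma: the Lipschitz factor at mesh scale
   becomes a Hoelder factor free of [a]. *)
have P2 : (a * d) * a^-1 `^ gamma <= d `^ gamma.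
  have an0 : a != 0 by rewrite gt_eqF.
  have -> : d `^ gamma = (a * d) `^ gamma * a^-1 `^ gamma.
    have ad_ge0 : 0 <= a * d by rewrite mulr_ge0// ltW.
    by rewrite -powRM// ?(ltW a1)// (mulrC a) mulfK.
  rewrite ler_wpM2r ?powR_ge0//.
  have [->|ad0] := eqVneq (a * d) 0; first exact: powR_ge0.
  have ad1 : 0 < a * d by rewrite lt_def ad0 mulr_ge0 // ltW.
  by apply: ger1_powR; rewrite // ad1 ltW.
have P3 : 2 `^ gamma <= 2 :> R by apply: ler1_powR; rewrite // ler1n.
have -> : (2 / a) `^ gamma = 2 `^ gamma * a^-1 `^ gamma by rewrite powRM// ltW.
have -> : L * (a * d) * (C * (2 `^ gamma * a^-1 `^ gamma)) =
  (L * C) * ((a * d * a^-1 `^ gamma) * 2 `^ gamma) by ring.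
have LC0 : 0 <= L * C by exact: mulr_ge0.
have PD : 0 <= C * d `^ gamma by rewrite mulr_ge0 ?powR_ge0.
apply: (@le_trans _ _ ((L * C) * (d `^ gamma * 2))); last by lra.
rewrite ler_wpM2l// ler_pM ?powR_ge0// mulr_ge0 ?powR_ge0// mulr_ge0// ltW.
Qed.

End Bounds.

End QuasiInterpolant.

Lemma holder_sup_bounded (R : realType) (m N : nat) (gamma C : R) (K : set 'rV[R]_m)
    (f : 'rV[R]_m -> 'rV[R]_N) : 0 <= gamma -> 0 <= C -> compact K ->
  holder_sup gamma C K f -> exists2 M, 0 <= M & forall x, K x -> `|f x| <= M.
Proof.
move=> g0 C0 cK fC; have [r Kr] := compact_norm_le cK.
have [[x0 Kx0]|K0] := pselect (exists x0, K x0); last first.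
  by exists 0 => // x Kx; exfalso; apply: K0; exists x.
exists (`|f x0| + C * (2 * r) `^ gamma) => [|x Kx].
  by rewrite addr_ge0// mulr_ge0 ?powR_ge0.
have r0 : 0 <= r by apply: le_trans (Kr x0 Kx0).
rewrite -[f x](subrK (f x0)) addrC (le_trans (ler_normD _ _))// lerD2l.
rewrite (le_trans (fC x x0 Kx Kx0))// ler_wpM2l//.
apply: ge0_ler_powR; rewrite ?nnegrE ?mulr_ge0//.
rewrite (le_trans (ler_normB _ _))//.
by have := Kr x Kx; have := Kr x0 Kx0; lra.
Qed.

(** Split d as d^(1 - gamma) d^gamma and bound the first factor by [D]. *)
Lemma ler_powR_bounded (R : realType) (gamma d D : R) :
  0 <= gamma -> gamma <= 1 -> 0 <= d -> d <= D -> 1 <= D -> d <= D * d `^ gamma.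
Proof.
move=> g0 g1 d0 dD D1.
rewrite -{1}[d]powRr1// (_ : 1 = (1 - gamma) + gamma); last by ring.
rewrite powRD ?subrK ?oner_eq0// ler_wpM2r ?powR_ge0//.
apply: (@le_trans _ _ (D `^ (1 - gamma))).
  by apply: ge0_ler_powR; rewrite ?nnegrE ?subr_ge0// (le_trans d0).
by apply: ler1_powR => //; lra.
Qed.

(** Bounds that may depend on [j]. They serve the finitely many meshes too coarse for the margin
    around [K], since [smooth_approximation] asks for bounds valid for every positive [eps]. *)
Lemma quasi_interp_rough (R : realType) (m N : nat) (gamma : R) (K : set 'rV[R]_m)
    (f : 'rV[R]_m -> 'rV[R]_N) (j : nat) : 0 <= gamma -> gamma <= 1 -> compact K ->
  exists2 C, 0 <= C & (forall x, K x -> `|quasi_interp f j x| <= C) /\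
    holder_sup gamma C K (quasi_interp f j).
Proof.
move=> g0 g1 cK; have [r Kr] := compact_norm_le cK.
have [L L0 BL] := bump_lipschitz R m.
pose A : R := \sum_(k : {ffun 'I_m -> 'I_(j.+1 ^ 2).*2.+1}) L * j.+1%:R * `|f (mesh_node R k)|.
have A0 : 0 <= A by apply: sumr_ge0 => k _; rewrite !mulr_ge0.
have lipG x y : `|quasi_interp f j x - quasi_interp f j y| <= A * `|x - y|.
  rewrite /quasi_interp -sumrB (le_trans (ler_norm_sum _ _ _))// /A mulr_suml.
  apply: ler_sum => k _; rewrite -scalerBl normrZ mulrAC ler_wpM2r//.
  rewrite (le_trans (BL _ _))// -mulrA ler_wpM2l// -scalerBr opprB addrA subrK.
  by rewrite normrZ ger0_norm.
pose D := 1 + 2 * `|r|.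
have D1 : 1 <= D by rewrite lerDl mulr_ge0.
have AD : 0 <= A * D by rewrite mulr_ge0// (le_trans _ D1).
have holG : holder_sup gamma (A * D) K (quasi_interp f j).
  move=> x y Kx Ky; rewrite (le_trans (lipG _ _))// -mulrA ler_wpM2l//.
  apply: ler_powR_bounded => //; rewrite (le_trans (ler_normB _ _))//.
  have := le_trans (Kr x Kx) (ler_norm r); have := le_trans (Kr y Ky) (ler_norm r).
  by rewrite /D; lra.
have [M M0 KM] := holder_sup_bounded g0 AD cK holG.
exists (M + A * D); first exact: addr_ge0.
split=> [x Kx|x y Kx Ky]; first by rewrite (le_trans (KM x Kx))// lerDl.
by rewrite (le_trans (holG x y Kx Ky))// ler_wpM2r ?powR_ge0// lerDr.
Qed.

Lemma exists_smooth_approximation (R : realType) (m N : nat) (gamma : R)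
    (Omega : set 'rV[R]_m) (f : 'rV[R]_m -> 'rV[R]_N) :
  0 < gamma -> gamma <= 1 -> open Omega ->
  holder_loc (@eucl_dist R N) gamma Omega f ->
  exists F, smooth_approximation gamma Omega f F.
Proof.
move=> g0 g1 oO fH; have g0' := ltW g0.
have [L L0 HL] := sum_bump_lipschitz R m.
have loc K : compact K -> K `<=` Omega -> exists C j0, [/\ 0 <= C,
    (forall j x, (j0 <= j)%N -> K x -> `|quasi_interp f j x - f x| <= C * j.+1%:R^-1 `^ gamma),
    (forall j x, (j0 <= j)%N -> K x -> `|quasi_interp f j x| <= C) &
    forall j, (j0 <= j)%N -> holder_sup gamma C K (quasi_interp f j)].
  move=> cK KO; have [r [K' [r0 cK' K'O KK']]] := compact_nbhs oO cK KO.
  have [C0 fC0] := fH K' cK' K'O.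
  have := holder_eucl_sup g0' fC0; set C := _ * _ => fC.
  have C_ge0 : 0 <= C by rewrite mulr_ge0// powR_ge0.
  have [R0 KR0] := compact_norm_le cK.
  have [M M0 fM] := holder_sup_bounded g0' C_ge0 cK' fC.
  (* From [j0] on, the cube of nodes contains [K] and two mesh widths fit into the margin [r]. *)
  pose j0 := Num.truncn (`|R0| + 2 / r).
  have j0P j : (j0 <= j)%N -> `|R0| + 2 / r < j.+1%:R.
    by move=> jj; rewrite (lt_le_trans (truncnS_gt _))// ler_nat.
  have r2 : 0 < 2 / r by rewrite divr_gt0.
  have Kj j x : (j0 <= j)%N -> K x -> `|x| <= j.+1%:R.
    move=> /j0P jj /KR0 xR; have := ler_norm R0; lra.
  have rj j : (j0 <= j)%N -> 2 * j.+1%:R^-1 <= r.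
    move=> /j0P jj; rewrite ler_pdivrMr// mulrC -ler_pdivrMr//.
    by have := normr_ge0 R0; lra.
  have close j x : (j0 <= j)%N -> K x ->
      `|quasi_interp f j x - f x| <= C * j.+1%:R^-1 `^ gamma.
    move=> jj Kx.
    exact: (quasi_interp_close g0' C_ge0 KK' fC (fun x => Kj j x jj) (rj j jj) Kx).
  have K'x x : K x -> K' x by move=> Kx; apply: (KK' x) => //; rewrite subrr normr0 ltW.
  have le1 j : j.+1%:R^-1 `^ gamma <= 1 :> R.
    apply: (@le_trans _ _ (1 `^ gamma)); last by rewrite powR1.
    apply: ge0_ler_powR; rewrite ?nnegrE//.
    by rewrite invf_le1// ler1n.
  have B0 : 0 <= 2 * L * C by rewrite !mulr_ge0.
  exists (M + (3 + 2 * L) * C), j0; split.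
  - by rewrite addr_ge0//; lra.
  - move=> j x jj Kx; rewrite (le_trans (close j x jj Kx))// ler_wpM2r ?powR_ge0//; lra.
  - move=> j x jj Kx; have := close j x jj Kx; have := fM x (K'x x Kx).
    have : C * j.+1%:R^-1 `^ gamma <= C by rewrite -[leRHS]mulr1 ler_wpM2l.
    have : `|quasi_interp f j x| <= `|quasi_interp f j x - f x| + `|f x|.
      by rewrite -{1}(subrK (f x) (quasi_interp f j x)) ler_normD.
    by lra.
  - move=> j jj x y Kx Ky.
    rewrite (le_trans (quasi_interp_holder L0 HL g0' g1 C_ge0 KK' fC
      (fun x => Kj j x jj) (rj j jj) Kx Ky))// ler_wpM2r ?powR_ge0//; lra.
exists (fun eps => quasi_interp f (Num.truncn eps^-1)); split.
- by move=> eps _; exact: quasi_interp_smooth.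
- move=> x Ox; have [C [j0 [C0 xC _ _]]] := loc [set x] (@compact_set1 _ x)
    (fun y => (fun E => eq_ind_r Omega Ox E)).
  apply/cvgrPdist_le => e e0.
  (* Chosen so that C a^-gamma <= e as soon as a >= T. *)
  pose T := (C / e) `^ gamma^-1.
  have T0 : 0 <= T by exact: powR_ge0.
  near=> eps.
  have eps0 : 0 < eps by near: eps; exact: nbhs_right_gt.
  have epsT : eps < (T + j0%:R + 1)^-1.
    by near: eps; apply: nbhs_right_lt; rewrite invr_gt0 ltr_wpDl ?addr_ge0.
  have Te : T + j0%:R + 1 < eps^-1.
    by rewrite -[ltLHS]invrK ltf_pV2// posrE ?invr_gt0 ?ltr_wpDl ?addr_ge0.
  have jj : (j0 <= Num.truncn eps^-1)%N.
    rewrite truncn_ge_nat ?invr_ge0 ?ltW//; lra.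
  rewrite distrC (le_trans (xC _ x jj erefl))//.
  have := truncnS_gt eps^-1; set a := _.+1%:R => aeps.
  have a0 : 0 < a by rewrite ltr0n.
  have Ta : T <= a by have := ler0n R j0; lra.
  have : T `^ gamma <= a `^ gamma by apply: ge0_ler_powR; rewrite ?nnegrE// ltW.
  have Ce0 : 0 <= C / e by rewrite divr_ge0 // ltW.
  rewrite /T -powRrM mulVf ?gt_eqF// powRr1// => H.
  have ag : 0 < a `^ gamma by exact: powR_gt0.
  rewrite -[a^-1]powR_inv1 ?(ltW a0)// -powRrM mulN1r powRN ler_pdivrMr// mulrC.
  by rewrite -ler_pdivrMr.
- move=> K cK KO; have [C [j0 [C0 _ CM CH]]] := loc K cK KO.
  have /choice[c cP] : forall j, exists c, 0 <= c /\
     ((forall x, K x -> `|quasi_interp f j x| <= c) /\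
      holder_sup gamma c K (quasi_interp f j)).
    by move=> j; have [c c0 cH] := quasi_interp_rough f j g0' g1 cK; exists c.
  (* Adding the constants of the finitely many meshes below [j0] makes the bound uniform in
     [eps]. *)
  pose Ct := C + \sum_(j < j0) c j.
  have S0 : 0 <= \sum_(j < j0) c j by apply: sumr_ge0 => j _; have [] := cP j.
  have Ct0 : 0 <= Ct by exact: addr_ge0.
  have main j : (forall x, K x -> `|quasi_interp f j x| <= Ct) /\
      holder_sup gamma Ct K (quasi_interp f j).
    have [jj|jj] := leqP j0 j.
      split=> [x Kx|x y Kx Ky]; first by rewrite (le_trans (CM _ _ jj Kx))// lerDl.
      by rewrite (le_trans (CH _ jj x y Kx Ky))// ler_wpM2r ?powR_ge0// lerDl.
    have cC : c j <= Ct.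
      rewrite /Ct (bigD1 (Ordinal jj))//= addrCA lerDl addr_ge0// sumr_ge0// => i _.
      by have [] := cP i.
    have [_ [cM cH]] := cP j.
    split=> [x Kx|x y Kx Ky]; first by rewrite (le_trans (cM _ Kx)).
    by rewrite (le_trans (cH x y Kx Ky))// ler_wpM2r ?powR_ge0.
  exists (N.+1%:R * Ct) => eps _ x y Kx Ky; have [M H] := main (Num.truncn eps^-1).
  split; last exact: (holder_sup_eucl g0' Ct0 H Kx Ky).
  by rewrite (le_trans (eucl_le_norm _))// ler_wpM2l// M.
Unshelve. all: by end_near. Qed.

(** * The contact form along Hoelder maps *)

Section ContactForm.
Context (R : realType) (n : nat).
Local Notation W := 'rV[R]_(2 * n).+1.
Implicit Types p q s w : W.

Definition area_form p w : R :=
  2 * \sum_(j < n) (heis_x p j * heis_y w j - heis_y p j * heis_x w j).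

Lemma contact_formE p w : contact_form p w = heis_t w + area_form p w.
Proof. by []. Qed.

Lemma area_form_le p w : `|area_form p w| <= 4 * n%:R * (`|p| * `|w|).
Proof.
rewrite /area_form normrM ger0_norm// (_ : 4 * _ * _ =
  2 * (n%:R * (2 * (`|p| * `|w|)))); last by ring.
rewrite ler_wpM2l// (le_trans (ler_norm_sum _ _ _))//.
apply: (@le_trans _ _ (\sum_(j < n) 2 * (`|p| * `|w|))).
  apply: ler_sum => j _; rewrite (le_trans (ler_normB _ _))// !normrM.
  by rewrite mulr_natl mulr2n lerD// ler_pM// ler_norm_coord.
by rewrite sumr_const card_ord [leRHS]mulr_natl.
Qed.

Lemma contact_form_le p w : `|contact_form p w| <= (1 + 4 * n%:R * `|p|) * `|w|.
Proof.
rewrite contact_formE (le_trans (ler_normD _ _))// [leRHS]mulrDl mul1r lerD//.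
  exact: ler_norm_coord.
by have := area_form_le p w; rewrite !mulrA.
Qed.

Lemma contact_formD p u w : contact_form p (u + w) = contact_form p u + contact_form p w.
Proof.
pose S w := \sum_(j < n) (heis_x p j * heis_y w j - heis_y p j * heis_x w j).
have SD : S (u + w) = S u + S w.
  rewrite -big_split; apply: eq_bigr => j _; rewrite /heis_x /heis_y !mxE /=; ring.
by rewrite /contact_form -!/(S _) SD /heis_t mxE; ring.
Qed.

Lemma contact_formZ p a w : contact_form p (a *: w) = a * contact_form p w.
Proof.
pose S w := \sum_(j < n) (heis_x p j * heis_y w j - heis_y p j * heis_x w j).
have SZ : S (a *: w) = a * S w.
  rewrite mulr_sumr; apply: eq_bigr => j _; rewrite /heis_x /heis_y !mxE /=; ring.
by rewrite /contact_form -!/(S _) SZ /heis_t mxE; ring.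
Qed.

(** The terms in t telescope and [area_form] is bilinear and alternating, so the defect of
    additivity depends on the two increments only and is quadratic in them. *)
Lemma contact_form_cocycle p q s :
  contact_form p (s - p) = contact_form p (q - p) + contact_form q (s - q)
   - area_form (p - q) (q - s).
Proof.
rewrite /contact_form /area_form /heis_t /heis_x /heis_y.
have -> : \sum_(j < n) (p ord0 (inord (2 * j)) * (s - p) ord0 (inord (2 * j).+1) -
      p ord0 (inord (2 * j).+1) * (s - p) ord0 (inord (2 * j))) =
  \sum_(j < n) (p ord0 (inord (2 * j)) * (q - p) ord0 (inord (2 * j).+1) -
      p ord0 (inord (2 * j).+1) * (q - p) ord0 (inord (2 * j))) +
  \sum_(j < n) (q ord0 (inord (2 * j)) * (s - q) ord0 (inord (2 * j).+1) -
      q ord0 (inord (2 * j).+1) * (s - q) ord0 (inord (2 * j))) -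
  \sum_(j < n) ((p - q) ord0 (inord (2 * j)) * (q - s) ord0 (inord (2 * j).+1) -
      (p - q) ord0 (inord (2 * j).+1) * (q - s) ord0 (inord (2 * j))).
  by rewrite -big_split -sumrB /=; apply: eq_bigr => j _; rewrite !mxE; ring.
by rewrite !mxE; ring.
Qed.

(** The twisted term of the metric is [area_form q p], which equals [area_form q (p - q)] because
    [area_form] is alternating. *)
Lemma koranyi_distE p q :
  koranyi_dist p q = (heis_zdist p q ^+ 4 + `|contact_form q (p - q)| ^+ 2) `^ 4^-1.
Proof.
rewrite /koranyi_dist /contact_form; congr ((_ + `|_| ^+ 2) `^ _).
rewrite /heis_t /heis_x /heis_y !mxE; congr (_ + _ * _).
by apply: eq_bigr => j _; rewrite !mxE; ring.
Qed.

Lemma heis_zdist_le p q : heis_zdist p q <= (2 * n)%:R * `|p - q|.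
Proof.
have c i : `|p ord0 i - q ord0 i| <= `|p - q|.
  by have := ler_norm_coord (p - q) i; rewrite !mxE.
rewrite /heis_zdist -[leRHS]ger0_norm ?mulr_ge0// -sqrtr_sqr ler_wsqrtr//.
apply: (@le_trans _ _ (\sum_(j < n) 2 * `|p - q| ^+ 2)).
  apply: ler_sum => j _; rewrite mulr_natl mulr2n /heis_x /heis_y.
  by rewrite lerD// -(real_normK (num_real (_ - _))) lerXn2r ?nnegrE.
rewrite sumr_const card_ord -[leLHS]mulr_natl mulrA exprMn ler_wpM2r ?sqr_ge0//.
rewrite -natrM -natrX ler_nat mulnC -mulnn.
by case: (2 * n)%N => // k; rewrite leq_pmulr.
Qed.

Lemma continuous_contact_form (T : topologicalType) (F G : T -> W) (x : T) :
  {for x, continuous F} -> {for x, continuous G} ->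
  {for x, continuous (fun y => contact_form (F y) (G y))}.
Proof.
move=> cF cG.
have cc (H : T -> W) i : {for x, continuous H} -> {for x, continuous (fun y => H y ord0 i)}.
  move=> cH; have := @coord_continuous R 1 (2 * n).+1 ord0 i (H x).
  exact: (@continuous_comp _ _ _ H (fun M : W => M ord0 i)).
pose S j y := F y ord0 (inord (2 * j)) * G y ord0 (inord (2 * j).+1) -
  F y ord0 (inord (2 * j).+1) * G y ord0 (inord (2 * j)).
have cS : {for x, continuous (\sum_(j < n) S j)}.
  elim/big_ind: _ => [|f g cf cg|j _].
  - exact: cst_continuous.
  - exact: (continuousD cf cg).
  - exact: (continuousB (continuousM (cc _ _ cF) (cc _ _ cG))
                        (continuousM (cc _ _ cF) (cc _ _ cG))).
have := continuousD (cc _ ord_max cG) (continuousM (@cst_continuous T R 2 x) cS).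
by congr {for x, continuous _}; apply/funext => y; rewrite /= fct_sumE.
Qed.

End ContactForm.

(** * Linearity of the integral on continuous functions with bounded support *)

Section SupportedIntegrals.
Context (R : realType) (m : nat).
Local Notation V := 'rV[R]_m.
Implicit Types (f g : V -> R).

Lemma cont_supp_le (r s : R) g : r <= s -> cont_supp r g -> cont_supp s g.
Proof. by move=> rs [cg g0]; split=> // x sx; rewrite g0// (le_lt_trans rs). Qed.

Lemma cont_suppD (r : R) f g :
  cont_supp r f -> cont_supp r g -> cont_supp r (fun x => f x + g x).
Proof.
move=> [cf f0] [cg g0]; split=> [x|x xr]; last by rewrite f0// g0// addr0.
exact: (continuousD (cf x) (cg x)).
Qed.

Lemma cont_suppZ (r a : R) g : cont_supp r g -> cont_supp r (fun x => a * g x).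
Proof.
move=> [cg g0]; split=> [x|x xr]; last by rewrite g0// mulr0.
exact: (continuousM (@cst_continuous V R a x) (cg x)).
Qed.

Lemma cont_suppB (r : R) f g :
  cont_supp r f -> cont_supp r g -> cont_supp r (fun x => f x - g x).
Proof.
move=> [cf f0] [cg g0]; split=> [x|x xr]; last by rewrite f0// g0// subr0.
exact: (continuousB (cf x) (cg x)).
Qed.

Lemma Rintegral_suppD (r : R) f g : cont_supp r f -> cont_supp r g ->
  \int[lebesgue_rV]_x (f x + g x) = \int[lebesgue_rV]_x f x + \int[lebesgue_rV]_x g x.
Proof.
by move=> sf sg; rewrite (RintegralD measurableT (cont_supp_integrable sf)
  (cont_supp_integrable sg)).
Qed.

Lemma Rintegral_suppB (r : R) f g : cont_supp r f -> cont_supp r g ->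
  \int[lebesgue_rV]_x (f x - g x) = \int[lebesgue_rV]_x f x - \int[lebesgue_rV]_x g x.
Proof.
by move=> sf sg; rewrite (RintegralB measurableT (cont_supp_integrable sf)
  (cont_supp_integrable sg)).
Qed.

Lemma Rintegral_suppZ (r a : R) g : cont_supp r g ->
  \int[lebesgue_rV]_x (a * g x) = a * \int[lebesgue_rV]_x g x.
Proof. by move=> sg; rewrite (RintegralZl _ measurableT (cont_supp_integrable sg)). Qed.

Lemma cont_supp_sum (r : R) (I : Type) (s : seq I) (F : I -> V -> R) :
  (forall i, cont_supp r (F i)) -> cont_supp r (fun x => \sum_(i <- s) F i x).
Proof.
move=> sF; elim: s => [|i s IH].
  by under eq_fun do rewrite big_nil; split=> // x; exact: cst_continuous.
by under eq_fun do rewrite big_cons; exact: cont_suppD.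
Qed.

Lemma Rintegral_supp_sum (r : R) (I : Type) (s : seq I) (F : I -> V -> R) :
  (forall i, cont_supp r (F i)) ->
  \int[lebesgue_rV]_x (\sum_(i <- s) F i x) = \sum_(i <- s) \int[lebesgue_rV]_x F i x.
Proof.
move=> sF; elim: s => [|i s IH].
  under eq_Rintegral do rewrite big_nil.
  by rewrite big_nil Rintegral_cst// mul0r.
under eq_Rintegral do rewrite big_cons.
by rewrite big_cons -IH (Rintegral_suppD (sF i) (cont_supp_sum s sF)).
Qed.

(** Off the closed set [K] the product vanishes on an open set, so continuity of [g] matters at the
    points of [K] only. This is how maps controlled on [Omega] alone enter integrals over the whole
    space. *)
Lemma cont_supp_mul (r : R) (K : set V) f g : closed K -> (forall x, K x -> `|x| <= r) ->
  continuous f -> (forall x, ~ K x -> f x = 0) ->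
  (forall x, K x -> {for x, continuous g}) -> cont_supp r (fun x => f x * g x).
Proof.
move=> cK Kr cf f0 cg; split=> [x|x xr]; last first.
  by rewrite f0 ?mul0r// => /Kr; rewrite leNgt xr.
have [Kx|Kx] := pselect (K x); first exact: (continuousM (cf x) (cg x Kx)).
rewrite /continuous_at f0// mul0r.
have E : {near x, (fun y => f y * g y) =1 cst 0}.
  have : \forall y \near x, ~ K y.
    by apply: (@open_nbhs_nbhs _ _ (~` K)); split => //; exact: closed_openC.
  by apply: filterS => y Ky; rewrite f0// mul0r.
have E' : {near x, cst 0 =1 (fun y => f y * g y)}.
  by apply: filterS E => y ->.
have c0 : (cst 0 : V -> R) y @[y --> x] --> (0 : R) by exact: (@cst_continuous V R (0 : R) x).
exact: cvg_trans (near_eq_cvg E') c0.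
Qed.

End SupportedIntegrals.

Lemma geometric_telescope (R : realFieldType) (E rho : R) (e : nat -> R) :
  0 <= rho -> rho < 1 -> 0 <= E -> (forall k, `|e k - e k.+1| <= E * rho ^+ k) ->
  forall k, `|e 0%N - e k| <= E / (1 - rho).
Proof.
move=> r0 r1 E0 he k.
have r10 : 0 < 1 - rho by lra.
(* The induction carries the exact partial sum of the geometric series. *)
suff H : `|e 0%N - e k| <= E * (1 - rho ^+ k) / (1 - rho).
  rewrite (le_trans H)// ler_pM2r ?invr_gt0// ler_piMr// gerBl exprn_ge0//.
elim: k => [|k IH]; first by rewrite subrr normr0 expr0 subrr mulr0 mul0r.
rewrite -(subrK (e k) (e 0%N)) -addrA (le_trans (ler_normD _ _))//.
rewrite (le_trans (lerD IH (he k)))// ler_pdivlMr// mulrDl divfK ?gt_eqF//.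
by rewrite exprS le_eqVlt; apply/orP; left; apply/eqP; ring.
Qed.

Lemma powR_exprn (R : realType) (x y : R) (k : nat) : 0 <= x -> (x ^+ k) `^ y = (x `^ y) ^+ k.
Proof.
by move=> x0; elim: k => [|k IH]; rewrite ?expr0 ?powR1// !exprS powRM ?IH ?exprn_ge0.
Qed.

Lemma shift_continuous (R : realType) (m : nat) (c : 'rV[R]_m) :
  continuous (fun y : 'rV[R]_m => y + c).
Proof. by move=> x; apply: (continuousD (f := id)) => //; exact: cst_continuous. Qed.

(** * Gap integrals and their comparison at dyadic steps *)

Section Commutator.
Context (R : realType) (m n : nat).
Local Notation V := 'rV[R]_m.
Local Notation W := 'rV[R]_(2 * n).+1.
Implicit Types (F : V -> W) (psi : V -> R).

Definition gap F (c x : V) : R := contact_form (F x) (F (x + c) - F x).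

Definition gap_integral F psi (c : V) : R := \int[lebesgue_rV]_x (psi x * gap F c x).

Definition contact_density F (v x : V) : R := contact_form (F x) ('D_v F x).

Context (gamma C M r R0 : R) (Omega K K' : set V).
Hypotheses (g12 : 2^-1 < gamma) (g1 : gamma <= 1) (C0 : 0 <= C) (M0 : 0 <= M).
Hypotheses (r0 : 0 < r) (cK : compact K) (cK' : compact K').
Hypothesis KR : forall x, K x -> `|x| <= R0.
Hypothesis K'O : K' `<=` Omega.
Hypothesis KK' : forall x y, K x -> `|y - x| <= r -> K' y.

(** [C] and [M] are fixed independently of the map: a smooth approximation and its limit share them,
    so estimates in terms of them are uniform along the approximation. *)
Definition regular F := [/\ forall x, Omega x -> {for x, continuous F},
  holder_sup gamma C K' F & forall x, K' x -> `|F x| <= M].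

(** [L] is a Lipschitz constant along [v], the direction in which integrands are translated. *)
Definition test_fun (P L : R) (v : V) psi := [/\ continuous psi, forall x, ~ K x -> psi x = 0,
  forall x, `|psi x| <= P & forall x s, `|psi (x + s *: v) - psi x| <= L * `|s|].

Let g0 : 0 <= gamma. Proof. by rewrite (le_trans _ (ltW g12))// invr_ge0. Qed.

Lemma gap_le F c x : regular F -> K' x -> K' (x + c) ->
  `|gap F c x| <= (1 + 4 * n%:R * M) * (C * `|c| `^ gamma).
Proof.
move=> [_ FC FM] Kx Kxc; rewrite (le_trans (contact_form_le _ _))//.
apply: ler_pM => //.
  by rewrite lerD2l ler_wpM2l// FM.
by have := FC _ _ Kxc Kx; rewrite (addrC x) addrK.
Qed.

Lemma gap_add F c x : regular F -> K' x -> K' (x + c) -> K' (x + c + c) ->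
  `|gap F (c + c) x - gap F c x - gap F c (x + c)| <= 4 * n%:R * (C * `|c| `^ gamma) ^+ 2.
Proof.
move=> [_ FC _] Kx Kxc Kxcc; rewrite /gap addrA (contact_form_cocycle _ (F (x + c))).
set a := contact_form _ _; set b := contact_form _ _.
rewrite (_ : _ - _ - _ = - area_form (F x - F (x + c)) (F (x + c) - F (x + c + c))); last by ring.
rewrite normrN (le_trans (area_form_le _ _))// ler_wpM2l ?mulr_ge0// expr2.
have E y : `|y - (y + c)| = `|c| by rewrite opprD addNKr normrN.
by apply: ler_pM => //; [have := FC _ _ Kx Kxc|have := FC _ _ Kxc Kxcc]; rewrite E.
Qed.

Lemma gap_continuous F c x : regular F -> Omega x -> Omega (x + c) ->
  {for x, continuous (gap F c)}.
Proof.
move=> [FO _ _] Ox Oxc; apply: continuous_contact_form; first exact: FO.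
have cc : {for x, continuous (fun y : V => y + c)}.
  by apply: (continuousD (f := id)) => //; exact: cst_continuous.
have := continuousB (continuous_comp cc (FO _ Oxc)) (FO _ Ox).
exact.
Qed.

Let near_K x c s : K x -> `|c| <= s -> s <= r -> K' (x + c).
Proof. by move=> Kx cs sr; apply: (KK' Kx); rewrite addrC addKr (le_trans cs). Qed.

Lemma cont_supp_gap F P L v psi c : regular F -> test_fun P L v psi -> `|c| <= r ->
  cont_supp R0 (fun x => psi x * gap F c x).
Proof.
move=> rF [cpsi psi0 _ _] cr.
apply: (cont_supp_mul (compact_closed_rV cK) KR cpsi psi0) => x Kx.
apply: gap_continuous => //; apply: K'O; last exact: near_K cr _.
by apply: (KK' Kx); rewrite subrr normr0 ltW.
Qed.

(** The first summand comes from the defect in [gap_add], integrated over the support of [psi]; the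
    second from the variation of [psi] under a translation, on a support enlarged by [r]. *)
Definition step_const (P L : R) (v : V) : R :=
  P * (4 * n%:R * (C * `|v| `^ gamma) ^+ 2) * vol_cball m R0 +
  L * ((1 + 4 * n%:R * M) * (C * `|v| `^ gamma)) * vol_cball m (R0 + r).

Lemma step_const_ge0 P L v : 0 <= P -> 0 <= L -> 0 <= step_const P L v.
Proof.
move=> P0 L0; rewrite /step_const.
by rewrite addr_ge0 ?mulr_ge0 ?addr_ge0 ?mulr_ge0 ?exprn_ge0 ?mulr_ge0 ?powR_ge0 ?vol_cball_ge0.
Qed.

Lemma gap_integral_step F P L v psi (s : R) : 0 <= P -> 0 <= L ->
  regular F -> test_fun P L v psi -> 0 < s -> s <= 1 -> 2 * s * `|v| <= r ->
  `|gap_integral F psi (2 * s *: v) - 2 * gap_integral F psi (s *: v)| <=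
  step_const P L v * (s * s `^ (2 * gamma - 1)).
Proof.
move=> P0 L0 rF tpsi s0 s1 sr; have [cpsi psi0 psiP psiL] := tpsi.
set c := s *: v; have cE : `|c| = s * `|v| by rewrite normrZ gtr0_norm.
have c_ge0 : 0 <= `|c| by [].
have ccr : `|c| + `|c| <= r by rewrite cE; lra.
have cr : `|c| <= r by lra.
have Kc x : K x -> [/\ K' x, K' (x + c) & K' (x + c + c)].
  move=> Kx; split; first by apply: (KK' Kx); rewrite subrr normr0 ltW.
    exact: near_K cr _.
  rewrite -addrA; apply: (near_K Kx _ (lexx r)).
  by rewrite (le_trans (ler_normD _ _)).
have KcB x : K (x - c) -> K' x /\ K' (x + c).
  by move=> /Kc[]; rewrite subrK.
have -> : 2 * s *: v = c + c by rewrite -scalerA mulr2n scalerDl scale1r.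
(* Two sources of error: [h1] is the additivity defect of the gap, [h2] what remains once the
   translation by [c] has been moved from the gap onto [psi]. *)
pose h1 x := psi x * (gap F (c + c) x - gap F c x - gap F c (x + c)).
pose h2 x := (psi (x - c) - psi x) * gap F c x.
have cKc : closed [set x : V | K (x - c)].
  have := @closed_comp _ _ (fun x : V => x - c) K.
  by apply=> [x _|]; [exact: shift_continuous|exact: compact_closed_rV].
have KRc (x : V) : K (x - c) -> `|x| <= R0 + r.
  move=> /KR xR; rewrite -(subrK c x) (le_trans (ler_normD _ _))//; lra.
have cpsic : continuous (fun x : V => psi (x - c)).
  move=> x; apply: (@continuous_comp _ _ _ (fun y : V => y - c) psi x).
    exact: shift_continuous.
  exact: cpsi.
have s3 : cont_supp (R0 + r) (fun x => psi (x - c) * gap F c x).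
  apply: (cont_supp_mul cKc KRc cpsic) => [x|x Kx]; first exact: psi0.
  by have [? ?] := KcB x Kx; apply: gap_continuous => //; exact: K'O.
have Rr : R0 <= R0 + r by rewrite lerDl ltW.
have s1' := cont_supp_gap rF tpsi cr.
have s2' : cont_supp R0 (fun x => psi x * gap F (c + c) x).
  apply: (cont_supp_gap rF tpsi); exact: le_trans (ler_normD _ _) ccr.
have s4 : cont_supp R0 (fun x => psi x * gap F c (x + c)).
  apply: (cont_supp_mul (compact_closed_rV cK) KR cpsi psi0) => x Kx.
  have [_ k2 k3] := Kc x Kx.
  apply: (@continuous_comp _ _ _ (fun y : V => y + c) (gap F c) x).
    exact: shift_continuous.
  by apply: gap_continuous => //; exact: K'O.
have sh1 : cont_supp R0 h1.
  have := cont_suppB (cont_suppB s2' s1') s4.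
  by congr cont_supp; apply/funext => x; rewrite /h1; ring.
have sh2 : cont_supp (R0 + r) h2.
  have := cont_suppB s3 (cont_supp_le Rr s1').
  by congr cont_supp; apply/funext => x; rewrite /h2; ring.
have I1 : \int[lebesgue_rV]_x h1 x = gap_integral F psi (c + c) - gap_integral F psi c
    - \int[lebesgue_rV]_x (psi x * gap F c (x + c)).
  rewrite -(Rintegral_suppB s2' s1') -(Rintegral_suppB (cont_suppB s2' s1') s4).
  by apply: eq_Rintegral => x _; rewrite /h1; ring.
have I2 : \int[lebesgue_rV]_x h2 x =
    \int[lebesgue_rV]_x (psi x * gap F c (x + c)) - gap_integral F psi c.
  rewrite -[X in _ = X - _](_ : \int[lebesgue_rV]_x (psi (x - c) * gap F c x) = _).
    rewrite -(Rintegral_suppB s3 (cont_supp_le Rr s1')).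
    by apply: eq_Rintegral => x _; rewrite /h2; ring.
  rewrite -(Rintegral_shift c s3); apply: eq_Rintegral => x _.
  by rewrite addrK.
have -> : gap_integral F psi (c + c) - 2 * gap_integral F psi c =
    \int[lebesgue_rV]_x h1 x + \int[lebesgue_rV]_x h2 x by rewrite I1 I2; ring.
rewrite (le_trans (ler_normD _ _))//.
have B1 : `|\int[lebesgue_rV]_x h1 x| <=
    P * (4 * n%:R * (C * `|c| `^ gamma) ^+ 2) * vol_cball m R0.
  apply: le_normr_Rintegral_supp => // x; rewrite /h1 normrM.
  have [Kx|Kx] := pselect (K x); last first.
    by rewrite psi0// normr0 mul0r !mulr_ge0// sqr_ge0.
  have [k1 k2 k3] := Kc x Kx.
  by apply: ler_pM => //; exact: gap_add.
have B2 : `|\int[lebesgue_rV]_x h2 x| <=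
    L * s * ((1 + 4 * n%:R * M) * (C * `|c| `^ gamma)) * vol_cball m (R0 + r).
  apply: le_normr_Rintegral_supp => // x; rewrite /h2 normrM.
  have bnd : 0 <= L * s * ((1 + 4 * n%:R * M) * (C * `|c| `^ gamma)).
    by rewrite !mulr_ge0 ?powR_ge0 ?addr_ge0 ?mulr_ge0// ltW.
  have psiB : `|psi (x - c) - psi x| <= L * s.
    by have := psiL x (- s); rewrite scaleNr normrN (gtr0_norm s0).
  have [Kx|Kx] := pselect (K x).
    by have [k1 k2 _] := Kc x Kx; apply: ler_pM => //; exact: gap_le.
  have [Kxc|Kxc] := pselect (K (x - c)).
    by have [k1 k2] := KcB x Kxc; apply: ler_pM => //; exact: gap_le.
  by rewrite !psi0// subrr normr0 mul0r.
rewrite (le_trans (lerD B1 B2))// cE.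
have -> : (s * `|v|) `^ gamma = s `^ gamma * `|v| `^ gamma by rewrite powRM// ltW.
have ss : s `^ gamma * s `^ gamma = s * s `^ (2 * gamma - 1).
  rewrite -powRD; last by apply/implyP => _; rewrite gt_eqF.
  rewrite -[X in _ = X * _]powRr1 ?ltW// -powRD; last by apply/implyP => _; rewrite gt_eqF.
  by congr (_ `^ _); ring.
(* The translation error is of order s s^gamma; since s <= 1 and gamma <= 1 it is dominated by s
   s^(2 gamma - 1). *)
have sg : s `^ gamma <= s `^ (2 * gamma - 1).
  have q1 : 2 * gamma - 1 <= gamma by rewrite mulr_natl mulr2n -addrA gerDl subr_le0.
  by apply: ger_powR => //; rewrite s0.
rewrite /step_const [leRHS]mulrDl lerD//.
  rewrite le_eqVlt; apply/orP; left; apply/eqP; rewrite -ss; ring.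
set k := (1 + 4 * n%:R * M); set vg := `|v| `^ gamma; set vol := vol_cball m _.
have -> : L * s * (k * (C * (s `^ gamma * vg))) * vol =
  L * (k * (C * vg)) * vol * (s * s `^ gamma) by ring.
rewrite ler_wpM2l//; last by rewrite ler_wpM2l// ltW.
by rewrite !mulr_ge0 ?vol_cball_ge0 ?powR_ge0 ?addr_ge0 ?mulr_ge0.
Qed.

Let q : R := 2 * gamma - 1.
Let q0 : 0 < q.
Proof. by rewrite subr_gt0 mulrC -ltr_pdivrMr// mul1r. Qed.

(** Ratio of the geometric series produced by halving the step; it is below 1 because gamma >
    1/2. *)
Definition half_pow : R := (2^-1) `^ (2 * gamma - 1).

Lemma half_pow_ge0 : 0 <= half_pow. Proof. exact: powR_ge0. Qed.

Lemma half_pow_lt1 : half_pow < 1.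
Proof.
apply: (@lt_le_trans _ _ (1 `^ (2 * gamma - 1))); last by rewrite powR1.
by apply: gt0_ltr_powR; rewrite ?nnegrE ?invr_ge0// ?invf_lt1// ltr1n.
Qed.

(** By [gap_integral_step] the changes of the quotient at the steps s 2^-k are bounded by a
    geometric series of ratio [half_pow]. *)
Lemma gap_integral_dyadic F P L v psi (s : R) k : 0 <= P -> 0 <= L ->
  regular F -> test_fun P L v psi -> 0 < s -> s <= 1 -> s * `|v| <= r ->
  `|gap_integral F psi (s *: v) / s -
    gap_integral F psi ((s * 2^-1 ^+ k) *: v) / (s * 2^-1 ^+ k)| <=
  step_const P L v * s `^ (2 * gamma - 1) / (1 - half_pow).
Proof.
move=> P0 L0 rF tpsi s0 s1 sr.
pose sk k := s * 2^-1 ^+ k.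
pose e k := gap_integral F psi (sk k *: v) / sk k.
have D0 := step_const_ge0 v P0 L0.
have -> : gap_integral F psi (s *: v) / s = e 0%N by rewrite /e /sk expr0 mulr1.
have h0 (j : nat) : 0 < 2^-1 ^+ j :> R by rewrite exprn_gt0// invr_gt0.
have h1 (j : nat) : 2^-1 ^+ j <= 1 :> R by rewrite exprn_ile1 ?invr_ge0// invf_le1// ler1n.
apply: (@geometric_telescope _ (step_const P L v * s `^ (2 * gamma - 1)) half_pow e).
- exact: half_pow_ge0.
- exact: half_pow_lt1.
- by rewrite mulr_ge0// powR_ge0.
move=> j; pose t := sk j.+1.
have t0 : 0 < t by rewrite /t /sk mulr_gt0.
have tE : sk j = 2 * t by rewrite /t /sk exprS; field.
have ts : 2 * t <= s by rewrite -tE /sk ler_piMr// ltW.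
rewrite /e -/t tE; clearbody t.
have step := gap_integral_step P0 L0 rF tpsi t0.
move: step; set I2 := gap_integral F psi (2 * t *: v); set I1 := gap_integral F psi (t *: v).
clearbody I2 I1 => step.
have -> : I2 / (2 * t) - I1 / t = (I2 - 2 * I1) / (2 * t).
  by rewrite mulrBl -mulf_div divff ?pnatr_eq0// mul1r.
rewrite normrM normfV (gtr0_norm (_ : 0 < 2 * t)) ?mulr_gt0// ler_pdivrMr ?mulr_gt0//.
rewrite (le_trans (step _ _))//.
- by rewrite (le_trans _ s1)// (le_trans _ ts)// ler_peMl ?ltW// ltr1n.
- by rewrite (le_trans _ sr)// ler_wpM2r.
rewrite -!mulrA ler_wpM2l// mulrC.
have tq : t `^ (2 * gamma - 1) <= s `^ (2 * gamma - 1) * half_pow ^+ j.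
  have -> : s `^ (2 * gamma - 1) * half_pow ^+ j = sk j `^ (2 * gamma - 1).
    by rewrite /half_pow -powR_exprn ?invr_ge0// -powRM// ?(ltW s0)// exprn_ge0// invr_ge0.
  have tsk : t <= sk j by rewrite tE ler_peMl ?ler1n// ltW.
  have sk0 : 0 < sk j by rewrite tE mulr_gt0.
  by apply: (ge0_ler_powR (ltW q0)) => //; rewrite nnegrE ltW.
rewrite mulrA; apply: ler_pM; rewrite ?powR_ge0 ?(ltW t0)//.
by rewrite ler_peMl ?ltW// ltr1n.
Qed.

Section SmoothMap.
Context (F : V -> W) (v : V).
Hypothesis rF : regular F.
Hypothesis dF : forall x, Omega x -> derivable F x v.
Hypothesis cdF : forall x, Omega x -> {for x, continuous ('D_v F)}.

Lemma cont_supp_density P L psi : test_fun P L v psi ->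
  cont_supp R0 (fun x => psi x * contact_density F v x).
Proof.
move=> [cpsi psi0 _ _]; have [FO _ _] := rF.
apply: (cont_supp_mul (compact_closed_rV cK) KR cpsi psi0) => x Kx.
have Ox : Omega x by apply: K'O; apply: (KK' Kx); rewrite subrr normr0 ltW.
by apply: continuous_contact_form; [exact: FO|exact: cdF].
Qed.

(** Mean value theorem in each coordinate, the derivative being bounded on the compact [K']; this
    provides the majorant when the step tends to 0. *)
Lemma diff_quotient_bound : exists2 B, 0 <= B & forall x s, K x -> 0 < s -> s * `|v| <= r ->
  `|F (x + s *: v) - F x| <= s * B.
Proof.
have cD : {within K', continuous ('D_v F)}.
  by apply: continuous_in_subspaceT => x; rewrite inE => /K'O; exact: cdF.
have /compact_bounded[B [_ HB]] := continuous_compact cD cK'.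
exists (`|B| + 1) => [|x s Kx s0 sr]; first by rewrite addr_ge0.
have DB y : K' y -> `|'D_v F y| <= `|B| + 1.
  by move=> Ky; apply: HB; [rewrite (le_lt_trans (ler_norm _))// ltrDl|exists y].
apply: norm_rV_le => [|i]; first by rewrite mulr_ge0 ?addr_ge0// ltW.
have Kt t : 0 <= t <= s -> K' (x + t *: v).
  move=> /andP[t0 ts]; apply: (KK' Kx); rewrite addrC addKr normrZ ger0_norm//.
  by rewrite (le_trans _ sr)// ler_wpM2r.
have [|c cs] := @mvt_line R V (fun y => F y ord0 i) x v s (ltW s0).
  by move=> t /Kt/K'O/dF/derivable_mxP; exact.
rewrite !mxE => ->; rewrite normrM gtr0_norm// ler_wpM2l ?(ltW s0)//.
have := DB _ (Kt c cs); rewrite (derive_mx (dF (K'O (Kt c cs)))) => h.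
apply: le_trans h.
have := ler_norm_coord (\matrix_(i, j) 'D_v (fun t => F t i j) (x + c *: v)) i.
by rewrite mxE.
Qed.

(** Divided by the step, the gap is the contact form of a difference quotient, which tends to the
    derivative along [v]; dominated convergence does the rest. *)
Lemma gap_integral_limit P L psi (s : R) : 0 <= P -> test_fun P L v psi ->
  0 < s -> s * `|v| <= r ->
  gap_integral F psi ((s * 2^-1 ^+ k) *: v) / (s * 2^-1 ^+ k) @[k --> \oo] -->
  \int[lebesgue_rV]_x (psi x * contact_density F v x).
Proof.
move=> P0 tpsi s0 sr; have [cpsi psi0 psiP _] := tpsi; have [FO FC FM] := rF.
have [B B0 FB] := diff_quotient_bound.
pose sk k := s * 2^-1 ^+ k : R.
have sk0 k : 0 < sk k by rewrite mulr_gt0// exprn_gt0// invr_gt0.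
have sks k : sk k <= s.
  by rewrite ler_piMr ?(ltW s0)// exprn_ile1 ?invr_ge0// invf_le1// ler1n.
have skr k : sk k * `|v| <= r by rewrite (le_trans _ sr)// ler_wpM2r.
have skc : sk k @[k --> \oo] --> (0 : R).
  by apply: cvg_geometric; rewrite ger0_norm ?invr_ge0// invf_lt1// ltr1n.
pose g_ k x := (sk k)^-1 * (psi x * gap F (sk k *: v) x).
have sg k : cont_supp R0 (g_ k).
  apply/cont_suppZ/(cont_supp_gap rF tpsi).
  by rewrite normrZ gtr0_norm.
have -> : (fun k => gap_integral F psi (sk k *: v) / sk k) =
    (fun k => \int[lebesgue_rV]_x g_ k x).
  apply/funext => k; rewrite /gap_integral mulrC.
  rewrite (@Rintegral_suppZ _ _ R0)//; apply: (cont_supp_gap rF tpsi).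
  by rewrite normrZ gtr0_norm.
apply: (@Rintegral_cvg _ _ R0 (P * ((1 + 4 * n%:R * M) * B))) => //.
- exact: cont_supp_density tpsi.
- move=> k x; rewrite /g_ mulrCA normrM.
  have [Kx|Kx] := pselect (K x); last first.
    by rewrite psi0// normr0 mul0r !mulr_ge0// addr_ge0// !mulr_ge0.
  apply: ler_pM => //; rewrite normrM normfV (gtr0_norm (sk0 k)) ler_pdivrMl//.
  rewrite (le_trans (contact_form_le _ _))// [leRHS]mulrCA; apply: ler_pM => //.
  - rewrite lerD2l ler_wpM2l// FM//; apply: (KK' Kx); by rewrite subrr normr0 ltW.
  - exact: FB.
move=> x; have [Kx|Kx] := pselect (K x); last first.
  rewrite psi0// mul0r /g_ psi0//; under eq_fun do rewrite mul0r mulr0.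
  exact: cvg_cst.
have Ox : Omega x by apply: K'O; apply: (KK' Kx); rewrite subrr normr0 ltW.
have dq : h^-1 *: (F (h *: v + x) - F x) @[h --> (0 : R)^'] --> 'D_v F x by exact: dF.
have dq' : contact_form (F x) (h^-1 *: (F (h *: v + x) - F x)) @[h --> (0 : R)^'] -->
    contact_form (F x) ('D_v F x).
  have cc : {for 'D_v F x, continuous (contact_form (F x))}.
    by apply: (continuous_contact_form (F := fun=> F x) (G := id)); [exact: cst_continuous|].
  exact: (cvg_comp _ _ dq cc).
have /cvg_at_rightP/(_ sk) dqs := cvg_dnbhs_at_right dq'.
have -> : (fun k => g_ k x) =
    (fun k => psi x * contact_form (F x) ((sk k)^-1 *: (F (sk k *: v + x) - F x))).
  by apply/funext => k; rewrite /g_ /gap contact_formZ mulrCA (addrC x).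
exact: (cvgM (cvg_cst (psi x)) (dqs (conj sk0 skc))).
Qed.

(* Letting the dyadic step tend to 0 turns the telescoped estimate into a bound
   that only involves the Hoelder data of [F], not its derivatives. *)
Lemma gap_integral_density P L psi (s : R) : 0 <= P -> 0 <= L -> test_fun P L v psi ->
  0 < s -> s <= 1 -> s * `|v| <= r ->
  `|gap_integral F psi (s *: v) / s - \int[lebesgue_rV]_x (psi x * contact_density F v x)| <=
  step_const P L v * s `^ (2 * gamma - 1) / (1 - half_pow).
Proof.
move=> P0 L0 tpsi s0 s1 sr.
have lim := gap_integral_limit P0 tpsi s0 sr.
have limn := cvg_norm (cvgB (cvg_cst (gap_integral F psi (s *: v) / s)) lim).
apply: (cvgr_to_le (limn _ _ _)); apply: nearW => k.
exact: gap_integral_dyadic.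
Qed.

End SmoothMap.

End Commutator.

Lemma cvg_contact_form (R : realType) (n : nat) (T : Type) (F : set_system T)
    (FF : Filter F) (f g : T -> 'rV[R]_(2 * n).+1) (a b : 'rV[R]_(2 * n).+1) :
  f @ F --> a -> g @ F --> b ->
  contact_form (f x) (g x) @[x --> F] --> contact_form a b.
Proof.
move=> fa gb.
have cc : {for (a, b), continuous (fun p : 'rV[R]_(2 * n).+1 * 'rV[R]_(2 * n).+1 =>
    contact_form p.1 p.2)}.
  by apply: continuous_contact_form; [exact: cvg_fst|exact: cvg_snd].
exact: (cvg_comp (fun x => (f x, g x)) _ (cvg_pair fa gb) cc).
Qed.

Lemma holder_loc_continuous (R : realType) (m N : nat) (gamma : R)
    (Omega : set 'rV[R]_m) (f : 'rV[R]_m -> 'rV[R]_N) (x : 'rV[R]_m) :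
  0 < gamma -> open Omega -> holder_loc (@eucl_dist R N) gamma Omega f -> Omega x ->
  {for x, continuous f}.
Proof.
move=> g0 oO fH Ox.
have [r [K [r0 cK KO xK]]] := compact_nbhs oO (@compact_set1 _ x)
  (fun y => (fun E => eq_ind_r Omega Ox E)).
have [C0 fC0] := fH K cK KO.
have := holder_eucl_sup (ltW g0) fC0; set C := _ * _ => fC.
have C_ge0 : 0 <= C by rewrite mulr_ge0// powR_ge0.
suff near_le (e : R) : 0 < e -> \forall y \near x, `|f x - f y| <= e.
  by apply/(@cvgrPdist_le _ _ _ (nbhs x) _) => e; exact: near_le.
(* Chosen so that C d^gamma = e C / (C + 1) <= e. *)
move=> e0; pose d := (e / (C + 1)) `^ gamma^-1.
have eC : 0 < e / (C + 1) by rewrite divr_gt0// ltr_wpDl.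
have d0 : 0 < d by exact: powR_gt0.
near=> y.
have yr : `|y - x| <= r.
  by rewrite distrC ltW//; near: y; apply/nbhs_ballP; exists r => //= z; rewrite -ball_normE.
have yd : `|x - y| <= d.
  by rewrite ltW//; near: y; apply/nbhs_ballP; exists d => //= z; rewrite -ball_normE.
have Kx : K x by apply: (xK x) => //; rewrite subrr normr0 ltW.
have Ky : K y by exact: (xK x).
rewrite (le_trans (fC x y Kx Ky))//.
apply: (@le_trans _ _ (C * d `^ gamma)).
  by rewrite ler_wpM2l//; apply: (ge0_ler_powR (ltW g0)); rewrite ?nnegrE ?(ltW d0).
rewrite /d -powRrM mulVf ?gt_eqF// powRr1 ?(ltW eC)// mulrCA ler_piMr ?(ltW e0)//.
by rewrite ler_pdivrMr ?ltr_wpDl// mul1r lerDl.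
Unshelve. all: by end_near. Qed.

(** * Passage to the limit along a smooth approximation *)

Section PassageToTheLimit.
Context (R : realType) (m n : nat).
Local Notation V := 'rV[R]_m.
Local Notation W := 'rV[R]_(2 * n).+1.
Context (gamma : R) (Omega : set V) (f : V -> W) (F : R -> V -> W).
Hypotheses (g12 : 2^-1 < gamma) (g1 : gamma <= 1) (oO : open Omega).
Hypothesis fH : holder_loc (@eucl_dist R (2 * n).+1) gamma Omega f.
Hypothesis FH : smooth_approximation gamma Omega f F.

Let g0 : 0 < gamma. Proof. by apply: lt_trans g12; rewrite invr_gt0. Qed.

(** The Hoelder and sup bounds of the approximations pass to the pointwise limit, so [f] gets the
    very constants of [F eps]. *)
Lemma approximation_regular K : compact K -> K `<=` Omega ->
  exists C M, [/\ 0 <= C, 0 <= M, regular gamma C M Omega K f &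
    forall eps, 0 < eps -> regular gamma C M Omega K (F eps)].
Proof.
move=> cK KO; have [Fsm Fcvg /(_ K cK KO)[C0 HC0]] := FH.
pose C := `|C0| * m.+1%:R `^ gamma.
have FC eps : 0 < eps -> holder_sup gamma C K (F eps).
  move=> e0; apply: holder_eucl_sup; first exact: ltW.
  by move=> x y Kx Ky; have [] := HC0 eps e0 x y Kx Ky.
have FM eps x : 0 < eps -> K x -> `|F eps x| <= `|C0|.
  move=> e0 Kx; have [h _] := HC0 eps e0 x x Kx Kx.
  by rewrite (le_trans (ler_norm_eucl _))// (le_trans h)// ler_norm.
have pos : \forall eps \near (0 : R)^'+, 0 < eps by exact: nbhs_right_gt.
exists C, `|C0|; split => //.
- by rewrite mulr_ge0// powR_ge0.
- split.
  + by move=> x Ox; exact: holder_loc_continuous fH Ox.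
  + move=> x y Kx Ky.
    have c : `|F eps x - F eps y| @[eps --> 0^'+] --> `|f x - f y|.
      by apply: cvg_norm; apply: cvgB; apply: Fcvg; exact: KO.
    apply: (cvgr_to_le c); apply: filterS pos => eps e0.
    exact: FC.
  + move=> x Kx; have c : `|F eps x| @[eps --> 0^'+] --> `|f x|.
      by apply: cvg_norm; apply: Fcvg; exact: KO.
    by apply: (cvgr_to_le c); apply: filterS pos => eps e0; exact: FM.
- move=> eps e0; split; [|exact: FC|by move=> x; exact: FM].
  by move=> x Ox; exact: (smooth_continuous (Fsm eps e0) Ox).
Qed.

Context (C M r R0 : R) (K K' : set V).
Hypotheses (C0 : 0 <= C) (M0 : 0 <= M).
Hypotheses (r0 : 0 < r) (cK : compact K) (cK' : compact K').
Hypothesis KR : forall x, K x -> `|x| <= R0.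
Hypothesis K'O : K' `<=` Omega.
Hypothesis KK' : forall x y, K x -> `|y - x| <= r -> K' y.
Hypothesis rf : regular gamma C M Omega K' f.
Hypothesis rF : forall eps, 0 < eps -> regular gamma C M Omega K' (F eps).

Context (P L : R) (v : V) (psi : V -> R).
Hypotheses (P0 : 0 <= P) (L0 : 0 <= L).
Hypothesis tpsi : test_fun K P L v psi.

Let Kc x c : K x -> `|c| <= r -> K' x /\ K' (x + c).
Proof.
move=> Kx cr; split; first by apply: (KK' Kx); rewrite subrr normr0 ltW.
by apply: (KK' Kx); rewrite addrC addKr.
Qed.

(** Dominated convergence along sequences of [eps]; the majorant from [gap_le] involves the common
    Hoelder data only. *)
Lemma gap_integral_cvg c : `|c| <= r ->
  gap_integral (F eps) psi c @[eps --> 0^'+] --> gap_integral f psi c.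
Proof.
move=> cr; apply/cvg_at_rightP => u [u0 uc].
have [cpsi psi0 psiP _] := tpsi; have [Fsm Fcvg _] := FH.
apply: (@Rintegral_cvg _ _ R0 (P * ((1 + 4 * n%:R * M) * (C * `|c| `^ gamma)))).
- by move=> k; exact: (cont_supp_gap r0 cK KR K'O KK' (rF (u0 k)) tpsi cr).
- exact: (cont_supp_gap r0 cK KR K'O KK' rf tpsi cr).
- move=> k x; rewrite normrM; have [Kx|Kx] := pselect (K x); last first.
    by rewrite psi0// normr0 mul0r !mulr_ge0 ?addr_ge0 ?mulr_ge0 ?powR_ge0.
  have [k1 k2] := Kc Kx cr.
  by apply: ler_pM => //; exact: (gap_le (rF (u0 k)) k1 k2).
move=> x; have [Kx|Kx] := pselect (K x); last first.
  by rewrite psi0// mul0r; under eq_fun do rewrite mul0r; exact: cvg_cst.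
have [k1 k2] := Kc Kx cr.
have Fu y : K' y -> F (u k) y @[k --> \oo] --> f y.
  move=> Ky; apply: (@cvg_comp _ _ _ u (fun e => F e y) \oo (0 : R)^'+ (nbhs (f y))); last first.
    exact: Fcvg (K'O Ky).
  move=> A [d /= d0 dA]; have /cvgrPdist_lt/(_ d d0) := uc.
  by apply: filterS => k ukd; apply: dA => //; exact: u0.
apply: cvgM; first exact: cvg_cst.
apply: cvg_contact_form; first exact: Fu.
by apply: cvgB; exact: Fu.
Qed.

Let D := step_const n gamma C M r R0 P L v / (1 - half_pow gamma).
Let D0 : 0 <= D.
Proof.
rewrite mulr_ge0 ?step_const_ge0// invr_ge0 subr_ge0 ltW//.
exact: half_pow_lt1.
Qed.

Lemma gap_integral_density_eps (s : R) eps : 0 < eps -> 0 < s -> s <= 1 -> s * `|v| <= r ->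
  `|gap_integral (F eps) psi (s *: v) / s -
    \int[lebesgue_rV]_x (psi x * contact_density (F eps) v x)| <= D * s `^ (2 * gamma - 1).
Proof.
move=> e0 s0 s1 sr; have [Fsm _ _] := FH.
have := gap_integral_density g12 g1 C0 M0 r0 cK cK' KR K'O KK' (rF e0)
  (fun x Ox => smooth_derivable (v := v) (Fsm eps e0) Ox)
  (fun x Ox => smooth_derive_continuous (v := v) (Fsm eps e0) Ox) P0 L0 tpsi s0 s1 sr.
by rewrite mulrAC.
Qed.

(** The estimate [gap_integral_density_eps] is uniform in [eps]. In the limit the gap integral
    becomes that of [f], and the density integral vanishes by assumption. *)
Lemma gap_integral_small (s : R) :
  \int[lebesgue_rV]_x (psi x * contact_density (F eps) v x) @[eps --> 0^'+] --> 0 ->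
  0 < s -> s <= 1 -> s * `|v| <= r ->
  `|gap_integral f psi (s *: v)| <= D * s `^ (2 * gamma - 1) * s.
Proof.
move=> F0 s0 s1 sr.
have cr : `|s *: v| <= r by rewrite normrZ gtr0_norm.
suff : `|gap_integral f psi (s *: v) / s - 0| <= D * s `^ (2 * gamma - 1).
  by rewrite subr0 normrM normfV (gtr0_norm s0) ler_pdivrMr.
have c : `|gap_integral (F eps) psi (s *: v) / s -
    \int[lebesgue_rV]_x (psi x * contact_density (F eps) v x)| @[eps --> 0^'+] -->
    `|gap_integral f psi (s *: v) / s - 0|.
  apply: cvg_norm; apply: cvgB; last exact: F0.
  by apply: cvgM; [exact: gap_integral_cvg|exact: cvg_cst].
apply: (cvgr_to_le c).
have pos : \forall eps \near (0 : R)^'+, 0 < eps by exact: nbhs_right_gt.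
apply: filterS pos => eps e0; exact: gap_integral_density_eps.
Qed.

(** The step [s] is fixed first, so small that the density error and the gap integral of [f] divided
    by [s] add up to at most e / 2. Then [eps] is taken so small, depending on [s], that the gap
    integrals of [F eps] and [f] differ by at most (e / 2) s. *)
Lemma density_cvg0 (H : R) : 0 <= H ->
  (forall x c, K x -> `|c| <= r -> `|gap f c x| <= H * (`|c| `^ gamma) ^+ 2) ->
  \int[lebesgue_rV]_x (psi x * contact_density (F eps) v x) @[eps --> 0^'+] --> 0.
Proof.
move=> H0 fgap; have [cpsi psi0 psiP _] := tpsi.
pose E := D + P * (H * (`|v| `^ gamma) ^+ 2) * vol_cball m R0.
have E0 : 0 <= E.
  by rewrite addr_ge0// !mulr_ge0 ?vol_cball_ge0// exprn_ge0// powR_ge0.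
have q0 : 0 < 2 * gamma - 1 by rewrite subr_gt0 mulrC -ltr_pdivrMr// mul1r.
apply/cvgr0Pnorm_le => e e0.
have [s [s0 s1 sr se]] : exists s, [/\ 0 < s, s <= 1, s * `|v| <= r &
    E * s `^ (2 * gamma - 1) <= e / 2].
  have eE : 0 < e / 2 / (E + 1) by rewrite !divr_gt0// ltr_wpDl.
  have := powR_cvg0 q0 => /cvgr0Pnorm_le/(_ _ eE) near1.
  near (0 : R)^'+ => s.
  have s0 : 0 < s by near: s; exact: nbhs_right_gt.
  exists s; split=> //.
  - by near: s; exact: nbhs_right_le.
  - have : s <= r / (`|v| + 1) by near: s; apply: nbhs_right_le; rewrite divr_gt0// ltr_wpDl.
    rewrite ler_pdivlMr ?ltr_wpDl// mulrDr mulr1; lra.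
  - have : `|s `^ (2 * gamma - 1)| <= e / 2 / (E + 1) by near: s.
    rewrite ger0_norm ?powR_ge0// ler_pdivlMr ?ltr_wpDl// mulrC => /(le_trans _); apply.
    by rewrite ler_wpM2r ?powR_ge0// lerDl.
have cr : `|s *: v| <= r by rewrite normrZ gtr0_norm.
have e2s : 0 < e / 2 * s by rewrite !mulr_gt0.
have gf : `|gap_integral f psi (s *: v)| <=
    P * (H * (`|v| `^ gamma) ^+ 2) * vol_cball m R0 * s `^ (2 * gamma - 1) * s.
  have -> : P * (H * (`|v| `^ gamma) ^+ 2) * vol_cball m R0 * s `^ (2 * gamma - 1) * s =
      P * (H * (`|s *: v| `^ gamma) ^+ 2) * vol_cball m R0.
    rewrite normrZ (gtr0_norm s0) powRM ?(ltW s0)//.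
    have ss : s `^ gamma * s `^ gamma = s * s `^ (2 * gamma - 1).
      rewrite -powRD; last by apply/implyP => _; rewrite gt_eqF.
      rewrite -[X in _ = X * _]powRr1 ?(ltW s0)// -powRD; last by apply/implyP => _; rewrite gt_eqF.
      by congr (_ `^ _); ring.
    transitivity (P * (H * (`|v| `^ gamma) ^+ 2) * vol_cball m R0 * (s `^ gamma * s `^ gamma)).
      by rewrite ss; ring.
    by ring.
  apply: le_normr_Rintegral_supp; first exact: (cont_supp_gap r0 cK KR K'O KK' rf tpsi cr).
  move=> x; rewrite normrM; have [Kx|Kx] := pselect (K x); last first.
    by rewrite psi0// normr0 mul0r !mulr_ge0// exprn_ge0// powR_ge0.
  by apply: ler_pM => //; exact: fgap.
have /cvgrPdist_le/(_ _ e2s) near2 := gap_integral_cvg cr.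
have pos : \forall eps \near (0 : R)^'+, 0 < eps by exact: nbhs_right_gt.
near=> eps.
have e1 : 0 < eps by near: eps.
have B1 := gap_integral_density_eps e1 s0 s1 sr.
have B2 : `|gap_integral f psi (s *: v) - gap_integral (F eps) psi (s *: v)| <= e / 2 * s.
  by near: eps.
set I := \int[lebesgue_rV]_x _ in B1 *.
set a := gap_integral (F eps) psi _ in B1 B2; set b := gap_integral f psi _ in B2 gf.
have -> : I = (b / s - (b - a) / s) - (a / s - I) by field; rewrite gt_eqF.
have sI : 0 < s^-1 by rewrite invr_gt0.
have B3 : `|b / s| <= P * (H * (`|v| `^ gamma) ^+ 2) * vol_cball m R0 * s `^ (2 * gamma - 1).
  by rewrite normrM normfV (gtr0_norm s0) ler_pdivrMr.
have B4 : `|(b - a) / s| <= e / 2 by rewrite normrM normfV (gtr0_norm s0) ler_pdivrMr.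
rewrite (le_trans (ler_normB _ _))// (le_trans (lerD (ler_normB _ _) (lexx _)))//.
rewrite (le_trans (lerD (lerD B3 B4) B1))// addrAC -mulrDl [X in X * _]addrC.
by rewrite (le_trans (lerD se (lexx _)))// -splitr.
Unshelve. all: by end_near. Qed.

End PassageToTheLimit.

(** * Forms of degree m - 1 *)

Lemma smooth_test_fun (R : realType) (m : nat) (Omega K : set 'rV[R]_m)
    (g : 'rV[R]_m -> R) (v : 'rV[R]_m) :
  open Omega -> compact K -> K `<=` Omega -> smooth_on Omega (g : 'rV[R]_m -> R^o) ->
  (forall x, Omega x -> ~ K x -> g x = 0) ->
  exists P L, [/\ 0 <= P, 0 <= L & test_fun K P L v (g \_ Omega)].
Proof.
move=> oO cK KO sg g0; have [r Kr] := compact_norm_le cK.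
have dg x : Omega x -> derivable g x v by move=> Ox; exact: (smooth_derivable sg Ox).
have cg x : Omega x -> {for x, continuous g} by move=> Ox; exact: (smooth_continuous sg Ox).
have cDg x : Omega x -> {for x, continuous ('D_v g)}.
  by move=> Ox; exact: (smooth_derive_continuous sg Ox).
have cgO := ext0_continuous oO cK KO g0 cg.
have [P gP] := cont_supp_bounded (conj cgO (ext0_supp cK g0 Kr)).
have Dg0 x : Omega x -> ~ K x -> 'D_v g x = 0.
  by move=> Ox Kx; exact: (derive_ext0 oO cK KO g0).
have cD : cont_supp r ('D_v (g \_ Omega)).
  rewrite (ext0_derive oO cK KO g0).
  by split; [exact: (ext0_continuous oO cK KO Dg0)|exact: (ext0_supp cK Dg0)].
have [L DL] := cont_supp_bounded cD.
exists P, L; split.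
- exact: le_trans (gP 0).
- exact: le_trans (DL 0).
split=> // [x Kx|x s].
  by apply/esym; exact: (nbhs_singleton (near_ext0_out cK g0 Kx)).
by apply: (dir_lipschitz _ DL); exact: (ext0_derivable oO cK KO g0).
Qed.

Section TopDegree.
Context (R : realType) (n m : nat).
Local Notation V := 'rV[R]_m.+1.
Local Notation W := 'rV[R]_(2 * n).+1.

Definition basis_row (i : 'I_m.+1) : V := row i 1%:M.

Definition basis_minor (i : 'I_m.+1) : 'M[R]_(m, m.+1) := row' i (1%:M : 'M[R]_m.+1).

(** Evaluation on the standard frame reduces a statement on forms to scalar test functions: each
    coefficient of [phi] is paired with the contact density in one coordinate direction. *)
Lemma integral_wedge_pullback (Omega : set V) (F : V -> W) (r : R)
    (phi : V -> 'M[R]_(m, m.+1) -> R) :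
  smooth_on Omega F ->
  (forall i, cont_supp r (fun x => ((phi ^~ (basis_minor i)) \_ Omega) x *
     contact_density F (basis_row i) x)) ->
  integral_form Omega (fun x => wedge1 (pullback1 F (@contact_form R n) x) (phi x)) =
  \sum_(i < m.+1) (-1) ^+ i * \int[lebesgue_rV]_x
    (((phi ^~ (basis_minor i)) \_ Omega) x * contact_density F (basis_row i) x).
Proof.
move=> sF sphi; rewrite /integral_form Rintegral_mkcond.
under [RHS]eq_bigr do rewrite -(Rintegral_suppZ _ (sphi _)).
rewrite -(Rintegral_supp_sum (r := r)); last by move=> i; exact: cont_suppZ.
apply: eq_Rintegral => x _; rewrite patchE; case: ifPn => Ox; last first.
  by rewrite big1// => i _; rewrite patchE (negbTE Ox) mul0r mulr0.
apply: eq_bigr => i _; rewrite patchE Ox.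
have -> : pullback1 F (@contact_form R n) x (row i 1%:M) = contact_density F (basis_row i) x.
  rewrite /pullback1 /contact_density deriveE//.
  by apply: (sF [::]); move: Ox; rewrite inE.
by rewrite -mulrA; congr (_ * _); exact: mulrC.
Qed.

(** The identity is its own adjugate, whose entries are signed minors. *)
Lemma det_minor_id (i j : 'I_m.+1) :
  \det (row' i (col' j (1%:M : 'M[R]_m.+1)) : 'M[R]_m) = (i == j)%:R * (-1) ^+ (i + j).
Proof.
have A1 : \adj (1%:M : 'M[R]_m.+1) = 1%:M.
  by rewrite -[LHS]mul1mx mul_mx_adj det1.
have : (\adj (1%:M : 'M[R]_m.+1)) j i = (1%:M : 'M[R]_m.+1) j i by rewrite A1.
rewrite !mxE /cofactor eq_sym => <-.
by rewrite mulrAC -expr2 sqrr_sign mul1r.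
Qed.

(* [det_form v] is the interior product of [v] with the volume form, so that
   the wedge product of a 1-form [a] with it has density [a v]. *)
Definition det_form (v : V) (A : 'M[R]_(m, m.+1)) : R :=
  \det (col_mx v A : 'M[R]_(1 + m)).

Lemma det_form_row' (v : V) (i : 'I_m.+1) :
  det_form v (basis_minor i) = v ord0 i * (-1) ^+ i.
Proof.
have minor j : row' ord0 (col' j (col_mx v (basis_minor i) : 'M[R]_(1 + m))) =
    row' i (col' j (1%:M : 'M[R]_m.+1)) :> 'M[R]_m.
  apply/matrixP => k l; rewrite !mxE.
  have -> : lift ord0 k = rshift 1 k :> 'I_(1 + m) by exact/val_inj.
  by case: splitP => [k' /= kk'|k' /= /(can_inj (addKn 1))/val_inj <-];
    [move: (ltn_ord k'); rewrite -kk'|rewrite !mxE].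
have top j : (col_mx v (basis_minor i) : 'M[R]_(1 + m)) ord0 j = v ord0 j.
  have -> : ord0 = lshift m (ord0 : 'I_1) :> 'I_(1 + m) by exact/val_inj.
  by rewrite col_mxEu.
rewrite /det_form (expand_det_row _ ord0) (bigD1 i)//= big1 ?addr0 => [|j ji].
  rewrite top /cofactor minor det_minor_id eqxx mul1r; congr (_ * _).
  by rewrite addnn -mul2n (exprM (-1) 2) sqrrN !expr1n mulr1.
by rewrite /cofactor minor det_minor_id eq_sym (negbTE ji) mul0r !mulr0.
Qed.

(** On the frame [det_form v] contributes the [i]-th coordinate of [v] with sign (-1)^i, which
    cancels the sign in [wedge1]; what remains is [a v] expanded in the basis. *)
Lemma wedge1_det_form (a : V -> R) (b : R) (v : V) :
  (forall u w, a (u + w) = a u + a w) -> (forall c u, a (c *: u) = c * a u) ->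
  wedge1 a (fun A => b * det_form v A) 1%:M = b * a v.
Proof.
move=> aD aZ.
have a_sum (s : seq 'I_m.+1) (G : 'I_m.+1 -> V) :
    a (\sum_(i <- s) G i) = \sum_(i <- s) a (G i).
  elim: s => [|i s IH]; last by rewrite !big_cons aD IH.
  by rewrite !big_nil -(scale0r (0 : V)) aZ mul0r.
rewrite [in RHS](row_sum_delta v) a_sum mulr_sumr; apply: eq_bigr => i _.
rewrite det_form_row' aZ row1.
set w := delta_mx _ _; set u := (-1) ^+ i.
have uu : u * u = 1 by rewrite -expr2 sqrr_sign.
transitivity ((u * u) * (b * (v ord0 i * a w))); first by ring.
by rewrite uu mul1r.
Qed.

Lemma det_form_alternating (c : R) (v : V) :
  alternating_multilinear (fun A => c * det_form v A).
Proof.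
split=> [i a b A B C rA rB rC|A i j ij rij].
- rewrite /det_form (@determinant_multilinear _ _ _ (col_mx v B) (col_mx v C) (rshift 1 i) a b).
  + by ring.
  + by rewrite !rowKd.
  + by rewrite !row'Kd rB.
  + by rewrite !row'Kd rC.
- have ij' : rshift 1 i != rshift 1 j :> 'I_(1 + m) by rewrite -val_eqE /= eqSS.
  rewrite /det_form (determinant_alternate ij') ?mulr0// => k.
  by rewrite !col_mxEd; move/rowP: rij => /(_ k); rewrite !mxE.
Qed.

End TopDegree.

(** * Koranyi distance and distributional pullback *)

Section KoranyiContact.
Context (R : realType) (m n : nat).
Local Notation V := 'rV[R]_m.
Local Notation W := 'rV[R]_(2 * n).+1.

Lemma koranyi_dist_expr4 (p q : W) :
  koranyi_dist p q ^+ 4 = heis_zdist p q ^+ 4 + `|contact_form q (p - q)| ^+ 2.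
Proof.
rewrite koranyi_distE -powR_mulrn ?powR_ge0// -powRrM mulVf ?pnatr_eq0// powRr1//.
by rewrite addr_ge0 ?exprn_ge0// sqrtr_ge0.
Qed.

(** The square of the contact term is a summand of the fourth power of the distance, hence at most
    T^4. *)
Lemma holder_koranyi_contact (gamma : R) (K : set V) (f : V -> W) : 0 <= gamma ->
  holder_on (@koranyi_dist R n) gamma K f ->
  exists2 H, 0 <= H & forall x y, K x -> K y ->
    `|contact_form (f x) (f y - f x)| <= H * (`|y - x| `^ gamma) ^+ 2.
Proof.
move=> g0 [C fC]; exists ((`|C| * m.+1%:R `^ gamma) ^+ 2) => [|x y Kx Ky]; first exact: sqr_ge0.
rewrite -exprMn; set T := _ * _ * _.
have T0 : 0 <= T by rewrite !mulr_ge0 ?powR_ge0.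
have kT : koranyi_dist (f y) (f x) <= T.
  rewrite (le_trans (fC y x Ky Kx))// (@le_trans _ _ (`|C| * eucl_dist y x `^ gamma))//.
    by rewrite ler_wpM2r ?powR_ge0// ler_norm.
  rewrite /T -mulrA ler_wpM2l// -powRM//.
  by apply: ge0_ler_powR; rewrite ?nnegrE ?mulr_ge0 ?sqrtr_ge0//; exact: eucl_le_norm.
rewrite -(@ler_pXn2r _ 2)// ?nnegrE ?sqr_ge0// -exprM.
have := @lerXn2r _ 4 (koranyi_dist (f y) (f x)) T.
rewrite !nnegrE powR_ge0 => /(_ isT T0 kT); apply: le_trans.
by rewrite koranyi_dist_expr4 lerDr exprn_ge0// sqrtr_ge0.
Qed.

(** Both summands of the fourth power of the distance are at most a constant times [u ^+ 4]: the
    horizontal one by the Euclidean condition, the contact one by hypothesis. *)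
Lemma contact_holder_koranyi (gamma C H : R) (K : set V) (f : V -> W) :
  0 <= gamma -> 0 <= C -> 0 <= H -> holder_sup gamma C K f ->
  (forall x y, K x -> K y ->
    `|contact_form (f x) (f y - f x)| <= H * (`|y - x| `^ gamma) ^+ 2) ->
  holder_on (@koranyi_dist R n) gamma K f.
Proof.
move=> g0 C0 H0 fC fH; pose Q := ((2 * n)%:R * C) ^+ 4 + H ^+ 2.
have Q0 : 0 <= Q by rewrite addr_ge0// exprn_ge0// mulr_ge0.
exists (Q `^ 4^-1) => x y Kx Ky.
set u := `|x - y| `^ gamma; have u0 : 0 <= u by exact: powR_ge0.
apply: (@le_trans _ _ (Q `^ 4^-1 * u)); last first.
  rewrite ler_wpM2l ?powR_ge0//; apply: ge0_ler_powR; rewrite ?nnegrE ?sqrtr_ge0//.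
  exact: ler_norm_eucl.
have -> : u = (u ^+ 4) `^ 4^-1 by rewrite -powR_mulrn// -powRrM divff ?pnatr_eq0// powRr1.
rewrite -powRM ?exprn_ge0// koranyi_distE.
have z0 : 0 <= heis_zdist (f x) (f y) by exact: sqrtr_ge0.
apply: ge0_ler_powR; rewrite ?nnegrE ?invr_ge0 ?addr_ge0 ?mulr_ge0 ?exprn_ge0//.
rewrite /Q mulrDl -exprMn (_ : u ^+ 4 = (u ^+ 2) ^+ 2); last by rewrite -exprM.
rewrite -exprMn lerD//.
  rewrite lerXn2r ?nnegrE ?mulr_ge0// (le_trans (heis_zdist_le _ _))// -mulrA ler_wpM2l//.
  exact: fC.
rewrite lerXn2r ?nnegrE ?mulr_ge0 ?exprn_ge0//; exact: fH.
Qed.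

End KoranyiContact.

Lemma cvg_sum0 (R : realType) (T I : Type) (F : set_system T) (FF : Filter F)
    (s : seq I) (a : I -> R) (G : I -> T -> R) :
  (forall i, G i x @[x --> F] --> 0) ->
  (\sum_(i <- s) a i * G i x) @[x --> F] --> 0.
Proof.
move=> G0; elim: s => [|i s IH].
  by under eq_fun do rewrite big_nil; exact: cvg_cst.
under eq_fun do rewrite big_cons.
have c : (a i * G i x + \sum_(j <- s) a j * G j x) @[x --> F] --> a i * 0 + 0.
  by apply: cvgD; [apply: cvgM; [exact: cvg_cst|exact: G0]|exact: IH].
by rewrite mulr0 addr0 in c.
Qed.

(** The pullback integral is a signed sum of density integrals, one per coordinate direction, and
    [density_cvg0] applies to each. *)
Lemma koranyi_pullback_eq0 (R : realType) (n m : nat) (gamma : R)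
    (Omega : set 'rV[R]_m.+1) (f : 'rV[R]_m.+1 -> 'rV[R]_(2 * n).+1)
    (phi : 'rV[R]_m.+1 -> 'M[R]_(m, m.+1) -> R) :
  2^-1 < gamma -> gamma <= 1 -> open Omega ->
  holder_loc (@eucl_dist R (2 * n).+1) gamma Omega f ->
  holder_loc (@koranyi_dist R n) gamma Omega f ->
  compactly_supported_form Omega phi ->
  distributional_pullback gamma Omega (@contact_form R n) f phi 0.
Proof.
move=> g12 g1 oO fH fK [_ sphi [K [cK KO phi0]]].
have g0 : 0 < gamma by apply: lt_trans g12; rewrite invr_gt0.
split; first exact: exists_smooth_approximation fH.
move=> F FH; have [r [K' [r0 cK' K'O KK']]] := compact_nbhs oO cK KO.
have [R0 KR] := compact_norm_le cK.
have [C [M [C0 M0 rf rF]]] := approximation_regular g12 oO fH FH cK' K'O.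
have [H H0 fHK] := holder_koranyi_contact (ltW g0) (fK K' cK' K'O).
have [Fsm _ _] := FH.
have test i := smooth_test_fun (basis_row R i) oO cK KO (sphi (basis_minor R i))
  (fun x Ox Kx => phi0 x Ox Kx (basis_minor R i)).
pose I i eps := \int[lebesgue_rV]_x
    (((phi ^~ (basis_minor R i)) \_ Omega) x * contact_density (F eps) (basis_row R i) x).
have I0 i : I i eps @[eps --> (0 : R)^'+] --> 0.
  have [P [L [P0 L0 tpsi]]] := test i.
  apply: (density_cvg0 g12 g1 FH C0 M0 r0 cK cK' KR K'O KK' rf rF P0 L0 tpsi H0).
  move=> x c Kx cr; have xcE : x + c - x = c by rewrite addrC addKr.
  have := fHK x (x + c); rewrite xcE; apply.
    by apply: (KK' x) => //; rewrite subrr normr0 ltW.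
  by apply: (KK' x) => //; rewrite xcE.
pose S (eps : R) := \sum_(i < m.+1) (-1) ^+ i * I i eps.
have S0 : S eps @[eps --> (0 : R)^'+] --> 0.
  exact: cvg_sum0.
have E : {near (0 : R)^'+, S =1 (fun eps => integral_form Omega
    (fun x => wedge1 (pullback1 (F eps) (@contact_form R n) x) (phi x)))}.
  have pos : \forall eps \near (0 : R)^'+, 0 < eps by exact: nbhs_right_gt.
  apply: filterS pos => eps e0.
  rewrite /S (integral_wedge_pullback (r := R0) (Fsm eps e0))// => i.
  have [P [L [P0 L0 tpsi]]] := test i.
  apply: (cont_supp_density r0 cK KR K'O KK' (rF eps e0) _ tpsi) => x Ox.
  exact: (smooth_derive_continuous (Fsm eps e0) Ox).
exact: cvg_trans (near_eq_cvg E) S0.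
Qed.

(** The right side minus the left is (1 - x)(2 - x) / 2. This closes the induction of
    [refine_close], with [half_pow] for [x]. *)
Lemma half_gap_le1 (R : realFieldType) (x : R) : 0 <= x -> x < 1 -> x * (1 - x) / 2 + x <= 1.
Proof. by move=> x0 x1; nra. Qed.

(** * Sums of gaps over dyadic subdivisions of a segment *)

Section Refinement.
Context (R : realType) (m n : nat).
Local Notation V := 'rV[R]_m.
Local Notation W := 'rV[R]_(2 * n).+1.

(** Recursive halving, rather than a sum over 2^k pieces, makes each level one application of
    [gap_add]. *)
Fixpoint refine (F : V -> W) (k : nat) (c z : V) : R :=
  if k is k'.+1 then refine F k' (2^-1 *: c) z + refine F k' (2^-1 *: c) (z + 2^-1 *: c)
  else gap F c z.

Let halfD (c : V) : 2^-1 *: c + 2^-1 *: c = c.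
Proof. by rewrite -scalerDl -[in RHS](scale1r c); congr (_ *: _); field. Qed.

Definition on_segment (A : set V) (z c : V) := forall t : R, 0 <= t <= 1 -> A (z + t *: c).

Let segment_halves (A : set V) z c : on_segment A z c ->
  on_segment A z (2^-1 *: c) /\ on_segment A (z + 2^-1 *: c) (2^-1 *: c).
Proof.
move=> Azc; split=> t /andP[t0 t1].
  by rewrite scalerA; apply: Azc; apply/andP; split; lra.
rewrite -addrA scalerA -scalerDl; apply: Azc; apply/andP; split; lra.
Qed.

Let segment0 (A : set V) z c : on_segment A z c -> A z.
Proof. by move=> /(_ 0); rewrite scale0r addr0; apply; rewrite lexx ler01. Qed.

Let segment1 (A : set V) z c : on_segment A z c -> A (z + c).
Proof. by move=> /(_ 1); rewrite scale1r; apply; rewrite lexx ler01. Qed.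

Context (gamma C M : R) (Omega K' : set V) (F : V -> W).
Hypotheses (g12 : 2^-1 < gamma) (C0 : 0 <= C) (rF : regular gamma C M Omega K' F).

Definition sewing_const : R := 4 * n%:R * C ^+ 2 / (1 - half_pow gamma).

Lemma sewing_const_ge0 : 0 <= sewing_const.
Proof.
by rewrite mulr_ge0 ?mulr_ge0 ?exprn_ge0// invr_ge0 subr_ge0 ltW// half_pow_lt1.
Qed.

(** Sewing estimate: halving a segment costs O(|c|^(2 gamma)) by [gap_add], while the bound for the
    two halves together shrinks by the factor [half_pow] < 1; [sewing_const] bounds the resulting
    geometric series. *)
Lemma refine_close k c z : on_segment K' z c ->
  `|gap F c z - refine F k c z| <= sewing_const * (`|c| `^ gamma) ^+ 2.
Proof.
elim: k c z => [|k IH] c z zc /=.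
  by rewrite subrr normr0 mulr_ge0 ?sewing_const_ge0 ?exprn_ge0 ?powR_ge0.
have [zc1 zc2] := segment_halves zc.
set d := 2^-1 *: c; have I1 := IH _ _ zc1; have I2 := IH _ _ zc2.
have G : `|gap F c z - gap F d z - gap F d (z + d)| <= 4 * n%:R * (C * `|d| `^ gamma) ^+ 2.
  rewrite -[X in gap F X z - _](halfD c); apply: (gap_add rF).
  - exact: segment0 zc1.
  - exact: segment0 zc2.
  - exact: segment1 zc2.
have dE : (`|d| `^ gamma) ^+ 2 = 2^-1 * half_pow gamma * (`|c| `^ gamma) ^+ 2.
  rewrite normrZ ger0_norm ?invr_ge0// powRM ?invr_ge0// exprMn; congr (_ * _).
  have n20 : (2^-1 : R) != 0 by rewrite invr_eq0.
  rewrite /half_pow expr2 -powRD; last by apply/implyP.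
  rewrite -[X in _ = X * _]powRr1 ?invr_ge0// -powRD; last by apply/implyP.
  by congr (_ `^ _); ring.
have h1 := half_pow_lt1 g12; have h0 := half_pow_ge0 gamma.
have cg : 0 <= (`|c| `^ gamma) ^+ 2 by rewrite exprn_ge0// powR_ge0.
have -> : gap F c z - (refine F k d z + refine F k d (z + d)) =
  (gap F c z - gap F d z - gap F d (z + d)) + (gap F d z - refine F k d z) +
  (gap F d (z + d) - refine F k d (z + d)) by ring.
rewrite (le_trans (ler_normD _ _))// (le_trans (lerD (ler_normD _ _) (lexx _)))//.
rewrite (le_trans (lerD (lerD G I1) I2))// exprMn dE.
have SE : 4 * n%:R * C ^+ 2 = sewing_const * (1 - half_pow gamma).
  by rewrite /sewing_const divfK// gt_eqF// subr_gt0.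
have S0 := sewing_const_ge0.
set h := half_pow gamma in h1 h0 SE *; set S := sewing_const in SE S0 *.
set u := (`|c| `^ gamma) ^+ 2 in cg *.
rewrite (_ : 4 * n%:R * (C ^+ 2 * (2^-1 * h * u)) =
  (4 * n%:R * C ^+ 2) * (2^-1 * h * u)); last by ring.
rewrite SE (_ : _ + _ = S * u * (h * (1 - h) / 2 + h)); last by field.
have Su0 : 0 <= S * u by exact: mulr_ge0.
by rewrite ler_piMr// half_gap_le1.
Qed.

Lemma refine_continuous k c z : on_segment Omega z c -> {for z, continuous (refine F k c)}.
Proof.
elim: k c z => [|k IH] c z zc.
  by apply: (gap_continuous rF); [exact: segment0 zc|exact: segment1 zc].
have [zc1 zc2] := segment_halves zc.
have c2 : {for z, continuous (fun y : V => refine F k (2^-1 *: c) (y + 2^-1 *: c))}.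
  apply: (@continuous_comp _ _ _ (fun y : V => y + 2^-1 *: c) (refine F k (2^-1 *: c)) z).
    exact: shift_continuous.
  exact: IH.
exact: (continuousD (IH _ _ zc1) c2).
Qed.

Section RefineIntegral.
Context (K1 : set V) (R0 : R) (v : V) (psi : V -> R) (G : R -> R) (s0 : R).
Hypotheses (cK1 : closed K1) (K1R : forall x, K1 x -> `|x| <= R0).
Hypothesis K1O : K1 `<=` Omega.
Hypothesis cpsi : continuous psi.
Hypothesis psi_supp : forall z, psi z != 0 -> on_segment K1 z v.
Hypothesis base : forall tau s, 0 <= tau -> 0 < s -> tau + s <= 1 -> s <= s0 ->
  `|gap_integral F (fun z => psi (z - tau *: v)) (s *: v)| <= G s.

Let shift_psi_supp tau s z : 0 <= tau -> 0 <= s -> tau + s <= 1 ->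
  psi (z - tau *: v) != 0 -> on_segment K1 z (s *: v).
Proof.
move=> t0 ss0 ts1 pz t /andP[tt0 tt1].
have -> : z + t *: (s *: v) = (z - tau *: v) + (tau + t * s) *: v.
  by rewrite scalerDl scalerA addrA subrK.
apply: (psi_supp pz); apply/andP; split; nra.
Qed.

(** The integrand lives on the closed set of base points whose segment stays in [K1], and there
    [refine] is continuous. *)
Lemma cont_supp_refine k tau s : 0 <= tau -> 0 <= s -> tau + s <= 1 ->
  cont_supp R0 (fun z => psi (z - tau *: v) * refine F k (s *: v) z).
Proof.
move=> t0 ss0 ts1.
pose T := [set z | on_segment K1 z (s *: v)].
have cT : closed T.
  have -> : T = \bigcap_(t in [set t : R | 0 <= t <= 1]) (fun z => z + t *: (s *: v)) @^-1` K1.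
    by apply/seteqP; split=> z zT t t01; exact: zT.
  apply: closed_bigI => t _.
  have := @closed_comp _ _ (fun z : V => z + t *: (s *: v)) K1.
  by apply=> // x _; exact: shift_continuous.
apply: (cont_supp_mul (K := T)) => //.
- by move=> z /segment0; exact: K1R.
- move=> z; apply: (@continuous_comp _ _ _ (fun y : V => y - tau *: v) psi z).
    exact: shift_continuous.
  exact: cpsi.
- by move=> z zT; apply/eqP; apply: contra_notT zT; exact: shift_psi_supp.
- by move=> z zT; apply: refine_continuous => t t01; apply: K1O; exact: zT.
Qed.

(** The integral splits into 2^k gap integrals of step s 2^-k, each against a translate of [psi]
    along [v]; hence [base] is assumed for all these translates. *)
Lemma refine_integral k tau s : 0 <= tau -> 0 < s -> tau + s <= 1 -> s * 2^-1 ^+ k <= s0 ->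
  `|\int[lebesgue_rV]_z (psi (z - tau *: v) * refine F k (s *: v) z)| <=
  2 ^+ k * G (s * 2^-1 ^+ k).
Proof.
elim: k tau s => [|k IH] tau s t0 ss0 ts1 sk.
  by rewrite expr0 mulr1 mul1r; apply: base; rewrite // expr0 mulr1 in sk.
pose h := 2^-1 * s; pose c := h *: v.
have h0 : 0 < h by rewrite mulr_gt0// invr_gt0.
have hh : h + h = s by rewrite /h; field.
have cE : 2^-1 *: (s *: v) = c by rewrite scalerA.
have th1 : tau + h + h <= 1 by rewrite -addrA hh.
have th1' : tau + h <= 1 by lra.
have th0 : 0 <= tau + h by rewrite addr_ge0// ltW.
have hk : h * 2^-1 ^+ k = s * 2^-1 ^+ k.+1 by rewrite /h exprS; ring.
have S1 := cont_supp_refine k t0 (ltW h0) th1'.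
have S2 := cont_supp_refine k th0 (ltW h0) th1.
have S3 := cont_supp_shift (lexx `|c|) S2.
have R0c : R0 <= R0 + `|c| by rewrite lerDl.
have -> : \int[lebesgue_rV]_z (psi (z - tau *: v) * refine F k.+1 (s *: v) z) =
  \int[lebesgue_rV]_z (psi (z - tau *: v) * refine F k c z) +
  \int[lebesgue_rV]_z (psi (z - (tau + h) *: v) * refine F k c z).
  (* Translation by [c] trades the base point [z + c] of the second half for a further shift of
     [psi] by [h *: v]. *)
  rewrite -(Rintegral_shift c S2) -(Rintegral_suppD (cont_supp_le R0c S1) S3).
  apply: eq_Rintegral => z _ /=; rewrite cE mulrDr.
  have -> : z + c - (tau + h) *: v = z - tau *: v.
    by rewrite /c scalerDl opprD addrACA subrr addr0.
  by [].
rewrite (le_trans (ler_normD _ _))// exprS -mulrA mulr_natl mulr2n -hk.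
by apply: lerD; apply: IH; rewrite // hk.
Qed.

End RefineIntegral.
End Refinement.

(** * From a vanishing pullback to a pointwise bound on the gap *)

Section VanishingPullback.
Context (R : realType) (m n : nat).
Local Notation V := 'rV[R]_m.+1.
Local Notation W := 'rV[R]_(2 * n).+1.
Context (gamma : R) (Omega : set V) (f : V -> W) (F : R -> V -> W).
Hypotheses (g12 : 2^-1 < gamma) (g1 : gamma <= 1).
Hypothesis FH : smooth_approximation gamma Omega f F.
Hypothesis pull : forall phi : V -> 'M[R]_(m, m.+1) -> R,
  compactly_supported_form Omega phi ->
  distributional_pullback gamma Omega (@contact_form R n) f phi 0.

(** [chi] times [det_form v] is an admissible test form, and pairing it with the pullback isolates
    the direction [v]. *)
Lemma vanishing_density (K : set V) (chi : V -> R) (v : V) :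
  compact K -> K `<=` Omega -> Cinf chi -> (forall x, ~ K x -> chi x = 0) ->
  \int[lebesgue_rV]_x (chi x * contact_density (F eps) v x) @[eps --> 0^'+] --> 0.
Proof.
move=> cK KO Cchi chi0; have [Fsm _ _] := FH.
pose phi x A := chi x * det_form v A.
have cphi : compactly_supported_form Omega phi.
  split=> [x _|A|]; first exact: det_form_alternating.
    apply: (Cinf_smooth_on (g := fun x => chi x * det_form v A)) => k.
    by apply: CkM; [exact: Cchi|exact: Ck_cst].
  by exists K; split=> // x _ Kx A; rewrite /phi chi0// mul0r.
have [_ /(_ F FH) lim0] := pull cphi.
have pos : \forall eps \near (0 : R)^'+, 0 < eps by exact: nbhs_right_gt.
have E : {near (0 : R)^'+, (fun eps => integral_form Omega
    (fun x => wedge1 (pullback1 (F eps) (@contact_form R n) x) (phi x))) =1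
    (fun eps => \int[lebesgue_rV]_x (chi x * contact_density (F eps) v x))}.
  apply: filterS pos => eps e0; rewrite /integral_form Rintegral_mkcond.
  apply: eq_Rintegral => x _; rewrite patchE; case: ifPn => Ox; last first.
    by rewrite chi0 ?mul0r// => /KO Ox'; move: Ox; rewrite mem_set.
  have dF : differentiable (F eps) x.
    by apply: (Fsm eps e0 [::]); move: Ox; rewrite inE.
  rewrite wedge1_det_form /contact_density ?deriveE// /pullback1.
    by move=> u w; rewrite linearD contact_formD.
  by move=> c u; rewrite linearZ contact_formZ.
exact: cvg_trans (near_eq_cvg E) lim0.
Qed.

Context (C M r R0 : R) (K K' : set V).
Hypotheses (C0 : 0 <= C) (M0 : 0 <= M).
Hypotheses (r0 : 0 < r) (cK : compact K) (cK' : compact K').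
Hypothesis KR : forall x, K x -> `|x| <= R0.
Hypothesis K'O : K' `<=` Omega.
Hypothesis KK' : forall x y, K x -> `|y - x| <= r -> K' y.
Hypothesis rf : regular gamma C M Omega K' f.
Hypothesis rF : forall eps, 0 < eps -> regular gamma C M Omega K' (F eps).

Let K_K' : K `<=` K'.
Proof. by move=> x Kx; apply: (KK' Kx); rewrite subrr normr0 ltW. Qed.

Let q0 : 0 < 2 * gamma - 1.
Proof. by rewrite subr_gt0 mulrC -ltr_pdivrMr// mul1r. Qed.

(** By contradiction: if the gap exceeded the sewing bound [B] at [x], it would do so, with constant
    sign, on a small ball. Against a bump on that ball the excess has positive integral, yet
    [refine_close] bounds it by the integral of the refined sum, which tends to 0 as the subdivision
    gets finer. *)
Lemma vanishing_gap_bound (x v : V) (delta : R) : 0 < delta ->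
  (forall z, `|z - x| <= delta -> on_segment K z v) ->
  `|gap f v x| <= sewing_const n gamma C * (`|v| `^ gamma) ^+ 2.
Proof.
move=> d0 tube; set B := _ * _; rewrite leNgt; apply/negP => gB.
have B0 : 0 <= B by rewrite mulr_ge0 ?sewing_const_ge0// exprn_ge0// powR_ge0.
pose sg := Num.sg (gap f v x).
have gE : sg * gap f v x = `|gap f v x| by rewrite normrEsg.
have sg1 : `|sg| = 1.
  by rewrite normr_sg; case: eqP gB => // ->; rewrite normr0 ltNge B0.
have seg0 : on_segment K x v by apply: tube; rewrite subrr normr0 ltW.
have Kx : K x by have := seg0 0; rewrite scale0r addr0; apply; rewrite lexx ler01.
have Kxv : K (x + v) by have := seg0 1; rewrite scale1r; apply; rewrite lexx ler01.
have [e [e0 ed eB]] : exists e, [/\ 0 < e, e <= delta &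
    forall z, `|z - x| < e -> B < sg * gap f v z].
  have cg : {for x, continuous (fun z => sg * gap f v z)}.
    apply: (continuousM (@cst_continuous V R sg x)).
    by apply: (gap_continuous rf); apply: K'O; exact: K_K'.
  have := cg; move=> /cvgr_gt/(_ B); rewrite gE => /(_ gB)/nbhs_ballP[e /= e0 eB].
  exists (Num.min e delta); split; first by rewrite lt_min e0.
    by rewrite ge_min lexx orbT.
  move=> z; rewrite lt_min => /andP[ze _]; apply: eB.
  by rewrite -ball_normE /ball_/= distrC.
(* Supported where the excess persists and where, by [tube], the whole segment along [v] stays in
   [K]. *)
pose psi z := bump (e^-1 *: (z - x)).
have ei0 : 0 < e^-1 by rewrite invr_gt0.
have psi_ge0 z : 0 <= psi z by exact: bump_ge0.
have psi_neq0 z : psi z != 0 -> `|z - x| < e.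
  apply: contra_neqT; rewrite -leNgt => ez; apply: bump_supp.
  by rewrite normrZ gtr0_norm// mulrC ler_pdivlMr// mul1r.
have psi_seg z : psi z != 0 -> on_segment K z v.
  by move=> /psi_neq0 ze; apply: tube; rewrite (le_trans (ltW ze)).
have Cpsi tau : Cinf (fun z => psi (z - tau *: v)).
  have := Cinf_bump e^-1 (- (e^-1 *: (tau *: v + x))).
  by congr Cinf; apply/funext => z; rewrite /psi -scalerBr opprD addrA.
have psiK tau z : 0 <= tau -> tau <= 1 -> ~ K z -> psi (z - tau *: v) = 0.
  move=> t0 t1 Kz; apply/eqP; apply: contra_notT Kz => /psi_seg/(_ tau).
  by rewrite subrK; apply; rewrite t0.
have cpsi : continuous psi.
  move=> z; have := differentiable_continuous (Ck_diff (Cpsi 0 0%N) z).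
  by under [X in continuous_at _ X -> _]eq_fun do rewrite scale0r subr0.
have [L L0 bL] := bump_lipschitz R m.+1.
have test tau : 0 <= tau -> tau <= 1 ->
    test_fun K 1 (L * (e^-1 * `|v|)) v (fun z => psi (z - tau *: v)).
  move=> t0 t1; split.
  - move=> z; apply: (@continuous_comp _ _ _ (fun y : V => y - tau *: v) psi z).
      exact: shift_continuous.
    exact: cpsi.
  - by move=> z Kz; exact: psiK.
  - move=> z; rewrite ger0_norm// /psi /bump; apply: prodr_ile1 => i _.
    by rewrite bump1_ge0 bump1_le1.
  - move=> z s; rewrite /psi (le_trans (bL _ _))// -scalerBr -mulrA ler_wpM2l//.
    rewrite normrZ gtr0_norm// -mulrA ler_wpM2l ?(ltW ei0)//.
    rewrite (_ : _ - _ = s *: v) ?normrZ 1?mulrC//.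
    by rewrite opprB addrA subrK opprB addrA subrK addrC addKr.
set D := step_const n gamma C M r R0 1 (L * (e^-1 * `|v|)) v / (1 - half_pow gamma).
(* Translates of [psi] by [tau *: v] with [tau] in [0, 1] still vanish off [K], so
   [gap_integral_small] applies to all of them with one constant [D]. *)
have base tau s : 0 <= tau -> 0 < s -> tau + s <= 1 -> s <= r / (`|v| + 1) ->
    `|gap_integral f (fun z => psi (z - tau *: v)) (s *: v)| <=
    D * s `^ (2 * gamma - 1) * s.
  move=> t0 s0 ts1 sr; have t1 : tau <= 1 by lra.
  apply: (gap_integral_small g12 g1 FH C0 M0 r0 cK cK' KR K'O KK' rf rF ler01 _ (test tau t0 t1)).
  - by rewrite !mulr_ge0// ltW.
  - apply: (vanishing_density v cK _ (Cpsi tau)) => [z /K_K'/K'O //|z].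
    exact: psiK.
  - exact: s0.
  - by lra.
  - by move: sr; rewrite ler_pdivlMr ?ltr_wpDl// mulrDr mulr1; lra.
have KO : K `<=` Omega by move=> z /K_K'/K'O.
have Kcl := compact_closed_rV cK.
pose J k := \int[lebesgue_rV]_z (psi z * refine f k v z).
(* There are 2^k pieces, each of order 2^-k (2^-k)^(2 gamma - 1), which leaves the factor
   [half_pow gamma ^+ k]. *)
have Jle k : 2^-1 ^+ k <= r / (`|v| + 1) -> `|J k| <= D * half_pow gamma ^+ k.
  move=> kr; have := refine_integral rf Kcl KR KO cpsi psi_seg base (k := k) (lexx 0) ltr01.
  rewrite add0r mul1r => /(_ (lexx 1) kr).
  rewrite powR_exprn ?invr_ge0// -/(half_pow gamma).
  have -> : 2 ^+ k * (D * half_pow gamma ^+ k * 2^-1 ^+ k) = D * half_pow gamma ^+ k.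
    have e1 : 2^-1 ^+ k * 2 ^+ k = 1 :> R by rewrite -exprMn mulVf ?expr1n.
    by transitivity (D * half_pow gamma ^+ k * (2^-1 ^+ k * 2 ^+ k)); [ring|rewrite e1 mulr1].
  apply: le_trans; rewrite le_eqVlt; apply/orP; left; apply/eqP; congr `|_|.
  by apply: eq_Rintegral => z _; rewrite scale0r subr0 scale1r.
have sJ k : cont_supp R0 (fun z => psi z * refine f k v z).
  have := cont_supp_refine rf Kcl KR KO cpsi psi_seg k (lexx 0) ler01.
  rewrite add0r => /(_ (lexx 1)).
  by congr cont_supp; apply/funext => z; rewrite scale0r subr0 scale1r.
have spsi : cont_supp R0 psi.
  split=> // z zR; apply: contraTeq zR => /psi_seg/(_ 0).
  by rewrite scale0r addr0 lexx ler01 -leNgt => /(_ isT)/KR.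
have sB : cont_supp R0 (fun z => B * psi z) by exact: cont_suppZ.
have sg0 := cont_suppZ sg (sJ 0%N).
have pos : 0 < \int[lebesgue_rV]_z (sg * (psi z * refine f 0 v z) - B * psi z).
  apply: (Rintegral_gt0 (x := x) (cont_suppB sg0 sB)) => [z|] /=.
    have [->|pz] := eqVneq (psi z) 0; first by rewrite !(mul0r, mulr0) subrr.
    rewrite mulrCA [B * _]mulrC -mulrBr mulr_ge0// subr_ge0 ltW// eB//; exact: psi_neq0.
  by rewrite /psi subrr scaler0 bump_0 mul1r mulr1 subr_gt0 gE.
(* On the support of [psi] the gap and its refinement differ by at most [B], so the signed gap minus
   [B] is at most the signed refinement. *)
have le_k k : \int[lebesgue_rV]_z (sg * (psi z * refine f 0 v z) - B * psi z) <= `|J k|.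
  have sgk := cont_suppZ sg (sJ k).
  apply: (@le_trans _ _ (\int[lebesgue_rV]_z (sg * (psi z * refine f k v z)))); last first.
    rewrite (Rintegral_suppZ _ (sJ k)) (le_trans (ler_norm _))// normrM sg1 mul1r//.
  apply: le_Rintegral => //.
  - exact: cont_supp_integrable (cont_suppB sg0 sB).
  - exact: cont_supp_integrable sgk.
  move=> z _ /=; have [->|pz] := eqVneq (psi z) 0; first by rewrite !(mul0r, mulr0) subrr.
  have close := refine_close g12 C0 rf k (fun t t01 => K_K' (psi_seg z pz t t01)).
  have : sg * (gap f v z - refine f k v z) <= B.
    by rewrite (le_trans (ler_norm _))// normrM sg1 mul1r.
  rewrite -subr_ge0 => h; rewrite -subr_ge0.
  rewrite (_ : _ - _ = psi z * (B - sg * (gap f v z - refine f k v z))); last by rewrite /=; ring.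
  exact: mulr_ge0.
have h0 := half_pow_ge0 gamma; have h1 := half_pow_lt1 g12.
have lim_h : D * half_pow gamma ^+ k @[k --> \oo] --> (0 : R).
  by apply: cvg_geometric; rewrite ger0_norm.
have lim_2 : 1 * 2^-1 ^+ k @[k --> \oo] --> (0 : R).
  by apply: cvg_geometric; rewrite ger0_norm ?invr_ge0// invf_lt1// ltr1n.
have rv0 : 0 < r / (`|v| + 1) by rewrite divr_gt0// ltr_wpDl.
set X := \int[lebesgue_rV]_z _ in pos le_k.
have near1 : \forall k \near \oo, D * half_pow gamma ^+ k < X.
  by apply: (cvgr_lt 0 lim_h).
have near2 : \forall k \near \oo, 1 * 2^-1 ^+ k < r / (`|v| + 1).
  by apply: (cvgr_lt 0 lim_2).
near \oo => k.
have k1 : D * half_pow gamma ^+ k < X by near: k.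
have k2 : 1 * 2^-1 ^+ k < r / (`|v| + 1) by near: k.
rewrite mul1r in k2.
have := le_lt_trans (Jle k (ltW k2)) k1.
by rewrite ltNge le_k.
Unshelve. all: by end_near. Qed.

End VanishingPullback.

(** Pairs at distance at most r1 / 2 are joined by a segment inside [K1], and [vanishing_gap_bound]
    applies. For distant pairs boundedness of [f] suffices, as |y - x|^gamma is then at least
    [rho]. *)
Lemma pullback_eq0_koranyi (R : realType) (n m : nat) (gamma : R)
    (Omega : set 'rV[R]_m.+1) (f : 'rV[R]_m.+1 -> 'rV[R]_(2 * n).+1) :
  2^-1 < gamma -> gamma <= 1 -> open Omega ->
  holder_loc (@eucl_dist R (2 * n).+1) gamma Omega f ->
  (forall phi : 'rV[R]_m.+1 -> 'M[R]_(m, m.+1) -> R,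
     compactly_supported_form Omega phi ->
     distributional_pullback gamma Omega (@contact_form R n) f phi 0) ->
  holder_loc (@koranyi_dist R n) gamma Omega f.
Proof.
move=> g12 g1 oO fH pull K cK KO.
have g0 : 0 < gamma by apply: lt_trans g12; rewrite invr_gt0.
have [F FH] := exists_smooth_approximation g0 g1 oO fH.
(* [K1] makes room for the segments between nearby points of [K], which may leave [K]; [K2] makes
   room for the steps of the gap integrals over [K1]. *)
have [r1 [K1 [r10 cK1 K1O KK1]]] := compact_nbhs oO cK KO.
have [r2 [K2 [r20 cK2 K2O KK2]]] := compact_nbhs oO cK1 K1O.
have [C [M [C0 M0 rf rF]]] := approximation_regular g12 oO fH FH cK2 K2O.
have [R0 K1R] := compact_norm_le cK1.
have K_K2 x : K x -> K2 x.
  move=> Kx; apply: (KK2 x); last by rewrite subrr normr0 ltW.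
  by apply: (KK1 x) => //; rewrite subrr normr0 ltW.
have [_ fC fM] := rf.
have fCK : holder_sup gamma C K f by move=> x y /K_K2 Kx /K_K2 Ky; exact: fC.
pose rho := (r1 / 2) `^ gamma.
have r12 : 0 < r1 / 2 by rewrite divr_gt0.
have rho0 : 0 < rho by exact: powR_gt0.
pose H1 := sewing_const n gamma C.
have H10 : 0 <= H1 by exact: sewing_const_ge0.
pose Q := (1 + 4 * n%:R * M) * (M + M).
have Q0 : 0 <= Q by rewrite !mulr_ge0 ?addr_ge0// !mulr_ge0.
have QR : 0 <= Q / rho ^+ 2 by rewrite divr_ge0// sqr_ge0.
apply: (contact_holder_koranyi (H := H1 + Q / rho ^+ 2) (ltW g0) C0 _ fCK); first exact: addr_ge0.
move=> x y Kx Ky; set u := `|y - x| `^ gamma.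
have u20 : 0 <= u ^+ 2 by exact: sqr_ge0.
have [yx|yx] := leP `|y - x| (r1 / 2).
  have tube z : `|z - x| <= r1 / 2 -> on_segment K1 z (y - x).
    move=> zx t /andP[t0 t1]; apply: (KK1 x) => //.
    rewrite addrAC (le_trans (ler_normD _ _))// normrZ ger0_norm//.
    have : t * `|y - x| <= `|y - x| by rewrite ler_piMl.
    by lra.
  have := vanishing_gap_bound g12 g1 FH pull C0 M0 r20 cK1 cK2 K1R K2O KK2 rf rF r12 tube.
  rewrite /gap (addrC x) subrK => /le_trans; apply.
  by rewrite ler_wpM2r// lerDl.
apply: (@le_trans _ _ Q).
  rewrite (le_trans (contact_form_le _ _))// ler_pM//.
    by rewrite lerD2l ler_wpM2l// fM//; exact: K_K2.
  by rewrite (le_trans (ler_normB _ _))// lerD// fM//; exact: K_K2.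
apply: (@le_trans _ _ (Q / rho ^+ 2 * u ^+ 2)); last by rewrite ler_wpM2r// lerDr.
rewrite mulrAC ler_pdivlMr ?exprn_gt0// ler_wpM2l// lerXn2r ?nnegrE ?powR_ge0//.
by apply: (ge0_ler_powR (ltW g0)); rewrite ?nnegrE// ltW.
Qed.

Theorem theorem7p4 (R : realType) (n m : nat) (gamma : R)
    (Omega : set 'rV[R]_m.+1) (f : 'rV[R]_m.+1 -> 'rV[R]_(2 * n).+1) :
  2^-1 < gamma -> gamma <= 1 ->
  open Omega ->
  holder_loc (@eucl_dist R (2 * n).+1) gamma Omega f ->
  (holder_loc (@koranyi_dist R n) gamma Omega f <->
   forall phi : 'rV[R]_m.+1 -> 'M[R]_(m, m.+1) -> R,
     compactly_supported_form Omega phi ->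
     distributional_pullback gamma Omega (@contact_form R n) f phi 0).
Proof.
move=> g12 g1 oO fH; split=> [fK phi cphi|pull].
  exact: koranyi_pullback_eq0.
exact: pullback_eq0_koranyi.
Qed.
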